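(* Let $(X,d,\mu,\mathcal{E},\mathcal{F})$ be a Dirichlet space satisfying the standing assumptions (A1)–(A3), (HK), (BE) stated in the context, and let $0<\delta<1$. Assume $\alpha_1^{\#}<1$. Then $\mathbf{B}^{1,\alpha_1^{\#}}(X)=BV(X)$ and there exist constants $c,C>0$ such that for every $f\in BV(X)$, $$c\,\mathbf{Var}(f)\le\|f\|_{1,\frac1\delta\left(1-\frac{\kappa}{d_W}\right)}\le C\,\mathbf{Var}(f).$$
   Context: Setting. $(X,d,\mu)$ is a locally compact metric measure space, $\mu$ a Radon measure supported on $X$, and $(\mathcal{E},\mathcal{F})$ is a Dirichlet form on $L^2(X,\mu)$ with heat semigroup $\{P_t\}_{t>0}$ and generator $L$. Write $B(x,r)=\{y: d(x,y)<r\}$. For $\lambda>0$, $1\le p<\infty$, $KS^{\lambda,p}(X)$ is the set of $f\in L^p(X,\mu)$ with $\limsup_{r\to0^+}\int_X\int_{B(x,r)}\frac{|f(x)-f(y)|^p}{r^{\lambda p}\mu(B(x,r))}d\mu(y)d\mu(x)<\infty$. Standing assumptions. (A1) Every ball $B(x,r)$ has compact closure. (A2) There are $c_1,c_2,d_H>0$ with $c_1r^{d_H}\le\mu(B(x,r))\le c_2r^{d_H}$ for all $x\in X$, $r\ge0$. (A3) $(\mathcal{E},\mathcal{F})$ is regular and strongly local. (HK) $\{P_t\}$ has a continuous heat kernel $p_t(x,y)$ and there are $c_3,c_4,c_5,c_6\in(0,\infty)$, $d_W\in[2,\infty)$ with $c_5t^{-d_H/d_W}\exp(-c_6(d(x,y)^{d_W}/t)^{1/(d_W-1)})\le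 p_t(x,y)\le c_3t^{-d_H/d_W}\exp(-c_4(d(x,y)^{d_W}/t)^{1/(d_W-1)})$ for $\mu\times\mu$-a.e. $(x,y)$ and every $t>0$. (BE) There is $C>0$ such that $|P_tg(x)-P_tg(y)|\le C\frac{d(x,y)^\kappa}{t^{\kappa/d_W}}\|g\|_{L^\infty(X,\mu)}$ for all $t>0$, $g\in L^\infty(X,\mu)$, $x,y\in X$, where $0<\kappa<d_W$ is defined by $d_W-\kappa=\sup\{\lambda>0: KS^{\lambda,1}(X)\text{ contains non-constant functions}\}$. Subordinated semigroup. For fixed $0<\delta<1$ let $\eta^{(\delta)}_t\ge0$ be the continuous function with $\int_0^\infty\eta^{(\delta)}_t(s)e^{-s\lambda}ds=e^{-t\lambda^\delta}$ for $\lambda>0$. The semigroup with generator given by the fractional Laplacian $(-L)^\delta$ is $P^{(\delta)}_tf=\int_0^\infty\eta^{(\delta)}_t(s)P_sf\,ds$, with heat kernel $p^{(\delta)}_t(x,y)=\int_0^\infty\eta^{(\delta)}_t(s)p_s(x,y)ds$. Besov classes. For $p\ge1$, $\alpha\ge0$: $\|f\|_{p,\alpha}=\sup_{t>0}t^{-\alpha}\left(\int_X\int_X|f(x)-f(y)|^pp^{(\delta)}_t(x,y)d\mu(x)d\mu(y)\right)^{1/p}$ and $\mathbf{B}^{p,\alpha}(X)=\{f\in L^p(X,\mu):\|f\|_{p,\alpha}<\infty\}$. The $L^1$ critical exponent is $\alpha_1^{\#}=\sup\{\alpha>0:\mathbf{B}^{1,\alpha}(X)\text{ contains non-constant functions}\}$;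 the condition $\alpha_1^{\#}<1$ is equivalent to $\delta>1-\frac{\kappa}{d_W}$, in which case $\alpha_1^{\#}=\frac1\delta(1-\frac{\kappa}{d_W})$. BV functions. $BV(X)=KS^{d_W-\kappa,1}(X)$ and $\mathbf{Var}(f)=\liminf_{r\to0^+}\int_X\int_{B(x,r)}\frac{|f(y)-f(x)|}{r^{d_W-\kappa}\mu(B(x,r))}d\mu(y)d\mu(x)$. *)

(* Defs.v *)
Set Warnings "-notation-overridden,-notation-incompatible-prefix,-ambiguous-paths".
From HB Require Import structures.
From mathcomp Require Import all_boot all_order all_algebra.
From mathcomp Require Import all_classical all_reals all_analysis.

Set Implicit Arguments.
Unset Strict Implicit.
Unset Printing Implicit Defensive.

Import Order.TTheory GRing.Theory Num.Theory.
Import numFieldNormedType.Exports.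

Local Open Scope classical_set_scope.
Local Open Scope ring_scope.

HB.mixin Record isBorelMetric (R : realType) (d : measure_display) T
    & Metric R T & Measurable d T := {
  measurable_borelE : @measurable d T = <<s (@open T) >>
}.

#[short(type="borelMetricType")]
HB.structure Definition BorelMetric (R : realType) (d : measure_display) :=
  {T of Metric R T & Measurable d T & isBorelMetric R d T}.

(* Elements of L^p spaces are represented by measurable functions; [Lfun mu p]
   is the set of measurable functions with finite L^p norm.  Every notion below
   is therefore formulated so as to be stable under mu-a.e. equality. *)

Section MetricMeasureSpace.
Context (R : realType) (d : measure_display) (X : borelMetricType R d).
Variable mu : {sigma_finite_measure set X -> \bar R}.

Definition radon : Prop :=
  [/\ forall K : set X, compact K -> (mu K < +oo)%E,
      forall A : set X, measurable A ->
        mu A = ereal_inf [set mu U | U in [set U | open U /\ A `<=` U]]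
    & forall U : set X, open U ->
        mu U = ereal_sup [set mu K | K in [set K | compact K /\ K `<=` U]]].

Definition fully_supported : Prop :=
  forall U : set X, open U -> U !=set0 -> (0 < mu U)%E.

Definition proper_balls : Prop :=
  forall (x : X) (r : R), compact (closure (ball x r)).

Definition ahlfors_regular (dH : R) : Prop :=
  exists c1 c2 : R, [/\ 0 < c1, 0 < c2
    & forall (x : X) (r : R), 0 <= r ->
        ((c1 * r `^ dH)%:E <= mu (ball x r) <= (c2 * r `^ dH)%:E)%E].

Definition ae_constant (f : X -> R) : Prop := exists c : R, f = cst c %[ae mu].

Definition L2dot (f g : X -> R) : R := \int[mu]_x (f x * g x).

(* The topological support of the measure f dmu. *)
Definition msupport (f : X -> R) : set X :=
  [set x | forall U : set X, open U -> U x ->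
     ~ {ae mu, forall y, U y -> f y = 0}].

Definition continuous_compact_support (f : X -> R) : Prop :=
  continuous f /\ compact (closure [set x | f x != 0]).

Section DirichletForm.
Variables (F : set (X -> R)) (E : (X -> R) -> (X -> R) -> R).

Definition energy1 (f : X -> R) : R := E f f + L2dot f f.

Record dirichlet_form : Prop := {
  dform_L2 : forall f, F f -> f \in Lfun mu 2%:E ;
  dform_ae : forall f g : X -> R, F f -> measurable_fun setT g -> f = g %[ae mu] ->
    F g /\ forall h, F h -> E f h = E g h ;
  dform_domain0 : F (cst 0) ;
  dform_domainP : forall (a : R) f g, F f -> F g -> F (a *: f + g) ;
  dform_dense : forall f, f \in Lfun mu 2%:E -> forall e : R, 0 < e ->
    exists2 g, F g & ('N[mu]_2%:E[EFin \o (f - g)%R] < e%:E)%E ;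
  dform_linear : forall (a : R) f g h, F f -> F g -> F h ->
    E (a *: f + g) h = a * E f h + E g h ;
  dform_sym : forall f g, F f -> F g -> E f g = E g f ;
  dform_ge0 : forall f, F f -> 0 <= E f f ;
  dform_closed : forall u : nat -> X -> R, (forall n, F (u n)) ->
    (forall e : R, 0 < e -> exists N, forall m n, (N <= m)%N -> (N <= n)%N ->
      energy1 (u m - u n) < e) ->
    exists2 v, F v & energy1 (u n - v) @[n --> \oo] --> (0 : R) ;
  dform_markov : forall f, F f ->
    let g x := Num.min (Num.max (f x) 0) 1 in F g /\ E g g <= E f f
}.

Definition regular_form : Prop :=
  (forall f, F f -> forall e : R, 0 < e ->
     exists g, [/\ F g, continuous_compact_support g & energy1 (f - g) < e]) /\
  (forall f, continuous_compact_support f -> forall e : R, 0 < e ->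
     exists g, [/\ F g, continuous_compact_support g
                 & forall x, `|f x - g x| < e]).

Definition strongly_local : Prop :=
  forall f g, F f -> F g -> compact (msupport f) -> compact (msupport g) ->
    (exists (U : set X) (c : R), [/\ open U, msupport f `<=` U
       & {ae mu, forall x, U x -> g x = c}]) ->
    E f g = 0.

End DirichletForm.

(* f lies in the domain of the L^2 generator L of P, and L f = h. *)
Definition generator (P : R -> (X -> R) -> X -> R) (f h : X -> R) : Prop :=
  [/\ f \in Lfun mu 2%:E, h \in Lfun mu 2%:E &
      ('N[mu]_2%:E[EFin \o (t^-1 *: (P t f - f) - h)%R])%E @[t --> 0^'+] --> 0%E].

(* P is the strongly continuous semigroup of symmetric contractions of
   L^2(X, mu) whose generator L is the self-adjoint operator of (E, F):
   E(f, g) = - <L f, g>. *)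
Record heat_semigroup (F : set (X -> R)) (E : (X -> R) -> (X -> R) -> R)
    (P : R -> (X -> R) -> X -> R) : Prop := {
  heat_L2 : forall (t : R) f, 0 < t -> f \in Lfun mu 2%:E -> P t f \in Lfun mu 2%:E ;
  heat_ae : forall (t : R) f g, 0 < t -> f \in Lfun mu 2%:E -> g \in Lfun mu 2%:E ->
    f = g %[ae mu] -> P t f = P t g %[ae mu] ;
  heat_linear : forall (t a : R) f g, 0 < t ->
    f \in Lfun mu 2%:E -> g \in Lfun mu 2%:E ->
    P t (a *: f + g) = a *: P t f + P t g %[ae mu] ;
  heat_contraction : forall (t : R) f, 0 < t -> f \in Lfun mu 2%:E ->
    ('N[mu]_2%:E[EFin \o P t f] <= 'N[mu]_2%:E[EFin \o f])%E ;
  heat_sym : forall (t : R) f g, 0 < t ->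
    f \in Lfun mu 2%:E -> g \in Lfun mu 2%:E ->
    L2dot (P t f) g = L2dot f (P t g) ;
  heat_semi : forall (s t : R) f, 0 < s -> 0 < t -> f \in Lfun mu 2%:E ->
    P (s + t) f = P s (P t f) %[ae mu] ;
  heat_cont : forall f, f \in Lfun mu 2%:E ->
    ('N[mu]_2%:E[EFin \o (P t f - f)%R])%E @[t --> 0^'+] --> 0%E ;
  heat_generator : forall f h, f \in Lfun mu 2%:E -> h \in Lfun mu 2%:E ->
    generator P f h <-> (F f /\ forall g, F g -> E f g = - L2dot h g)
}.

Definition kernel_op (k : X -> X -> R) (f : X -> R) (x : X) : R :=
  \int[mu]_y (k x y * f y).

Definition continuous_heat_kernel (P : R -> (X -> R) -> X -> R)
    (p : R -> X -> X -> R) : Prop :=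
  forall t : R, 0 < t -> continuous (fun z : X * X => p t z.1 z.2) /\
    forall f, f \in Lfun mu 2%:E -> P t f = kernel_op (p t) f %[ae mu].

Definition sub_gaussian_bounds (dH dW : R) (p : R -> X -> X -> R) : Prop :=
  exists c3 c4 c5 c6 : R, [/\ 0 < c3, 0 < c4, 0 < c5, 0 < c6 &
    forall t : R, 0 < t -> {ae (mu \x mu)%E, forall z : X * X,
      c5 * t `^ (- (dH / dW)) *
        expR (- (c6 * (mdist z.1 z.2 `^ dW / t) `^ (dW - 1)^-1))
      <= p t z.1 z.2 <=
      c3 * t `^ (- (dH / dW)) *
        expR (- (c4 * (mdist z.1 z.2 `^ dW / t) `^ (dW - 1)^-1))}].

(* On L^oo, P_t is the pointwise defined operator with kernel p_t. *)
Definition weak_bakry_emery (kappa dW : R) (p : R -> X -> X -> R) : Prop :=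
  exists2 C : R, 0 < C & forall (t : R) (g : X -> R) (x y : X),
    0 < t -> g \in Lfun mu +oo%E ->
    `|kernel_op (p t) g x - kernel_op (p t) g y| <=
      C * (mdist x y `^ kappa / t `^ (kappa / dW)) *
      fine ('N[mu]_+oo[EFin \o g])%E.

Definition KS_energy (lambda p : R) (f : X -> R) (r : R) : \bar R :=
  (\int[mu]_x \int[mu]_(y in ball x r)
    (`|f x - f y| `^ p / (r `^ (lambda * p) * fine (mu (ball x r))))%:E)%E.

Definition KS (lambda p : R) : set (X -> R) :=
  [set f | f \in Lfun mu p%:E /\
           (limf_esup (KS_energy lambda p f) 0^'+ < +oo)%E].

(* The supremum that defines d_W - kappa. *)
Definition KS_critical : \bar R :=
  ereal_sup [set lambda%:E | lambda in [set l : R | 0 < l /\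
    exists2 f, KS l 1 f & ~ ae_constant f]].

Definition BV (dW kappa : R) : set (X -> R) := KS (dW - kappa) 1.

Definition Var (dW kappa : R) (f : X -> R) : \bar R :=
  limf_einf (KS_energy (dW - kappa) 1 f) 0^'+.

(* eta t is the density at time t of the delta-stable subordinator; continuity
   and the Laplace transform determine it on ]0, +oo[. *)
Definition subordinator_density (delta : R) (eta : R -> R -> R) : Prop :=
  forall t : R, 0 < t ->
    [/\ {in `]0, +oo[, continuous (eta t)},
        forall s : R, 0 < s -> 0 <= eta t s
      & forall lambda : R, 0 < lambda ->
        (\int[lebesgue_measure]_(s in `]0%R, +oo[)
           (eta t s * expR (- (s * lambda)))%:E =
         (expR (- (t * lambda `^ delta)))%:E)%E].

Section Besov.
Variables (eta : R -> R -> R) (p : R -> X -> X -> R).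

Definition subordinated_kernel (t : R) (x y : X) : \bar R :=
  (\int[lebesgue_measure]_(s in `]0%R, +oo[) (eta t s * p s x y)%:E)%E.

Definition besov_seminorm (q alpha : R) (f : X -> R) : \bar R :=
  ereal_sup [set ((t `^ (- alpha))%:E *
    (\int[mu]_y \int[mu]_x
       ((`|f x - f y| `^ q)%:E * subordinated_kernel t x y)) `^ q^-1)%E
    | t in [set t : R | 0 < t]].

Definition besov (q alpha : R) : set (X -> R) :=
  [set f | f \in Lfun mu q%:E /\ (besov_seminorm q alpha f < +oo)%E].

Definition besov_critical : \bar R :=
  ereal_sup [set alpha%:E | alpha in [set a : R | 0 < a /\
    exists2 f, besov 1 a f & ~ ae_constant f]].

End Besov.

End MetricMeasureSpace.

(* Main.v *)
Require Import Defs.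
Set Warnings "-notation-overridden,-notation-incompatible-prefix,-ambiguous-paths".
From HB Require Import structures.
From mathcomp Require Import finmap.
From mathcomp Require Import all_boot all_order all_algebra.
From mathcomp Require Import all_classical all_reals all_analysis.
From mathcomp Require Import measurable_realfun ess_sup_inf.
From mathcomp Require Import ring lra.

(** Write osc f w for the double integral of |f x - f y| w x y, and near_diag r for
the indicator of d(x, y) < r.  Ahlfors regularity makes the Korevaar-Schoen
energy of f with parameter lambda at scale r comparable to
r^-(lambda + dH) osc f (near_diag r), so the theorem is about the growth in r of
osc f (near_diag r).

Besov seminorms see the same growth.  The stable law at time t puts a fixed
proportion of its mass on times s comparable to t^(1/delta) [eta_mass], so the
subordinated kernel at time t of order r^(delta dW) is at least c r^-dH on
d(x, y) < r; this bounds osc f (near_diag r) by the Besov seminorm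
[besov_lower].  Conversely let osc f (near_diag r) <= M r^(lambda + dH) for
every r.  Sub-Gaussian tails decay faster than any power, and a dyadic
decomposition [integral_decay_le] shows that the integral of |f x - f y| p_s(x, y)
is at most C M s^(lambda / dW).  Integrating against the stable density, whose
moment of order lambda / dW < delta at time t is of order
t^(lambda / (delta dW)) [eta_moment], bounds the Besov seminorm of exponent
lambda / (delta dW) by C M [besov_upper].  Together these two estimates say that
the Besov critical exponent, when it is below 1, is (dW - kappa) / (delta dW),
that the Besov class at this exponent is BV, and that Var f is at most a multiple
of the seminorm.

The remaining inequality needs the supremum over all scales of
r^-a osc f (near_diag r), a = dW - kappa + dH, to be bounded by its lower limit
at r = 0 [weak_monotonicity].  It is proved for sets first.  Let A have finite
measure.  The heat flow is conservative [conservation], so the integral of p_t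
over A x A^c is <1_A, 1_A - P_t 1_A>, which telescopes along t = N tau into the
terms <1_A, h - P_tau h> with h = P_(j tau) 1_A.  In each of them the
contribution of A x A cancels by symmetry, and on A x A^c the weak Bakry-Emery
estimate bounds |h x - h y| by a multiple of d(x, y)^kappa (j tau)^(-kappa / dW)
[heat_step_across_boundary, jump_telescope].  Summing over j gives, with
rho^dW = tau and for r^dW <= N tau, a bound of the integral of near_diag r over
A x A^c by N^(a / dW) times that of a power decay in d / rho
[jump_near_diag_le_decay].  The coarea formula [descent_coarea] carries this
inequality over to functions.  Cutting the decay at d = r' = Lam rho yields
  r^-a osc f (near_diag r)
    <= C (Lam^a r'^-a osc f (near_diag r') + M / Lam)
for all r' <= r and Lam >= 1, where M is the supremum on the left-hand side
[osc_comparison_of_scales].  For f in BV the supremum M is finite, so the last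
term is absorbed by choosing Lam large, and r' is taken along a sequence that
realizes the lower limit. *)

Set Implicit Arguments.
Unset Strict Implicit.
Unset Printing Implicit Defensive.

Import Order.TTheory GRing.Theory Num.Theory.
Import numFieldNormedType.Exports.

Local Open Scope classical_set_scope.
Local Open Scope ring_scope.

(** * Integrals of non-negative functions and power decay *)

Section PowerDecay.
Context (R : realType).

(** The integral of a non-negative function is a supremum over simple functions
below it, hence is monotone without any measurability.  This is what allows the
subordinated kernel to be estimated without studying the regularity in time of
the heat kernel. *)
Lemma ge0_le_integral_nomeas d (T : measurableType d)
    (mu : {measure set T -> \bar R}) (D : set T) (f g : T -> \bar R) :
  (forall x, D x -> (0 <= f x)%E) -> (forall x, D x -> (f x <= g x)%E) ->
  (\int[mu]_(x in D) f x <= \int[mu]_(x in D) g x)%E.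
Proof.
move=> f0 fg.
have g0 x : D x -> (0 <= g x)%E by move=> Dx; exact: le_trans (f0 _ Dx) (fg _ Dx).
rewrite integral_mkcond [leRHS]integral_mkcond.
rewrite ge0_integralTE; last exact: erestrict_ge0.
rewrite ge0_integralTE; last exact: erestrict_ge0.
apply: ereal_sup_le => _ [h /= hf <-]; exists h => //= x.
apply: le_trans (hf x) _; rewrite /patch; case: ifPn => // xD.
by apply: fg; rewrite inE in xD.
Qed.

Lemma measurable_natr d (T : measurableType d) (b : T -> bool) :
  measurable_fun setT b -> measurable_fun setT (fun x => (b x)%:R : R).
Proof.
move=> mb.
rewrite (_ : (fun x => _) = (fun x => if b x then 1 else 0)); last first.
  by apply/funext => x; case: (b x).
exact: measurable_fun_ifT.
Qed.

Lemma measurable_lt_natr d (T : measurableType d) (D : T -> R) (r : R) :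
  measurable_fun setT D -> measurable_fun setT (fun x => (D x < r)%R%:R : R).
Proof. by move=> mD; apply: measurable_natr; apply: measurable_fun_ltr. Qed.

Lemma ge0_integralZl_real d (T : measurableType d)
    (mu : {measure set T -> \bar R}) (D : set T) (c : R) (f : T -> R) :
  measurable D -> measurable_fun D f -> (forall x, D x -> 0 <= f x) -> 0 <= c ->
  (\int[mu]_(x in D) (c * f x)%:E = c%:E * \int[mu]_(x in D) (f x)%:E)%E.
Proof.
move=> mD mf f0 c0; under eq_integral do rewrite EFinM.
by rewrite ge0_integralZl_EFin//; exact/measurable_EFinP.
Qed.

(** A power tail without singularity at 0; with u = d(x, y) / rho it replaces the
sub-Gaussian factor of the heat kernel. *)
Definition decay (b u : R) : R := Num.max 1 u `^ (- b).

Lemma decay_ge0 b u : 0 <= decay b u.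
Proof. exact: powR_ge0. Qed.

Lemma measurable_decay d (T : measurableType d) (D : T -> R) (b c : R) :
  measurable_fun setT D -> measurable_fun setT (fun x => decay b (D x / c)).
Proof.
move=> mD; rewrite /decay.
apply: (measurableT_comp (measurable_powR (- b))).
by apply: measurable_maxr => //; apply: measurable_funM.
Qed.

Lemma decayD b c u : decay (b + c) u = decay b u * decay c u.
Proof.
rewrite /decay opprD powRD//; apply/implyP => _.
by rewrite gt_eqF// lt_max ltr01.
Qed.

Lemma decay_anti b c u : b <= c -> decay c u <= decay b u.
Proof. by move=> bc; apply: ler_powR; rewrite ?le_max ?lexx// lerN2. Qed.

Lemma decay_le1 b u : 0 <= b -> decay b u <= 1.
Proof.
move=> b0; rewrite -(powRr0 (Num.max 1 u)).
by apply: ler_powR; rewrite ?le_max ?lexx// oppr_le0.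
Qed.

Lemma dyadic_floor (u : R) : 1 <= u -> exists k : nat, 2 ^+ k <= u < 2 ^+ k.+1.
Proof.
move=> u1; have : exists n : nat, u < 2 ^+ n.
  exists (Num.truncn u).+1; apply: lt_le_trans (_ : (Num.truncn u).+1%:R <= _).
    by rewrite truncnS_gt.
  by rewrite -natrX ler_nat; apply/ltnW/ltn_expl.
case/ex_minnP => -[|k] uk kmin; first by move: uk; rewrite expr0 ltNge u1.
exists k; rewrite uk andbT leNgt; apply/negP => /kmin.
by rewrite ltnn.
Qed.

Lemma decay_le_dyadic (b u : R) : 0 <= b ->
  exists k : nat, (u < 2 ^+ k.+1) /\ decay b u <= (2 ^+ k) `^ (- b).
Proof.
move=> b0; have [u1|u1] := ltP u 1.
  exists 0%N; rewrite expr1 expr0 powR1; split; last exact: decay_le1.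
  by rewrite (lt_trans u1)// ltr1n.
have [k /andP[ku uk]] := dyadic_floor u1; exists k; split => //.
rewrite /decay (max_idPr u1) !powRN lef_pV2 ?posrE ?powR_gt0 ?exprn_gt0//; last first.
  by rewrite (lt_le_trans _ u1).
by apply: ge0_ler_powR; rewrite ?nnegrE// ?exprn_ge0// (le_trans _ u1).
Qed.

Lemma nneseries_geometric_le (c q : R) : 0 <= c -> 0 <= q < 1 ->
  (\sum_(k <oo) (c * q ^+ k)%:E <= (c / (1 - q))%:E)%E.
Proof.
move=> c0 /andP[q0 q1]; have q1' : 0 < 1 - q by rewrite subr_gt0.
apply: lime_le.
  by apply: is_cvg_nneseries => k _ _; rewrite lee_fin mulr_ge0 ?exprn_ge0.
apply: nearW => n; rewrite sumEFin lee_fin.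
have -> : \sum_(0 <= k < n) c * q ^+ k = c * (1 - q ^+ n) / (1 - q).
  elim: n => [|n IH]; first by rewrite big_geq// expr0 subrr mulr0 mul0r.
  rewrite big_nat_recr//= IH exprS; field.
  by rewrite gt_eqF.
rewrite ler_wpM2r ?invr_ge0 ?(ltW q1')// ler_piMr// gerBl exprn_ge0//.
Qed.

(** If nu gives the sublevel set D < r a g-mass of at most M r^a, then a tail of
order a + 1 is integrable with the bound dictated by scaling: the dyadic layer
2^k rho <= D < 2^(k+1) rho contributes at most 2^(-k(a+1)) M (2^(k+1) rho)^a,
and these terms form a geometric series of ratio 1/2. *)
Lemma integral_decay_le d (T : measurableType d) (nu : {measure set T -> \bar R})
    (g D : T -> R) (a M : R) :
  measurable_fun setT g -> (forall x, 0 <= g x) -> measurable_fun setT D ->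
  0 <= a -> 0 <= M ->
  (forall r, 0 < r -> (\int[nu]_x (g x * (D x < r)%R%:R)%:E <= (M * r `^ a)%:E)%E) ->
  forall rho, 0 < rho ->
  (\int[nu]_x (g x * decay (a + 1) (D x / rho))%:E
     <= (2 `^ (a + 1) * M * rho `^ a)%:E)%E.
Proof.
move=> mg g0 mD a0 M0 H rho rho0.
pose h k x := ((2 ^+ k) `^ (- (a + 1)) * (g x * (D x < 2 ^+ k.+1 * rho)%R%:R))%:E.
have h0 k x : (0 <= h k x)%E.
  by rewrite lee_fin mulr_ge0 ?powR_ge0// mulr_ge0.
have mh k : measurable_fun setT (h k).
  apply/measurable_EFinP; apply: measurable_funM => //.
  by apply: measurable_funM => //; exact: measurable_lt_natr.
apply: (@le_trans _ _ (\int[nu]_x (\sum_(k <oo) h k x))%E).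
  apply: ge0_le_integral_nomeas => x _; first by rewrite lee_fin mulr_ge0 ?decay_ge0.
  have a10 : 0 <= a + 1 by rewrite addr_ge0.
  have [k [uk dk]] := @decay_le_dyadic (a + 1) (D x / rho) a10.
  apply: (@le_trans _ _ (h k x)).
    rewrite lee_fin mulrCA -ltr_pdivrMr// uk mulr1.
    exact: ler_wpM2l.
  rewrite (@nneseriesD1 _ (h^~ x) k)//=.
  rewrite leeDl//; apply: nneseries_ge0 => n _ _; exact: h0.
rewrite integral_nneseries//.
apply: (@le_trans _ _ (\sum_(k <oo) ((2 `^ a * M * rho `^ a) * 2^-1 ^+ k)%:E)%E).
  apply: lee_nneseries => [k _ _|k _]; first exact: integral_ge0.
  rewrite ge0_integralZl_real ?powR_ge0//; last 2 first.
  - by apply: measurable_funM => //; exact: measurable_lt_natr.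
  - by move=> x _; rewrite mulr_ge0.
  have r0 : 0 < 2 ^+ k.+1 * rho by rewrite mulr_gt0// exprn_gt0.
  apply: le_trans (lee_pmul _ _ (lexx _) (H _ r0)) _.
  - by rewrite lee_fin powR_ge0.
  - by apply: integral_ge0 => x _; rewrite lee_fin mulr_ge0.
  rewrite -EFinM lee_fin exprS exprVn -mulrA powRM// ?mulr_ge0 ?exprn_ge0 ?(ltW rho0)//.
  rewrite powRM ?exprn_ge0 ?(ltW rho0)//.
  have : 0 < 2 ^+ k :> R by rewrite exprn_gt0.
  move: (2 ^+ k) => q q0.
  rewrite opprD powRD; last by apply/implyP => _; rewrite gt_eqF.
  rewrite powR_inv1 ?(ltW q0)// powRN.
  rewrite le_eqVlt; apply/orP; left; apply/eqP; field.
  by rewrite !gt_eqF// powR_gt0.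
have c0 : 0 <= 2 `^ a * M * rho `^ a by rewrite !mulr_ge0 ?powR_ge0.
have half : 0 <= (2^-1 : R) < 1 by lra.
apply: (le_trans (nneseries_geometric_le c0 half)).
have -> : 1 - 2^-1 = 2^-1 :> R by lra.
rewrite lee_fin powRD; last by rewrite pnatr_eq0 implybT.
by rewrite powRr1// invrK le_eqVlt; apply/orP; left; apply/eqP; ring.
Qed.

End PowerDecay.

(** * Measurability and almost everywhere bounds in proper metric spaces *)

Section ProperMetricSpaces.
Context (R : realType) (d : measure_display) (X : borelMetricType R d).

Lemma metric_ball_open (x : X) (r : R) : open (ball x r).
Proof.
rewrite openE => y /= xy; apply/nbhs_ballP.
move: xy; rewrite ballEmdist /= => xy.
exists (r - mdist x y) => /=; first by rewrite subr_gt0.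
move=> z; rewrite !ballEmdist /= ltrBrDl; apply: le_lt_trans.
exact: metric_triangle.
Qed.

Lemma open_measurableX (U : set X) : open U -> measurable U.
Proof. by move=> oU; rewrite measurable_borelE; exact: sub_sigma_algebra. Qed.

Lemma measurable_metric_ball (x : X) (r : R) : measurable (ball x r).
Proof. exact/open_measurableX/metric_ball_open. Qed.

(** A ball of integer radius has compact closure, so finitely many balls of a given
small radius cover it; their centres form a countable dense set. *)
Lemma proper_separable : proper_balls X ->
  exists2 C : set X, countable C & forall x e, 0 < e -> exists2 c, C c & ball c e x.
Proof.
move=> properX; have [[x0 _]|X0] := pselect ([set: X] !=set0); last first.
  by exists set0 => // x; exfalso; apply: X0; exists x.
pose e k : R := k.+1%:R^-1.
have e0 k : 0 < e k by rewrite invr_gt0.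
have h n k : finite_subset_cover [set: X] (fun z => ball z (e k))
    (closure (ball x0 n%:R)).
  have := properX x0 n%:R; rewrite compact_cover; apply => [z _|y _].
    exact: metric_ball_open.
  by exists y => //; exact: ballxx.
pose h' n k := projT1 (cid (iffLR (exists2P _ _) (h n k))).
exists (\bigcup_n \bigcup_k [set` h' n k]).
  apply: bigcup_countable => // n _; apply: bigcup_countable => // k _.
move=> x r r0.
pose n := (Num.truncn (mdist x0 x)).+1.
pose k := Num.truncn (r^-1).
have xn : closure (ball x0 n%:R) x.
  by apply: subset_closure; rewrite ballEmdist /=; exact: truncnS_gt.
have kr : e k < r by rewrite -(invrK r) ltf_pV2 ?posrE ?invr_gt0// truncnS_gt.
have [_ /(_ x xn) [c /= cn cx]] := projT2 (cid (iffLR (exists2P _ _) (h n k))).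
exists c; first by exists n => //; exists k.
exact: le_ball (ltW kr) _ cx.
Qed.

(** The product sigma-algebra contains the open sets of X x X because, X being
separable, such a set is a countable union of products of balls. *)
Lemma open_prod_measurable (U : set (X * X)) : proper_balls X ->
  open U -> measurable U.
Proof.
move=> properX oU; have [C cC dC] := proper_separable properX.
pose e k : R := k.+1%:R^-1.
have e0 k : 0 < e k by rewrite invr_gt0.
pose B (i : X * X * nat) := ball i.1.1 (e i.2) `*` ball i.1.2 (e i.2).
pose I := [set i | (C `*` C `*` setT) i /\ B i `<=` U].
have -> : U = \bigcup_(i in I) B i.
  apply/seteqP; split; last by move=> z [i [_ iU] iz]; exact: iU.
  move=> [x y] Uxy.
  have /(_ _ Uxy) := open_nbhs_nbhs (conj oU _) => nU.
  have {nU} [[A1 A2] [/= /nbhs_ballP[r1 /= r10 A1r] /nbhs_ballP[r2 /= r20 A2r]] A12] :=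
    nU.
  pose r := Num.min r1 r2; have r0 : 0 < r by rewrite lt_min r10.
  pose k := Num.truncn ((r / 2)^-1).
  have kr : e k < r / 2.
    by rewrite -(invrK (r / 2)) ltf_pV2 ?posrE ?invr_gt0 ?divr_gt0// truncnS_gt.
  have [a Ca ax] := dC x _ (e0 k).
  have [b Cb by'] := dC y _ (e0 k).
  exists (a, b, k); last by split.
  split; first by split => //; split.
  move=> [u v] [/= au bv]; apply: A12; split => /=; [apply: A1r|apply: A2r].
  - apply: (@le_ball _ _ _ (r / 2 + r / 2)); first by rewrite -splitr ge_min lexx.
    apply: (@ball_triangle _ _ a).
      by apply/ball_sym; exact: le_ball (ltW kr) _ ax.
    exact: le_ball (ltW kr) _ au.
  - apply: (@le_ball _ _ _ (r / 2 + r / 2)); first by rewrite -splitr ge_min lexx orbT.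
    apply: (@ball_triangle _ _ b).
      by apply/ball_sym; exact: le_ball (ltW kr) _ by'.
    exact: le_ball (ltW kr) _ bv.
have cI : countable I.
  apply: sub_countable (countableX (countableX cC cC) (countableP [set: nat])).
  by apply: subset_card_le => i [].
have mB i : measurable (B i) by apply: measurableX; exact: measurable_metric_ball.
have [->|[f]] := pfcard_geP cI; first by rewrite bigcup_set0.
rewrite -(image_eq f) bigcup_image; apply: bigcupT_measurable => i; exact: mB.
Qed.

Lemma continuous_prod_measurable (f : X * X -> R) : proper_balls X ->
  continuous f -> measurable_fun setT f.
Proof.
move=> properX /continuousP cf; apply: (measurability _ (RGenOpens.measurableE R)).
move=> _ [_ [a [b ->] <-]]; rewrite setTI; apply: open_prod_measurable => //.
exact/cf/interval_open.
Qed.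

Lemma continuous_measurable (f : X -> R) :
  continuous f -> measurable_fun setT f.
Proof.
move=> /continuousP cf; apply: (measurability _ (RGenOpens.measurableE R)).
move=> _ [_ [a [b ->] <-]]; rewrite setTI; apply: open_measurableX => //.
exact/cf/interval_open.
Qed.

Lemma continuous_mdist : continuous (fun z : X * X => mdist z.1 z.2).
Proof.
move=> [x y]; apply/cvgrPdist_lt => e e0 /=.
have e2 : 0 < e / 2 by rewrite divr_gt0.
exists (ball x (e / 2), ball y (e / 2)); first by split; exact: nbhsx_ballx.
move=> [u v] [/=]; rewrite !ballEmdist /= => xu yv.
have := metric_triangle x u y; have := metric_triangle u v y.
have := metric_triangle u x v; have := metric_triangle x y v.
rewrite (metric_sym u x) (metric_sym v y) => h1 h2 h3 h4.
by rewrite ltr_norml; lra.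
Qed.

Lemma measurable_mdist : proper_balls X ->
  measurable_fun setT (fun z : X * X => mdist z.1 z.2).
Proof. by move=> ?; apply: continuous_prod_measurable => //; exact: continuous_mdist. Qed.

Lemma measurable_mdistl (x : X) : measurable_fun setT (fun y : X => mdist x y).
Proof.
apply: continuous_measurable => y; apply/cvgrPdist_lt => e e0 /=.
apply/nbhs_ballP; exists e => //= z; rewrite ballEmdist /= => yz.
have := metric_triangle x y z; have := metric_triangle x z y.
rewrite (metric_sym z y) ltr_norml => h1 h2; lra.
Qed.

Variable mu : {sigma_finite_measure set X -> \bar R}.

(** Since mu charges every non-empty open set, an almost everywhere bound on a
continuous function over an open set holds at every point. *)
Lemma ae_le_continuous (g : X * X -> R) (U : set (X * X)) (c : R) :
  fully_supported mu -> continuous g -> open U ->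
  {ae (mu \x mu)%E, forall z, U z -> g z <= c} -> forall z, U z -> g z <= c.
Proof.
move=> supp cg oU [N [mN N0 UN]] z Uz.
rewrite leNgt; apply/negP => cz.
have oV : open (U `&` [set z | c < g z]).
  by apply: openI => //; move/continuousP: cg => /(_ _ (@open_gt R c)).
have := open_nbhs_nbhs (conj oV (conj Uz cz)).
move=> [[A1 A2] [/= /nbhs_ballP[r1 /= r10 A1r] /nbhs_ballP[r2 /= r20 A2r]] A12].
have : ((mu \x mu) (ball z.1 r1 `*` ball z.2 r2) <= (mu \x mu) N)%E.
  apply: le_measure; rewrite ?inE//.
    by apply: measurableX; exact: measurable_metric_ball.
  move=> w [w1 w2]; apply: UN => /= H.
  have [Uw] : (U `&` [set z | c < g z]) w by apply: A12; split; [exact: A1r|exact: A2r].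
  by rewrite /= ltNge H.
rewrite [leRHS]N0 leNgt => /negP; apply.
rewrite [ltRHS]product_measure1E; try exact: measurable_metric_ball.
apply: mule_gt0; apply: supp; try exact: metric_ball_open.
  by exists z.1; exact: ballxx.
by exists z.2; exact: ballxx.
Qed.

End ProperMetricSpaces.

(** * Real inequalities *)

Section RealIneq.
Context (R : realType).

(** The term of order n + 1 >= b of the exponential series dominates u^b. *)
Lemma expRN_le_decay (c b : R) : 0 < c ->
  exists2 C : R, 0 < C & forall u, 0 <= u -> expR (- (c * u)) <= C * decay b u.
Proof.
move=> c0; pose n := Num.truncn b.
have nb : b <= n.+1%:R by exact/ltW/truncnS_gt.
pose K : R := n.+1`!%:R / c ^+ n.+1.
have K0 : 0 < K by rewrite divr_gt0 ?exprn_gt0// ltr0n fact_gt0.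
exists (1 + K) => [|u u0]; first by rewrite addr_gt0.
apply: (@le_trans _ _ ((1 + K) * decay n.+1%:R u)); last first.
  by rewrite ler_wpM2l ?decay_anti// addr_ge0// ltW.
rewrite /decay; have [u1|u1] := leP 1 u; last first.
  rewrite powR1 mulr1 (le_trans (_ : _ <= 1))// ?lerDl ?(ltW K0)//.
  by rewrite expR_le1 oppr_le0 mulr_ge0// ltW.
rewrite powR_invn// expRN -[leLHS]mul1r ler_pdivrMr ?expR_gt0//.
rewrite mulrAC ler_pdivlMr ?exprn_gt0// ?(lt_le_trans _ u1)// mul1r.
have cu : 0 <= c * u by rewrite mulr_ge0// ltW.
apply: le_trans (ler_wpM2l _ (expR_ge1Dxn n cu)); last by rewrite addr_ge0// ltW.
rewrite mulrDr mulr1 ler_wpDl ?addr_ge0 ?(ltW K0)// mulrDl mul1r.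
rewrite ler_wpDl ?divr_ge0 ?exprn_ge0//.
have F0 : 0 < n.+1`!%:R :> R by rewrite ltr0n fact_gt0.
have q0 : 0 < c ^+ n.+1 by rewrite exprn_gt0.
rewrite exprMn /K; move: (c ^+ n.+1) (u ^+ n.+1) (n.+1`!%:R) q0 F0 => q w F q0 F0.
by rewrite le_eqVlt; apply/orP; left; apply/eqP; field; rewrite !gt_eqF.
Qed.

(** Bernoulli's inequality: writing v = exp l, it is the convex combination with
weights b and 1 - b of exp y >= 1 + y at y = (1 - b) l and y = - b l. *)
Lemma bernoulli_powR (b v : R) : 0 <= b <= 1 -> 0 < v -> v `^ b <= 1 - b + b * v.
Proof.
move=> /andP[b0 b1] v0; rewrite -(lnK v0) -expRM.
move: (ln v) => l.
have h1 : 1 + (1 - b) * l <= expR ((1 - b) * l) by exact: expR_ge1Dx.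
have h2 : 1 - b * l <= expR (- (l * b)) by rewrite mulrC; exact: expR_ge1Dx.
have e1 : expR l = expR (l * b) * expR ((1 - b) * l).
  by rewrite -expRD; congr expR; ring.
have e2 : expR (l * b) * expR (- (l * b)) = 1.
  by rewrite -expRD subrr expR0.
have e0 := expR_gt0 (l * b).
have -> : 1 - b + b * expR l =
    expR (l * b) * ((1 - b) * expR (- (l * b)) + b * expR ((1 - b) * l)).
  by rewrite e1 mulrDr (mulrCA _ (1 - b)) e2 mulr1 (mulrCA _ b).
rewrite -[leLHS]mulr1 ler_pM2l//.
have := ler_wpM2l b0 h1; have : 0 <= 1 - b by rewrite subr_ge0.
move=> b1'; have := ler_wpM2l b1' h2.
by nra.
Qed.

(** By Bernoulli's inequality, j^(-s) is at most (1 - s)^-1 times the increment of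
x^(1 - s) from j - 1 to j. *)
Lemma sum_powRN_le (s : R) (n : nat) : 0 < s -> s < 1 ->
  \sum_(1 <= j < n.+1) (j%:R : R) `^ (- s) <= (1 - s)^-1 * n%:R `^ (1 - s).
Proof.
move=> s0 s1; have b0 : 0 < 1 - s by rewrite subr_gt0.
elim: n => [|n IH].
  by rewrite big_geq// powR0 ?mulr0// gt_eqF.
rewrite big_nat_recr//=; apply: le_trans (lerD IH (lexx _)) _.
have n0 : 0 < n.+1%:R :> R by rewrite ltr0n.
rewrite -lerBrDl -mulrBr mulrC ler_pdivlMr// [leLHS]mulrC.
have [->|nn] := eqVneq n 0%N.
  by rewrite !powR1 powR0 ?gt_eqF//; lra.
have nR : 0 < n%:R :> R by rewrite ltr0n lt0n.
have b01 : 0 <= 1 - s <= 1 by rewrite ltW//= gerBl ltW.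
have v0 : 0 < n%:R / n.+1%:R :> R by rewrite divr_gt0.
have := bernoulli_powR b01 v0.
have -> : n%:R / n.+1%:R = 1 - n.+1%:R^-1 :> R.
  by rewrite -natr1; field; rewrite natr1 pnatr_eq0.
rewrite mulrBr mulr1 subrKA.
move=> h.
have e : n.+1%:R `^ (1 - s) = n.+1%:R * n.+1%:R `^ (- s) :> R.
  by rewrite powRD ?powRr1// ?ltW//; apply/implyP => _; rewrite gt_eqF.
have e3 : n%:R `^ (1 - s) = n.+1%:R `^ (1 - s) * (1 - n.+1%:R^-1) `^ (1 - s) :> R.
  rewrite -powRM ?ltW//; last by rewrite subr_gt0 invf_lt1// ltr1n ltnS lt0n.
  by congr (_ `^ _); rewrite mulrBr mulr1 mulfV ?gt_eqF// -natr1 addrK.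
rewrite e3 -[in leRHS](mulr1 (n.+1%:R `^ (1 - s))) -mulrA mul1r -mulrBr.
apply: (@le_trans _ _ (n.+1%:R `^ (1 - s) * ((1 - s) / n.+1%:R))).
  rewrite e le_eqVlt; apply/orP; left; apply/eqP; field.
  by rewrite gt_eqF.
by rewrite ler_pM2l ?powR_gt0// lerBrDr addrC -lerBrDr.
Qed.

Lemma powR_divl (u v s : R) : 0 <= u -> 0 < v -> u `^ s / v `^ s = (u / v) `^ s.
Proof.
move=> u0 v0; rewrite powRM ?invr_ge0 ?(ltW v0)//.
by rewrite -(powR_inv1 (ltW v0)) -powRrM mulN1r powRN.
Qed.

Lemma powR_natN_cvg0 (a : R) : 0 < a -> (n.+1%:R : R) `^ (- a) @[n --> \oo] --> (0 : R).
Proof.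
move=> a0; have /cvg_at_rightP/(_ (@harmonic R)) := powR_cvg0 a0.
move=> h.
rewrite (_ : (fun n => _) = (fun n => (@harmonic R n) `^ a)); last first.
  apply/funext => n; by rewrite /harmonic /= -powR_inv1// -powRrM mulN1r.
by apply: h; split => [n|]; [exact: harmonic_gt0|exact: cvg_harmonic].
Qed.

End RealIneq.

Section RatioLemma.
Context (R : realType).
Implicit Types (c C q : R) (v e : nat -> R).

(** If q differed from 1, the increments of v would eventually be bounded away
from 0 with a constant sign, and v would leave the interval [c, C]. *)
Lemma asymptotic_ratio_eq1 (c C q : R) (v e : nat -> R) :
  0 < c -> (forall n, c <= v n <= C) -> e n @[n --> \oo] --> (0 : R) ->
  (forall n, `|v n.+1 - q * v n| <= e n) -> q = 1.
Proof.
move=> c0 vb e0 H; apply/eqP/negPn/negP => q1.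
pose eta := `|q - 1| * c / 2.
have q10 : 0 < `|q - 1| by rewrite normr_gt0 subr_eq0.
have eta0 : 0 < eta by rewrite divr_gt0// mulr_gt0.
have [N _ HN] : \forall n \near \oo, e n < eta by exact: cvgr_lt e0 _ eta0.
have C0 : 0 < C by have /andP[h1 h2] := vb 0%N; lra.
pose m := (Num.truncn (C / eta)).+1.
have Cm : C < m%:R * eta by rewrite -ltr_pdivrMr//; exact: truncnS_gt.
have step n : (N <= n)%N -> `|v n.+1 - q * v n| <= eta.
  by move=> Nn; apply: le_trans (H n) _; exact/ltW/HN.
have [q1'|q1'] := ltP 1 q.
  have h k : k%:R * eta <= v (N + k)%N.
    elim: k => [|k IH].
      by rewrite mul0r; have /andP[h1 _] := vb (N + 0)%N; lra.
    have := step _ (leq_addr k N); rewrite addnS ler_norml => /andP[h1 _].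
    have /andP[h2 _] := vb (N + k)%N.
    have e1 : `|q - 1| = q - 1 by rewrite gtr0_norm// subr_gt0.
    rewrite -natr1 mulrDl mul1r; move: h1 IH; rewrite /eta e1; nra.
  by have /andP[_ h1] := vb (N + m)%N; have := h m; lra.
have h k : v (N + k)%N <= C - k%:R * eta.
  elim: k => [|k IH].
    by rewrite mul0r; have /andP[_ h1] := vb (N + 0)%N; lra.
  have := step _ (leq_addr k N); rewrite addnS ler_norml => /andP[_ h1].
  have /andP[h2 _] := vb (N + k)%N.
  have e1 : `|q - 1| = 1 - q by rewrite ler0_norm ?opprB// subr_le0.
  rewrite -natr1 mulrDl mul1r; move: h1 IH; rewrite /eta e1; nra.
by have /andP[h1 _] := vb (N + m)%N; have := h m; lra.
Qed.

End RatioLemma.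

(** * Lebesgue classes *)

Section Lfun_tools.
Context d (T : measurableType d) (R : realType) (mu : {measure set T -> \bar R}).

Lemma Lfun_measurable p (f : T -> R) : f \in Lfun mu p -> measurable_fun setT f.
Proof. by move=> /sub_Lfun_mfun; rewrite inE. Qed.

Lemma Lfun2P (f : T -> R) : f \in Lfun mu 2%:E <->
  measurable_fun setT f /\ (\int[mu]_x (f x ^+ 2)%:E < +oo)%E.
Proof.
have e : ('N[mu]_2%:E[EFin \o f] `^ 2 = \int[mu]_x (f x ^+ 2)%:E)%E.
  rewrite poweR_Lnorm ?pnatr_eq0//; apply: eq_integral => x _ /=.
  by congr EFin; rewrite powR_mulrn ?normr_ge0// real_normK ?num_real.
split=> [f2|[mf f2]].
  split; first exact: Lfun_measurable f2.
  have := integrable_lty measurableT (Lfun2_integrable_sqr f2).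
  by rewrite /=.
apply/andP; split; rewrite inE//= /finite_norm.
apply: (@lty_poweRy _ _ 2); rewrite ?pnatr_eq0//.
by rewrite e.
Qed.

Lemma Lfun2_ae (f g : T -> R) : f \in Lfun mu 2%:E -> measurable_fun setT g ->
  f = g %[ae mu] -> g \in Lfun mu 2%:E.
Proof.
move=> /Lfun2P[mf f2] mg fg; apply/Lfun2P; split => //.
apply: le_lt_trans f2; rewrite le_eqVlt; apply/orP; left; apply/eqP.
apply: ge0_ae_eq_integral => //.
- by apply/measurable_EFinP; exact: measurable_funX.
- by apply/measurable_EFinP; exact: measurable_funX.
- by move=> x _; rewrite lee_fin sqr_ge0.
- by move=> x _; rewrite lee_fin sqr_ge0.
by apply: filterS fg => x fg _; rewrite fg.
Qed.

Lemma Lfun2_indic (A : set T) : measurable A -> (mu A < +oo)%E ->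
  (\1_A : T -> R) \in Lfun mu 2%:E.
Proof.
move=> mA A0; apply/Lfun2P; split; first exact: measurable_indic.
under eq_integral do rewrite indicE expr2 -natrM mulnb andbb -indicE.
by rewrite integral_indic// setIT.
Qed.

Lemma Lfunoo_bounded (f : T -> R) (K : R) : measurable_fun setT f -> 0 <= K ->
  (forall x, `|f x| <= K) ->
  f \in Lfun mu +oo%E /\ fine ('N[mu]_+oo[EFin \o f])%E <= K.
Proof.
move=> mf K0 fK.
have NK : ('N[mu]_+oo[EFin \o f] <= K%:E)%E.
  rewrite unlock /=; case: ifPn => _ //.
  by apply/ess_supP; apply: nearW => x /=; rewrite lee_fin.
split; last first.
  rewrite -lee_fin fineK// ge0_fin_numE//; last exact: Lnorm_ge0.
  exact: le_lt_trans NK (ltry K).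
apply/andP; split; rewrite inE//= /finite_norm.
by apply: (le_lt_trans NK); exact: ltry.
Qed.

End Lfun_tools.

Section IntegrationTools.
Context d (T : measurableType d) (R : realType) (mu : {measure set T -> \bar R}).

Lemma EFin_Rintegral (D : set T) (f : T -> R) : measurable D ->
  mu.-integrable D (EFin \o f) ->
  ((\int[mu]_(x in D) f x)%R%:E = \int[mu]_(x in D) (f x)%:E)%E.
Proof. by move=> mD fi; rewrite /Rintegral fineK// integrable_fin_num. Qed.

Lemma integrable_dominated (D : set T) (f g : T -> R) : measurable D ->
  measurable_fun D f -> (forall x, D x -> `|f x| <= g x) ->
  (\int[mu]_(x in D) (g x)%:E < +oo)%E -> mu.-integrable D (EFin \o f).
Proof.
move=> mD mf fg gy; apply/integrableP; split; first exact/measurable_EFinP.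
apply: le_lt_trans gy; apply: ge0_le_integral_nomeas => x Dx //=.
by rewrite lee_fin fg.
Qed.

End IntegrationTools.

(** * Boundary functionals of sets and the coarea formula *)

Section SquareMeasure.
Context (R : realType) (d : measure_display) (X : measurableType d).
Variable mu : {sigma_finite_measure set X -> \bar R}.

Lemma square_sigma_finite : sigma_finite setT (mu \x mu)%E.
Proof.
have /sigma_finiteP[A [AT Amono Afin]] := sigma_finiteT mu.
exists (fun n => A n `*` A n) => [|n]; last first.
  have [mA Ay] := Afin n; split; first exact: measurableX.
  by rewrite product_measure1E// lte_mul_pinfty// ge0_fin_numE.
apply/seteqP; split => // -[x y] _.
have [[n _ Ax] [m _ Ay]] : (\bigcup_n A n) x /\ (\bigcup_n A n) y by rewrite -AT.
by exists (maxn n m) => //; split => /=;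
  [move: Ax|move: Ay]; apply/subsetPset/Amono; rewrite ?leq_maxl ?leq_maxr.
Qed.

(** The product measure packed with its sigma-finiteness, as required by Tonelli's
theorem for three variables. *)
Definition square_measure : {sigma_finite_measure set (X * X)%type -> \bar R} :=
  HB.pack_for {sigma_finite_measure set (X * X)%type -> \bar R} (mu \x mu)%E
   (Measure_isSigmaFinite.Build _ _ _ (mu \x mu)%E square_sigma_finite).

End SquareMeasure.

Lemma normr_maxN (R : realType) (t : R) : `|t| = Num.max 0 t + Num.max 0 (- t).
Proof.
have [t0|t0] := lerP 0 t.
  by rewrite ger0_norm// (max_idPl _) ?oppr_le0// addr0.
by rewrite ltr0_norm// (max_idPr _) ?oppr_ge0 ?ltW// add0r.
Qed.

Lemma normr_sub_posneg (R : realType) (u v : R) :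
  `|u - v| =
    Num.max 0 (Num.max 0 u - Num.max 0 v) + Num.max 0 (Num.max 0 v - Num.max 0 u) +
    (Num.max 0 (Num.max 0 (- u) - Num.max 0 (- v)) +
     Num.max 0 (Num.max 0 (- v) - Num.max 0 (- u))).
Proof.
have sw (a b : R) : Num.max 0 (a - b) + Num.max 0 (b - a) = `|a - b|.
  by rewrite -(opprB a b) -normr_maxN.
rewrite !sw.
have pos (t : R) : 0 <= t -> Num.max 0 t = t /\ Num.max 0 (- t) = 0.
  by move=> t0; rewrite (max_idPr t0) (max_idPl _) ?oppr_le0.
have neg (t : R) : t < 0 -> Num.max 0 t = 0 /\ Num.max 0 (- t) = - t.
  by move=> t0; rewrite (max_idPl (ltW t0)) (max_idPr _) ?oppr_ge0 ?ltW.
have sgn (t : R) : 0 <= t \/ t < 0 by case: (ltP t 0); [right|left].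
have [u0|u0] := sgn u; have [v0|v0] := sgn v.
- have [-> ->] := pos _ u0; have [-> ->] := pos _ v0.
  by rewrite subrr normr0 addr0.
- have [-> ->] := pos _ u0; have [-> ->] := neg _ v0.
  rewrite subr0 sub0r opprK (ger0_norm u0) (ltr0_norm v0) ger0_norm//.
  by rewrite subr_ge0 (le_trans _ u0)// ltW.
- have [-> ->] := neg _ u0; have [-> ->] := pos _ v0.
  rewrite sub0r normrN subr0 normrN (ger0_norm v0) (ltr0_norm u0) ler0_norm.
    by rewrite opprB addrC.
  by rewrite subr_le0 (le_trans _ v0)// ltW.
- have [-> ->] := neg _ u0; have [-> ->] := neg _ v0.
  by rewrite subrr normr0 add0r -opprD normrN.
Qed.

Section Jump.
Context (R : realType) (d : measure_display) (X : measurableType d).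
Variable mu : {sigma_finite_measure set X -> \bar R}.

(** The w-interaction between a set and its complement. *)
Definition jump (A : set X) (w : X -> X -> R) : \bar R :=
  (\int[mu \x mu]_z (\1_A z.1 * (1 - \1_A z.2) * w z.1 z.2)%:E)%E.

Variable A : set X.
Hypothesis mA : measurable A.
Local Notation e := (\1_A : X -> R).

Let e_ge0 y : 0 <= e y. Proof. by rewrite indicE. Qed.
Let e_le1 y : e y <= 1. Proof. by rewrite indicE lern1 leq_b1. Qed.
Let ec_ge0 y : 0 <= 1 - e y. Proof. by rewrite subr_ge0. Qed.
Let me : measurable_fun setT e. Proof. exact: measurable_indic. Qed.

Lemma measurable_jump (w : X -> X -> R) :
  measurable_fun setT (fun z : X * X => w z.1 z.2) ->
  measurable_fun setT (fun z : X * X => e z.1 * (1 - e z.2) * w z.1 z.2).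
Proof.
move=> mw; apply: measurable_funM => //; apply: measurable_funM.
  exact: measurableT_comp me measurable_fst.
apply: measurable_funB => //; exact: measurableT_comp me measurable_snd.
Qed.

Lemma jump_iterated (w : X -> X -> R) :
  measurable_fun setT (fun z : X * X => w z.1 z.2) -> (forall x y, 0 <= w x y) ->
  jump A w = (\int[mu]_x \int[mu]_y (e x * (1 - e y) * w x y)%:E)%E.
Proof.
move=> mw w0; rewrite /jump (@fubini_tonelli1 _ _ _ _ _ mu mu)//.
  by apply/measurable_EFinP; exact: measurable_jump.
by move=> z; rewrite lee_fin !mulr_ge0.
Qed.

Lemma jumpZ (w : X -> X -> R) (c : R) : 0 <= c ->
  measurable_fun setT (fun z : X * X => w z.1 z.2) -> (forall x y, 0 <= w x y) ->
  jump A (fun x y => c * w x y) = (c%:E * jump A w)%E.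
Proof.
move=> c0 mw w0; rewrite /jump -ge0_integralZl_real//.
- by apply: eq_integral => z _; rewrite mulrCA.
- exact: measurable_jump.
- by move=> z _; rewrite !mulr_ge0.
Qed.

Lemma jump_le (v w : X -> X -> R) : (forall x y, 0 <= v x y) ->
  (forall x y, v x y <= w x y) -> (jump A v <= jump A w)%E.
Proof.
move=> v0 vw; apply: ge0_le_integral_nomeas => z _.
  by rewrite lee_fin !mulr_ge0.
by rewrite lee_fin ler_wpM2l// !mulr_ge0.
Qed.

Lemma jump_ge0 (w : X -> X -> R) : (forall x y, 0 <= w x y) -> (0 <= jump A w)%E.
Proof. by move=> w0; apply: integral_ge0 => z _; rewrite lee_fin !mulr_ge0. Qed.

End Jump.

Section Coarea.
Context (R : realType) (d : measure_display) (X : borelMetricType R d).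
Variable mu : {sigma_finite_measure set X -> \bar R}.
Implicit Types (f g : X -> R) (w : X -> X -> R).

Definition osc f w : \bar R :=
  (\int[mu \x mu]_z (`|f z.1 - f z.2| * w z.1 z.2)%:E)%E.

(** The one-sided version of osc.  Unlike |f x - f y|, the positive part of
f x - f y is the integral over the levels s of the indicator of
f y < s <= f x, which is the jump of one superlevel set. *)
Definition descent f w : \bar R :=
  (\int[mu \x mu]_z (Num.max 0 (f z.1 - f z.2) * w z.1 z.2)%:E)%E.

Let mfst f : measurable_fun setT f -> measurable_fun setT (fun z : X * X => f z.1).
Proof. by move=> mf; exact: measurableT_comp mf measurable_fst. Qed.
Let msnd f : measurable_fun setT f -> measurable_fun setT (fun z : X * X => f z.2).
Proof. by move=> mf; exact: measurableT_comp mf measurable_snd. Qed.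

Lemma measurable_descent f w : measurable_fun setT f ->
  measurable_fun setT (fun z : X * X => w z.1 z.2) ->
  measurable_fun setT (fun z : X * X => Num.max 0 (f z.1 - f z.2) * w z.1 z.2).
Proof.
move=> mf mw; apply: measurable_funM => //; apply: measurable_maxr => //.
by apply: measurable_funB; [exact: mfst|exact: msnd].
Qed.

Let level f (s : R) : set X := [set x | s <= f x].

Let measurable_level f s : measurable_fun setT f -> measurable (level f s).
Proof.
move=> mf; rewrite /level -[X in measurable X]setTI.
have := mf measurableT `[s, +oo[%classic (measurable_itv _).
congr (measurable (_ `&` _)).
by apply/seteqP; split => x /=; rewrite in_itv /= andbT.
Qed.

(** For fixed (x, y) the levels s with f y < s <= f x form an interval of length
the positive part of f x - f y; Tonelli's theorem exchanges the integral over
s with that over (x, y). *)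
Lemma descent_coarea f w : measurable_fun setT f ->
  measurable_fun setT (fun z : X * X => w z.1 z.2) -> (forall x y, 0 <= w x y) ->
  measurable_fun setT (fun s => jump mu (level f s) w) /\
  descent f w = (\int[lebesgue_measure]_s jump mu (level f s) w)%E.
Proof.
move=> mf mw w0.
pose G (zs : (X * X) * R) : \bar R :=
  ((zs.2 <= f zs.1.1)%R%:R * (1 - (zs.2 <= f zs.1.2)%R%:R) * w zs.1.1 zs.1.2)%:E.
have G0 zs : (0 <= G zs)%E.
  by rewrite lee_fin !mulr_ge0// subr_ge0 lern1 leq_b1.
have m1 : measurable_fun setT (fun zs : (X * X) * R => zs.1) by exact: measurable_fst.
have m2 : measurable_fun setT (fun zs : (X * X) * R => zs.2) by exact: measurable_snd.
have mG : measurable_fun setT G.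
  apply/measurable_EFinP; apply: measurable_funM; last exact: measurableT_comp mw m1.
  apply: measurable_funM.
    apply: measurable_natr; apply: measurable_fun_ler => //.
    exact: measurableT_comp (mfst mf) m1.
  apply: measurable_funB => //.
  apply: measurable_natr; apply: measurable_fun_ler => //.
  exact: measurableT_comp (msnd mf) m1.
have jumpE s : jump mu (level f s) w = (\int[mu \x mu]_z G (z, s))%E.
  apply: eq_integral => z _; rewrite /G /=; congr (_ * (1 - _) * _)%:E.
    by rewrite indicE; congr (nat_of_bool _)%:R; apply/idP/idP; rewrite inE.
  by rewrite indicE; congr (nat_of_bool _)%:R; apply/idP/idP; rewrite inE.
split.
  rewrite (_ : (fun s => _) = (fun s => \int[mu \x mu]_z G (z, s))%E); last first.
    by apply/funext => s; rewrite jumpE.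
  have := @measurable_fun_fubini_tonelli_G _ _ _ _ _ (square_measure mu) G mG G0.
  exact.
transitivity (\int[lebesgue_measure]_s \int[mu \x mu]_z G (z, s))%E; last first.
  by apply: eq_integral => s _; rewrite jumpE.
rewrite -[RHS](@fubini_tonelli _ _ _ _ _ (square_measure mu) lebesgue_measure G)//.
apply: eq_integral => -[x y] _; rewrite /G /=.
have -> : (\int[lebesgue_measure]_s ((s <= f x)%R%:R * (1 - (s <= f y)%R%:R) * w x y)%:E)%E =
    (\int[lebesgue_measure]_s (w x y * \1_(`]f y, f x]%classic) s)%:E)%E.
  apply: eq_integral => s _; rewrite mulrC; congr (_ * _)%:E.
  rewrite indicE.
  have -> : (s \in `]f y, f x]%classic) = (f y < s) && (s <= f x).
    by apply/idP/idP; rewrite inE /= in_itv.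
  rewrite (ltNge (f y)).
  by case: (s <= f y); case: (s <= f x); rewrite /= ?subrr ?subr0 ?mulr0 ?mulr1.
rewrite ge0_integralZl_real//.
rewrite integral_indic// setIT.
rewrite [X in (_ * X)%E](lebesgue_measure_itv `]f y, f x]) /= lte_fin.
case: ltP => [xy|xy].
  by rewrite -EFinB -EFinM (max_idPr _) ?subr_ge0 ?ltW// mulrC.
by rewrite mule0; congr EFin; rewrite (max_idPl _) ?mul0r// subr_le0.
Qed.

Lemma integral_swap (H : X * X -> \bar R) : measurable_fun setT H ->
  (forall z, (0 <= H z)%E) ->
  (\int[mu \x mu]_z H (z.2, z.1) = \int[mu \x mu]_z H z)%E.
Proof.
move=> mH H0.
have mH' : measurable_fun setT (fun z : X * X => H (z.2, z.1)).
  apply: (measurableT_comp mH); apply: measurable_fun_pair => //.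
rewrite (@fubini_tonelli1 _ _ _ _ _ mu mu (fun z => H (z.2, z.1)))//.
by rewrite (@fubini_tonelli2 _ _ _ _ _ mu mu H).
Qed.

(** The weight is symmetric, so the two orderings of x and y contribute equally.
Splitting f into its positive and negative parts makes all levels s > 0, whose
superlevel sets have finite measure when f is integrable. *)
Lemma osc_descent f w : measurable_fun setT f ->
  measurable_fun setT (fun z : X * X => w z.1 z.2) -> (forall x y, 0 <= w x y) ->
  (forall x y, w x y = w y x) ->
  osc f w = (2%:E * (descent (fun x => Num.max 0 (f x))%R w +
                     descent (fun x => Num.max 0 (- f x))%R w))%E.
Proof.
move=> mf mw w0 wC.
have mp : measurable_fun setT (fun x => Num.max 0 (f x)) by exact: measurable_maxr.
have mn : measurable_fun setT (fun x => Num.max 0 (- f x)).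
  by apply: measurable_maxr => //; exact: measurable_funN.
pose H g (z : X * X) := (Num.max 0 (g z.1 - g z.2) * w z.1 z.2)%:E.
have mH g : measurable_fun setT g -> measurable_fun setT (H g).
  by move=> mg; apply/measurable_EFinP; exact: measurable_descent.
have H0 g z : (0 <= H g z)%E by rewrite lee_fin mulr_ge0// le_max lexx.
have mHs g : measurable_fun setT g -> measurable_fun setT (fun z => H g (z.2, z.1)).
  by move=> mg; apply: (measurableT_comp (mH _ mg)); apply: measurable_fun_pair.
have D g : measurable_fun setT g ->
    (\int[mu \x mu]_z (H g z + H g (z.2, z.1)) = 2%:E * descent g w)%E.
  move=> mg; rewrite ge0_integralD//; [|exact: mH|exact: mHs].
  rewrite integral_swap//; last exact: mH.
  by rewrite -/(descent g w) mule_natl mule2n.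
have d0 g : (0 <= descent g w)%E by apply: integral_ge0 => z _; exact: (H0 g z).
rewrite ge0_muleDr//.
rewrite -!D// -ge0_integralD//; last 4 first.
- by move=> z _; rewrite adde_ge0.
- by apply: emeasurable_funD; [exact: mH|exact: mHs].
- by move=> z _; rewrite adde_ge0.
- by apply: emeasurable_funD; [exact: mH|exact: mHs].
apply: eq_integral => -[x y] _; rewrite /H /= -!EFinD; congr EFin.
rewrite (wC y x) -!mulrDl; congr (_ * _).
exact: normr_sub_posneg.
Qed.

(** By the coarea formula it is enough to compare two symmetric weights on sets of
finite measure: the superlevel sets of the positive and negative parts of f at
levels s > 0 have finite measure by Chebyshev's inequality, and the jump at
levels s <= 0 vanishes. *)
Lemma osc_le_of_jumps f w1 w2 (K : R) : f \in Lfun mu 1 -> 0 <= K ->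
  measurable_fun setT (fun z : X * X => w1 z.1 z.2) -> (forall x y, 0 <= w1 x y) ->
  measurable_fun setT (fun z : X * X => w2 z.1 z.2) -> (forall x y, 0 <= w2 x y) ->
  (forall x y, w1 x y = w1 y x) -> (forall x y, w2 x y = w2 y x) ->
  (forall A, measurable A -> (mu A < +oo)%E -> (jump mu A w1 <= K%:E * jump mu A w2)%E) ->
  (osc f w1 <= K%:E * osc f w2)%E.
Proof.
move=> f1 K0 mw1 w10 mw2 w20 w1C w2C H.
have mf := Lfun_measurable f1.
have if_ : mu.-integrable setT (EFin \o f) by exact/Lfun1_integrable.
rewrite !osc_descent// muleCA lee_pmul2l//.
rewrite ge0_muleDr; last 2 first.
- by apply: integral_ge0 => z _; rewrite lee_fin mulr_ge0// le_max lexx.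
- by apply: integral_ge0 => z _; rewrite lee_fin mulr_ge0// le_max lexx.
have key g : measurable_fun setT g -> (forall x, 0 <= g x <= `|f x|) ->
    (descent g w1 <= K%:E * descent g w2)%E.
  move=> mg g0.
  have [mj1 ->] := descent_coarea mg mw1 w10.
  have [mj2 ->] := descent_coarea mg mw2 w20.
  have j0 w s : (forall x y, 0 <= w x y) -> (0 <= jump mu (level g s) w)%E.
    move=> w0; apply: integral_ge0 => z _; rewrite lee_fin !mulr_ge0//.
  rewrite -(ge0_integralZl lebesgue_measure measurableT mj2)//; last by move=> s _; exact: j0.
  apply: ge0_le_integral_nomeas => s _; first exact: j0.
  have [s0|s0] := ltP 0 s; last first.
    have -> : jump mu (level g s) w1 = 0%E; last first.
      by rewrite mule_ge0// j0.
    rewrite /jump; apply: integral0_eq => z _.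
    rewrite [X in 1 - X]indicE mem_set ?subrr ?mulr0 ?mul0r//.
    by have /andP[g1 _] := g0 z.2; exact: le_trans g1.
  apply: H; first exact: measurable_level.
  have : (s%:E * mu (level g s) <= \int[mu]_x `|(EFin \o f) x|)%E.
    rewrite -[mu _]mul1e.
    have ml := measurable_level s mg.
    rewrite mul1e -[level g s]setIT -integral_indic// -ge0_integralZl_real ?(ltW s0)//.
    apply: ge0_le_integral_nomeas => x _.
      by rewrite lee_fin mulr_ge0// ltW.
    rewrite lee_fin indicE; case: (boolP (x \in _)); last by rewrite mulr0.
    rewrite inE mulr1 => sx; have /andP[_] := g0 x; exact: le_trans.
  have fy : (\int[mu]_x `|(EFin \o f) x| < +oo)%E by have /integrableP[] := if_.
  move=> h; rewrite ltey; apply/eqP => e.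
  by move: (le_lt_trans h fy); rewrite e gt0_muley// lte_fin.
apply: leeD; apply: key.
- exact: measurable_maxr.
- by move=> x; rewrite le_max lexx/= ge_max normr_ge0 ler_norm.
- by apply: measurable_maxr => //; exact: measurable_funN.
- by move=> x; rewrite le_max lexx/= ge_max normr_ge0 -normrN ler_norm.
Qed.

End Coarea.

(** * Korevaar-Schoen energies *)

Section OneSidedLimits.
Context (R : realType).
Implicit Types (G : R -> \bar R).

Lemma at_right0P (V : set R) : (0^'+)%classic V ->
  exists2 e : R, 0 < e & forall r, 0 < r -> r < e -> V r.
Proof.
move=> [e /= e0 H]; exists e => // r r0 re; apply: H => //=.
by rewrite sub0r normrN gtr0_norm.
Qed.

(** These intervals generate the filter of right neighbourhoods of 0. *)
Definition initial (e : R) : set R := [set r | 0 < r < e].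

Lemma at_right0_itv (e : R) : 0 < e -> (0^'+)%classic (initial e).
Proof.
move=> e0; exists e => //= r /=; rewrite sub0r normrN => re r0.
by rewrite /initial /= r0 -(gtr0_norm r0).
Qed.

Lemma limf_esup_lty_bound G : (limf_esup G 0^'+ < +oo)%E ->
  exists e M : R, 0 < e /\ forall r, 0 < r -> r < e -> (G r <= M%:E)%E.
Proof.
move=> /ereal_inf_lt[_ [V /at_right0P[e e0 eV] <-] VM].
have [M GM] : exists M : R, (ereal_sup [set G x | x in V] <= M%:E)%E.
  case: (ereal_sup _) VM => [x _|//|_]; [by exists x|by exists 0; rewrite leNye].
exists e, M; split => // r r0 re; apply: le_trans GM.
by apply: ereal_sup_ubound; exists r => //; exact: eV.
Qed.

Lemma limf_esup_le_bound G (B : \bar R) : (forall r, 0 < r -> (G r <= B)%E) ->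
  (limf_esup G 0^'+ <= B)%E.
Proof.
move=> GB; apply: (@le_trans _ _ (ereal_sup [set G r | r in (initial 1)])).
  by apply: ereal_inf_lbound; exists (initial 1) => //; exact: at_right0_itv.
by apply: ge_ereal_sup => _ [r /= /andP[r0 _] <-]; exact: GB.
Qed.

Lemma limf_einf_lt_near G (v : \bar R) : (limf_einf G 0^'+ < v)%E ->
  forall e : R, 0 < e -> exists r, [/\ 0 < r, r < e & (G r < v)%E].
Proof.
move=> Gv e e0.
have : (ereal_inf [set G r | r in (initial e)] < v)%E.
  apply: le_lt_trans Gv; rewrite limf_einfE; apply: ereal_sup_ubound.
  by exists (initial e) => //; exact: at_right0_itv.
by move=> /ereal_inf_lt[_ [r /= /andP[r0 re] <-] Gr]; exists r.
Qed.

Lemma limf_einf_le_bound G (B : \bar R) : (forall r, 0 < r -> (G r <= B)%E) ->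
  (limf_einf G 0^'+ <= B)%E.
Proof.
move=> GB; rewrite limf_einfE; apply: ge_ereal_sup => _ [V /at_right0P[e e0 eV] <-].
have e2 : 0 < e / 2 by rewrite divr_gt0.
apply: le_trans (GB _ e2); apply: ereal_inf_lbound; exists (e / 2) => //.
by apply: eV => //; lra.
Qed.

Lemma limf_einf_ge0 G : (forall r, (0 <= G r)%E) -> (0 <= limf_einf G 0^'+)%E.
Proof.
move=> G0; rewrite limf_einfE.
apply: (@le_trans _ _ (ereal_inf [set G r | r in (initial 1)])).
  by apply: le_ereal_inf_tmp => _ [r _ <-].
apply: ereal_sup_ubound; exists (initial 1) => //; exact: at_right0_itv.
Qed.

End OneSidedLimits.

Section KorevaarSchoen.
Context (R : realType) (d : measure_display) (X : borelMetricType R d).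
Variable mu : {sigma_finite_measure set X -> \bar R}.
Variable (dH : R).
Hypotheses (A1 : proper_balls X) (A2 : ahlfors_regular mu dH).

Definition near_diag (r : R) (x y : X) : R := (mdist x y < r)%R%:R.

Lemma near_diagC r x y : near_diag r x y = near_diag r y x.
Proof. by rewrite /near_diag metric_sym. Qed.

Lemma measurable_near_diag r : measurable_fun setT (fun z : X * X => near_diag r z.1 z.2).
Proof. by apply: measurable_lt_natr; exact: measurable_mdist. Qed.

Lemma measurable_osc (f : X -> R) (w : X -> X -> R) : measurable_fun setT f ->
  measurable_fun setT (fun z : X * X => w z.1 z.2) ->
  measurable_fun setT (fun z : X * X => `|f z.1 - f z.2| * w z.1 z.2).
Proof.
move=> mf mw; apply: measurable_funM => //; apply: measurableT_comp => //.
apply: measurable_funB.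
  exact: measurableT_comp mf measurable_fst.
exact: measurableT_comp mf measurable_snd.
Qed.

Lemma osc_iterated (f : X -> R) (w : X -> X -> R) : measurable_fun setT f ->
  measurable_fun setT (fun z : X * X => w z.1 z.2) -> (forall x y, 0 <= w x y) ->
  osc mu f w = (\int[mu]_x \int[mu]_y (`|f x - f y| * w x y)%:E)%E.
Proof.
move=> mf mw w0; rewrite /osc (@fubini_tonelli1 _ _ _ _ _ mu mu)//.
  by apply/measurable_EFinP; exact: measurable_osc.
by move=> z; rewrite lee_fin mulr_ge0.
Qed.

Lemma osc_ge0 (f : X -> R) (w : X -> X -> R) : (forall x y, 0 <= w x y) ->
  (0 <= osc mu f w)%E.
Proof. by move=> w0; apply: integral_ge0 => z _; rewrite lee_fin mulr_ge0. Qed.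

Lemma osc_le (f : X -> R) (v w : X -> X -> R) : (forall x y, 0 <= v x y) ->
  (forall x y, v x y <= w x y) -> (osc mu f v <= osc mu f w)%E.
Proof.
move=> v0 vw; apply: ge0_le_integral_nomeas => z _.
  by rewrite lee_fin mulr_ge0.
by rewrite lee_fin ler_wpM2l.
Qed.

Lemma oscZ (f : X -> R) (w : X -> X -> R) c : measurable_fun setT f ->
  measurable_fun setT (fun z : X * X => w z.1 z.2) -> (forall x y, 0 <= w x y) ->
  0 <= c -> osc mu f (fun x y => c * w x y) = (c%:E * osc mu f w)%E.
Proof.
move=> mf mw w0 c0; rewrite /osc -ge0_integralZl_real//.
- by apply: eq_integral => z _; rewrite mulrCA.
- exact: measurable_osc.
- by move=> z _; rewrite mulr_ge0.
Qed.

Lemma oscD (f : X -> R) (v w : X -> X -> R) : measurable_fun setT f ->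
  measurable_fun setT (fun z : X * X => v z.1 z.2) -> (forall x y, 0 <= v x y) ->
  measurable_fun setT (fun z : X * X => w z.1 z.2) -> (forall x y, 0 <= w x y) ->
  osc mu f (fun x y => v x y + w x y) = (osc mu f v + osc mu f w)%E.
Proof.
move=> mf mv v0 mw w0; rewrite /osc -ge0_integralD//.
- by apply: eq_integral => z _; rewrite -EFinD mulrDr.
- by move=> z _; rewrite lee_fin mulr_ge0.
- by apply/measurable_EFinP; exact: measurable_osc.
- by move=> z _; rewrite lee_fin mulr_ge0.
- by apply/measurable_EFinP; exact: measurable_osc.
Qed.

(** The normalization mu (ball x r) is comparable to r^dH. *)
Lemma KS_energy_osc : exists c1 c2 : R, [/\ 0 < c1, 0 < c2 & forall lambda (f : X -> R) r,
  measurable_fun setT f -> 0 < r ->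
  ((c2 * r `^ (lambda + dH))^-1%:E * osc mu f (near_diag r) <= KS_energy mu lambda 1 f r
    <= (c1 * r `^ (lambda + dH))^-1%:E * osc mu f (near_diag r))%E].
Proof.
have [c1 [c2 [c10 c20 H]]] := A2; exists c1, c2; split => // lambda f r mf r0.
have rl0 : 0 < r `^ lambda by rewrite powR_gt0.
have rd0 : 0 < r `^ dH by rewrite powR_gt0.
have rE : r `^ (lambda + dH) = r `^ lambda * r `^ dH.
  by rewrite powRD//; apply/implyP => _; rewrite gt_eqF.
have bx x : c1 * r `^ dH <= fine (mu (ball x r)) <= c2 * r `^ dH.
  have /andP[h1 h2] := H x r (ltW r0).
  have fin : mu (ball x r) \is a fin_num.
    by rewrite ge0_fin_numE//; apply: le_lt_trans h2 _; rewrite ltry.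
  by rewrite -!lee_fin fineK// h1.
have V0 x : 0 < fine (mu (ball x r)).
  by have /andP[h1 _] := bx x; apply: lt_le_trans h1; rewrite mulr_gt0.
have mn := measurable_near_diag r.
have E1 x : (\int[mu]_(y in ball x r) (`|f x - f y| `^ 1 /
     (r `^ (lambda * 1) * fine (mu (ball x r))))%:E =
   \int[mu]_y (`|f x - f y| * near_diag r x y / (r `^ lambda * fine (mu (ball x r))))%:E)%E.
  rewrite integral_mkcond; apply: eq_integral => y _.
  rewrite patchE /near_diag powRr1// mulr1 ballEmdist.
  case: ifPn => [|]; first by rewrite inE /= => ->; rewrite mulr1.
  by rewrite notin_setE /= => /negP/negbTE ->; rewrite mulr0 mul0r.
rewrite /KS_energy; under eq_integral do rewrite E1.
have c1r : 0 < c1 * r `^ (lambda + dH) by rewrite rE !mulr_gt0.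
have c2r : 0 < c2 * r `^ (lambda + dH) by rewrite rE !mulr_gt0.
rewrite -!oscZ ?invr_ge0 ?(ltW c1r) ?(ltW c2r)//.
have mZ c : measurable_fun setT (fun z : X * X => c * near_diag r z.1 z.2).
  exact: measurable_funM.
rewrite !osc_iterated//; last 2 first.
- by move=> x y; rewrite mulr_ge0// invr_ge0 ltW.
- by move=> x y; rewrite mulr_ge0// invr_ge0 ltW.
apply/andP; split; apply: ge0_le_integral_nomeas => x _.
- by apply: integral_ge0 => y _; rewrite lee_fin !mulr_ge0// invr_ge0 ltW.
- apply: ge0_le_integral_nomeas => y _.
    by rewrite lee_fin !mulr_ge0// invr_ge0 ltW.
  rewrite lee_fin mulrA mulrAC ler_wpM2l ?mulr_ge0// lef_pV2 ?posrE ?mulr_gt0 ?powR_gt0//.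
  have /andP[_ h] := bx x.
  by rewrite rE mulrCA ler_wpM2l// ltW.
- by apply: integral_ge0 => y _; rewrite lee_fin !mulr_ge0// invr_ge0 mulr_ge0// ltW.
- apply: ge0_le_integral_nomeas => y _.
    by rewrite lee_fin !mulr_ge0// invr_ge0 mulr_ge0// ltW.
  rewrite lee_fin [leRHS]mulrA [leRHS]mulrAC ler_wpM2l ?mulr_ge0// lef_pV2 ?posrE ?mulr_gt0 ?powR_gt0//.
  have /andP[h _] := bx x.
  by rewrite rE mulrCA ler_wpM2l// ltW.
Qed.

(** |f x - f y| <= |f x| + |f y|, and each of the two terms integrates over
d(x, y) < r to at most c2 r^dH times the L^1 norm of f. *)
Lemma osc_near_diag_L1 (f : X -> R) : f \in Lfun mu 1 ->
  exists2 M : R, 0 <= M & forall r, 0 < r -> (osc mu f (near_diag r) <= (M * r `^ dH)%:E)%E.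
Proof.
move=> f1; have mf := Lfun_measurable f1.
have if_ : mu.-integrable setT (EFin \o f) by exact/Lfun1_integrable.
have [c1 [c2 [c10 c20 H]]] := A2.
pose N := fine (\int[mu]_x (`|f x|)%:E)%E.
have Ny : (\int[mu]_x (`|f x|)%:E < +oo)%E by have /integrableP[] := if_.
have NE : (N%:E = \int[mu]_x (`|f x|)%:E)%E.
  by rewrite fineK// ge0_fin_numE//; apply: integral_ge0 => x _.
have N0 : 0 <= N by rewrite -lee_fin NE; apply: integral_ge0 => x _; rewrite lee_fin.
exists (2 * (c2 * N)) => [|r r0]; first by rewrite !mulr_ge0// ltW.
have mn := measurable_near_diag r.
pose H1 (z : X * X) := (`|f z.1| * near_diag r z.1 z.2)%:E.
have mH1 : measurable_fun setT H1.
  apply/measurable_EFinP; apply: measurable_funM => //; apply: measurableT_comp => //.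
  exact: measurableT_comp mf measurable_fst.
have H10 z : (0 <= H1 z)%E by rewrite lee_fin mulr_ge0.
have B : (\int[mu \x mu]_z H1 z <= (c2 * N * r `^ dH)%:E)%E.
  rewrite (@fubini_tonelli1 _ _ _ _ _ mu mu H1)//.
  have -> : c2 * N * r `^ dH = (c2 * r `^ dH) * N by ring.
  rewrite EFinM NE -ge0_integralZl_real ?mulr_ge0 ?powR_ge0 ?(ltW c20)//; last first.
    exact: measurableT_comp.
  apply: ge0_le_integral_nomeas => x _; first exact: integral_ge0.
  rewrite /H1 /= /fubini_F /=.
  have mnx : measurable_fun setT (near_diag r x).
    by apply: measurable_lt_natr; exact: measurable_mdistl.
  rewrite ge0_integralZl_real// [leRHS]EFinM muleC lee_wpmul2r ?lee_fin//.
  have /andP[_ h2] := H x r (ltW r0); apply: le_trans h2.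
  rewrite -[ball x r]setIT -integral_indic//; last exact: measurable_metric_ball.
  apply: ge0_le_integral_nomeas => y _; first by rewrite lee_fin.
  rewrite lee_fin indicE ballEmdist /near_diag; case: ltP => // yr.
  by rewrite mem_set.
apply: (@le_trans _ _ (\int[mu \x mu]_z (H1 z + H1 (z.2, z.1)))%E).
  apply: ge0_le_integral_nomeas => z _; first by rewrite lee_fin mulr_ge0.
  rewrite /H1 -EFinD lee_fin /= (near_diagC r z.2) -mulrDl ler_wpM2r//.
  exact: ler_normB.
have mH1' : measurable_fun setT (fun z : X * X => H1 (z.2, z.1)).
  by apply: (measurableT_comp mH1); apply: measurable_fun_pair.
rewrite ge0_integralD// integral_swap//.
apply: le_trans (leeD B B) _.
by rewrite -EFinD lee_fin; lra.
Qed.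

(** The upper limit controls only small r; at larger r the trivial L^1 bound
has a better power.  Lowering the exponent from l to lambda is harmless at
r < 1, and at larger r a positive power of r is bounded below. *)
Lemma KS_osc_bound (f : X -> R) (l lambda : R) : KS mu l 1 f -> 0 <= lambda <= l ->
  exists2 M : R, 0 <= M & forall r, 0 < r ->
    (osc mu f (near_diag r) <= (M * r `^ (lambda + dH))%:E)%E.
Proof.
move=> [f1 /limf_esup_lty_bound[e [M0 [e0 HM]]]] /andP[lam0 lam].
have mf := Lfun_measurable f1.
have [M1 M10 HM1] := osc_near_diag_L1 f1.
have [c1 [c2 [c10 c20 H]]] := KS_energy_osc.
have el0 : 0 < Num.min e 1 `^ lambda by rewrite powR_gt0// lt_min e0 ltr01.
have K0 : 0 <= c2 * `|M0| + M1 / (Num.min e 1) `^ lambda.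
  by apply: addr_ge0; [rewrite mulr_ge0// ltW|rewrite divr_ge0// ltW].
exists (c2 * `|M0| + M1 / (Num.min e 1) `^ lambda) => // r r0.
have rE : r `^ (lambda + dH) = r `^ lambda * r `^ dH.
  by rewrite powRD//; apply/implyP => _; rewrite gt_eqF.
have rd0 : 0 < r `^ dH by rewrite powR_gt0.
have [re|re] := ltP r (Num.min e 1).
  move: re; rewrite lt_min => /andP[re r1].
  have /andP[h _] := H l f r mf r0.
  have := le_trans h (HM r r0 re).
  have c2r : 0 < c2 * r `^ (l + dH) by rewrite mulr_gt0// powR_gt0.
  rewrite lee_pdivrMl// => {}h; apply: le_trans h _.
  rewrite -EFinM lee_fin.
  have rl : r `^ (l + dH) <= r `^ (lambda + dH).
    by apply: ger_powR; rewrite ?r0 ?(ltW r1)// lerD2r.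
  apply: (@le_trans _ _ (c2 * `|M0| * r `^ (lambda + dH))).
    rewrite -!mulrA ler_pM2l// mulrC.
    apply: (@le_trans _ _ (`|M0| * r `^ (l + dH))).
      by rewrite ler_wpM2r ?powR_ge0// ler_norm.
    exact: ler_wpM2l.
  by rewrite ler_wpM2r ?powR_ge0// lerDl divr_ge0// ltW.
apply: le_trans (HM1 r r0) _; rewrite lee_fin rE mulrA ler_wpM2r ?(ltW rd0)//.
apply: (@le_trans _ _ (M1 / Num.min e 1 `^ lambda * r `^ lambda)).
  rewrite -mulrA ler_peMr// mulrC ler_pdivlMr// mul1r.
  by apply: ge0_ler_powR; rewrite ?nnegrE ?le_min ?(ltW e0) ?ler01 ?(ltW r0).
by rewrite ler_wpM2r ?powR_ge0// lerDr mulr_ge0// ltW.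
Qed.

End KorevaarSchoen.

(** S is an extended real, such as a seminorm, so that the bound serves both for the
upper limit that defines the Korevaar-Schoen class and for the lower limit that
defines Var. *)
Lemma KS_of_osc_bound (R : realType) (d : measure_display) (X : borelMetricType R d)
    (mu : {sigma_finite_measure set X -> \bar R}) (dH : R) :
  proper_balls X -> ahlfors_regular mu dH ->
  exists2 c : R, 0 < c & forall (lambda : R) (f : X -> R) (C : R) (S : \bar R),
    measurable_fun setT f -> 0 < C ->
    (forall r, 0 < r -> (osc mu f (near_diag r) <= (C * r `^ (lambda + dH))%:E * S)%E) ->
    forall r, 0 < r -> (KS_energy mu lambda 1 f r <= (C / c)%:E * S)%E.
Proof.
move=> A1 A2; have [c1 [c2 [c10 c20 H]]] := KS_energy_osc A1 A2.
exists c1 => // lambda f C S mf C0 HS r r0.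
have /andP[_ h] := H lambda f r mf r0; apply: (le_trans h).
have cr : 0 < c1 * r `^ (lambda + dH) by rewrite mulr_gt0// powR_gt0.
rewrite lee_pdivrMl//; apply: (le_trans (HS r r0)).
rewrite muleA -EFinM (_ : c1 * _ * (C / c1) = C * r `^ (lambda + dH))//.
by field; rewrite gt_eqF.
Qed.

(** * The density of the stable subordinator *)

Section Subordinator.
Context (R : realType).
Variables (delta : R) (eta : R -> R -> R).
Hypothesis delta_gt0 : 0 < delta.
Hypothesis eta_density : subordinator_density delta eta.

Local Notation D := (`]0%R, +oo[%classic : set R).
Local Notation leb := (@lebesgue_measure R).

Let Dgt0 s : D s -> 0 < s. Proof. by rewrite /= in_itv /= andbT. Qed.

Lemma eta_ge0 t s : 0 < t -> D s -> 0 <= eta t s.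
Proof. by move=> t0 /Dgt0 s0; have [_ + _] := eta_density t0; exact. Qed.

Lemma eta_measurable t : 0 < t -> measurable_fun D (eta t).
Proof.
move=> t0; have [c _ _] := eta_density t0.
apply: open_continuous_measurable_fun; first exact: interval_open.
by move=> x xD; apply: c; move: xD; rewrite inE.
Qed.

Lemma eta_laplace t l : 0 < t -> 0 < l ->
  (\int[leb]_(s in D) (eta t s * expR (- (s * l)))%:E = (expR (- (t * l `^ delta)))%:E)%E.
Proof. by move=> t0; have [_ _ +] := eta_density t0; exact. Qed.

Let mexp (l : R) : measurable_fun D (fun s : R => expR (- (s * l))).
Proof.
apply: measurable_funTS; apply: measurableT_comp => //.
by apply: measurableT_comp => //; apply: measurable_funM.
Qed.

Let mD : measurable D. Proof. exact: measurable_itv. Qed.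

Lemma eta_integral_sum t (f g : R -> R) : 0 < t ->
  measurable_fun D f -> measurable_fun D g ->
  (forall s, D s -> 0 <= f s) -> (forall s, D s -> 0 <= g s) ->
  (\int[leb]_(s in D) (eta t s * (f s + g s))%:E =
   \int[leb]_(s in D) (eta t s * f s)%:E + \int[leb]_(s in D) (eta t s * g s)%:E)%E.
Proof.
move=> t0 mf mg f0 g0; have me := eta_measurable t0.
under eq_integral do rewrite mulrDr EFinD.
rewrite ge0_integralD//.
- by move=> s Ds; rewrite lee_fin mulr_ge0 ?f0// eta_ge0.
- by apply/measurable_EFinP; apply: measurable_funM.
- by move=> s Ds; rewrite lee_fin mulr_ge0 ?g0// eta_ge0.
- by apply/measurable_EFinP; apply: measurable_funM.
Qed.

Lemma eta_integralZ t (c : R) (f : R -> R) : 0 < t -> 0 <= c ->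
  measurable_fun D f -> (forall s, D s -> 0 <= f s) ->
  (\int[leb]_(s in D) (eta t s * (c * f s))%:E =
   c%:E * \int[leb]_(s in D) (eta t s * f s)%:E)%E.
Proof.
move=> t0 c0 mf f0; have me := eta_measurable t0.
rewrite -ge0_integralZl_real//.
- by apply: eq_integral => s _; rewrite mulrCA.
- exact: measurable_funM.
- by move=> s Ds; rewrite mulr_ge0 ?f0// eta_ge0.
Qed.

Lemma eta_integral_le t (f g : R -> R) : 0 < t ->
  (forall s, D s -> 0 <= f s) -> (forall s, D s -> f s <= g s) ->
  (\int[leb]_(s in D) (eta t s * f s)%:E <= \int[leb]_(s in D) (eta t s * g s)%:E)%E.
Proof.
move=> t0 f0 fg; apply: ge0_le_integral_nomeas => s Ds.
  by rewrite lee_fin mulr_ge0 ?f0// eta_ge0.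
by rewrite lee_fin ler_wpM2l ?eta_ge0// fg.
Qed.

(** Self-similarity of the stable law: time t corresponds to the scale
s = t^(1/delta). *)
Lemma laplace_exponent_scale t l : 0 < t -> 0 < l ->
  t * (l / t `^ delta^-1) `^ delta = l `^ delta.
Proof.
move=> t0 l0; have T0 : 0 < t `^ delta^-1 by rewrite powR_gt0.
rewrite powRM ?invr_ge0 ?(ltW l0) ?(ltW T0)//.
rewrite -(powR_inv1 (ltW T0)) -!powRrM mulrA mulrN1 mulNr mulVf ?gt_eqF//.
by rewrite powR_inv1 ?(ltW t0)// mulrCA mulfV ?mulr1// gt_eqF.
Qed.

Lemma expR1_gt2 : 2 < expR 1 :> R.
Proof. by have := @expR_gt1Dx R 1 (oner_neq0 _); lra. Qed.

(** With u = s / t^(1/delta), the function exp(-u) is at most the indicator of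
[a, 4] plus exp(1 - u / a) for u < a plus exp(-2 - u / 2) for u > 4.  By the
Laplace transform the last two contribute at most exp(-2) each, a being chosen
with a^-delta = 3, and exp(-1) > 2 exp(-2) because e > 2. *)
Lemma eta_mass : exists a c : R, [/\ 0 < a, a <= 4, 0 < c & forall t, 0 < t ->
  (c%:E <= \int[leb]_(s in D) (eta t s *
     (a * t `^ delta^-1 <= s <= 4 * t `^ delta^-1)%R%:R)%:E)%E].
Proof.
pose a : R := (3 `^ delta^-1)^-1.
have a30 : 0 < 3 `^ delta^-1 :> R by rewrite powR_gt0.
have a0 : 0 < a by rewrite invr_gt0.
have ea : a^-1 `^ delta = 3 by rewrite invrK -powRrM mulVf ?powRr1// gt_eqF.
have eN1 : expR (- 1) = expR 1 * expR (- 2) :> R.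
  by rewrite -expRD; congr expR; lra.
have c0 : 0 < expR (- 1) - (expR (- 2) + expR (- 2)) :> R.
  rewrite eN1; have := expR1_gt2; have := expR_gt0 (- 2 : R).
  move: (expR (- 2)) (expR 1) => u v; nra.
have a4 : a <= 4.
  apply: (@le_trans _ _ 1); last by rewrite ler1n.
  rewrite /a invf_le1// -[leLHS](powRr0 3); apply: ler_powR; first by rewrite ler1n.
  by rewrite invr_ge0 ltW.
exists a, (expR (- 1) - (expR (- 2) + expR (- 2))); split => // t t0.
pose T := t `^ delta^-1; have T0 : 0 < T by rewrite powR_gt0.
have me := eta_measurable t0.
pose I s : R := (a * T <= s <= 4 * T)%R%:R.
have mI : measurable_fun D I.
  apply: measurable_funTS; apply: measurable_natr; apply: measurable_and.
    exact: measurable_fun_ler.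
  exact: measurable_fun_ler.
have I0 s : 0 <= I s by [].
pose g1 s : R := expR (- (s * (1 / T))).
pose g2 s : R := expR 1 * expR (- (s * (a^-1 / T))).
pose g3 s : R := expR (- 2) * expR (- (s * (2^-1 / T))).
have LE : (\int[leb]_(s in D) (eta t s * g1 s)%:E <=
    \int[leb]_(s in D) (eta t s * (I s + (g2 s + g3 s)))%:E)%E.
  apply: eta_integral_le => // s /Dgt0 s0; first exact: expR_ge0.
  have g20 : 0 <= g2 s by rewrite mulr_ge0 ?expR_ge0.
  have g30 : 0 <= g3 s by rewrite mulr_ge0 ?expR_ge0.
  have [h1|h1] := leP (a * T) s; last first.
    have I_0 : I s = 0 by rewrite /I (lt_geF h1).
    apply: (@le_trans _ _ (g2 s)); last by rewrite I_0; lra.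
    apply: (@le_trans _ _ 1).
      by rewrite expR_le1 oppr_le0 mulr_ge0 ?divr_ge0 ?ltW.
    rewrite /g2 -expRD -[leLHS]expR0 ler_expR subr_ge0.
    rewrite mulrA ler_pdivrMr// mul1r ler_pdivrMr//.
    by rewrite ltW// mulrC.
  have [h2|h2] := leP s (4 * T).
    rewrite /I h1 h2 /=; apply: (@le_trans _ _ 1); last by lra.
    by rewrite expR_le1 oppr_le0 mulr_ge0 ?divr_ge0 ?ltW.
  apply: (@le_trans _ _ (g3 s)); last by have := I0 s; lra.
  rewrite /g1 /g3 -expRD ler_expR.
  have : 4 <= s / T by rewrite ler_pdivlMr// ltW.
  have -> : s * (1 / T) = s / T by rewrite mul1r.
  have -> : s * (2^-1 / T) = (s / T) / 2 by field; rewrite gt_eqF.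
  lra.
have I2 : (\int[leb]_(s in D) (eta t s * g2 s)%:E = (expR (- 2))%:E)%E.
  rewrite eta_integralZ ?expR_ge0//.
  rewrite eta_laplace ?divr_gt0 ?invr_gt0//.
  rewrite laplace_exponent_scale ?invr_gt0// ea -EFinM -expRD.
  by congr (expR _)%:E; lra.
have I3 : (\int[leb]_(s in D) (eta t s * g3 s)%:E <= (expR (- 2))%:E)%E.
  rewrite eta_integralZ ?expR_ge0//.
  rewrite eta_laplace ?divr_gt0 ?invr_gt0//.
  by rewrite -EFinM lee_fin ler_piMr ?expR_ge0// expR_le1 oppr_le0 mulr_ge0 ?powR_ge0// ltW.
have mg2 : measurable_fun D g2 by apply: measurable_funM.
have mg3 : measurable_fun D g3 by apply: measurable_funM.
have g20 s : 0 <= g2 s by rewrite mulr_ge0 ?expR_ge0.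
have g30 s : 0 <= g3 s by rewrite mulr_ge0 ?expR_ge0.
move: LE; rewrite eta_laplace ?divr_gt0// laplace_exponent_scale// powR1.
rewrite eta_integral_sum//; last 2 first.
- exact: measurable_funD.
- by move=> s _; rewrite addr_ge0.
rewrite eta_integral_sum// I2 => LE.
rewrite EFinB leeBlDr//; apply: (le_trans LE).
by rewrite EFinD; apply: leeD => //; apply: leeD.
Qed.

(** With u = s / t^(1/delta), cover u >= 1 by the dyadic intervals
[2^k, 2^(k+1)).  On such an interval exp(-v) - exp(-2 v) with v = u / 2^k is
bounded below, while its Laplace expectation is at most (2 / 2^k)^delta;
so the series of 2^(k theta) 2^(-k delta) dominates the moment. *)
Lemma eta_moment theta : 0 < theta -> theta < delta -> exists2 C : R, 0 < C &
  forall t, 0 < t ->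
  (\int[leb]_(s in D) (eta t s * s `^ theta)%:E <= (C * t `^ (theta / delta))%:E)%E.
Proof.
move=> th0 thd.
pose K : R := (expR (- 2) * (1 - expR (- 1)))^-1.
have e1 : expR (- 1) < 1 :> R by rewrite expR_lt1; lra.
have K0 : 0 < K by rewrite invr_gt0 mulr_gt0 ?expR_gt0// subr_gt0.
pose q : R := 2 `^ (theta - delta).
have q01 : 0 <= q < 1.
  rewrite powR_ge0 /= /q.
  have : expR ((theta - delta) * ln 2) < 1 :> R.
    rewrite expR_lt1 nmulr_rlt0; last by rewrite subr_lt0.
    by rewrite ln_gt0// ltr1n.
  by rewrite mulrC expRM lnK// posrE.
pose c : R := K * 2 `^ theta * 2 `^ delta.
have c0 : 0 < c by rewrite !mulr_gt0 ?powR_gt0.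
have q1' : 0 < 1 - q by rewrite subr_gt0; case/andP: q01.
exists (1 + c / (1 - q)) => [|t t0]; first by rewrite addr_gt0// divr_gt0.
pose T := t `^ delta^-1; have T0 : 0 < T by rewrite powR_gt0.
have me := eta_measurable t0.
have TE : T `^ theta = t `^ (theta / delta) by rewrite /T -powRrM mulrC.
pose g0 s : R := expR 1 * expR (- (s * (1 / T))).
pose l k : R := (2 ^+ k)^-1.
have l0 k : 0 < l k by rewrite invr_gt0 exprn_gt0.
pose ck k : R := K * (2 ^+ k.+1) `^ theta.
have ck0 k : 0 <= ck k by rewrite mulr_ge0 ?powR_ge0// ltW.
pose h k s : R := expR (- (s * (l k / T))) - expR (- (s * (2 * l k / T))).
have h0 k s : D s -> 0 <= h k s.
  move=> /Dgt0 s0; rewrite subr_ge0 ler_expR lerN2 ler_wpM2l ?(ltW s0)//.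
  by rewrite ler_wpM2r ?invr_ge0 ?(ltW T0)// ler_peMl ?(ltW (l0 k))// ler1n.
have mh k : measurable_fun D (h k) by apply: measurable_funB.
(* The term k with 2^k <= s / T < 2^(k+1) alone dominates when s >= T, and g0
dominates when s < T. *)
have PW s : D s -> (((s / T) `^ theta)%:E <= (g0 s)%:E + \sum_(k <oo) (ck k * h k s)%:E)%E.
  move=> Ds; have s0 := Dgt0 Ds; have u0 : 0 < s / T by rewrite divr_gt0.
  have g00 : 0 <= g0 s by rewrite mulr_ge0 ?expR_ge0.
  have S0 k : (0 <= (ck k * h k s)%:E)%E by rewrite lee_fin mulr_ge0// h0.
  have [u1|u1] := ltP (s / T) 1.
    apply: (@le_trans _ _ (g0 s)%:E); last first.
      by rewrite leeDl//; apply: nneseries_ge0 => k _ _.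
    rewrite lee_fin /g0 -expRD; apply: (@le_trans _ _ 1).
      have th1 : 1 `^ theta = 1 :> R by rewrite powR1.
      rewrite -[leRHS]th1.
      by apply: ge0_ler_powR; rewrite ?nnegrE ?ltW.
    by rewrite -[leLHS]expR0 ler_expR mul1r subr_ge0 ltW.
  have [k /andP[ku uk]] := dyadic_floor u1.
  have p0 : 0 < 2 ^+ k :> R by rewrite exprn_gt0.
  apply: (@le_trans _ _ (ck k * h k s)%:E); last first.
    apply: (@le_trans _ _ (\sum_(k <oo) (ck k * h k s)%:E)%E); last first.
      by rewrite leeDr// lee_fin.
    rewrite (@nneseriesD1 _ (fun k => (ck k * h k s)%:E) k)//= leeDl//.
    by apply: nneseries_ge0 => j _ _.
  rewrite lee_fin; pose v := s / T / 2 ^+ k.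
  have hE : h k s = expR (- v) * (1 - expR (- v)).
    rewrite /h mulrBr mulr1 -expRD; congr (expR _ - expR _).
      by rewrite /v /l; field; rewrite !gt_eqF.
    by rewrite /v /l; field; rewrite !gt_eqF.
  have v1 : 1 <= v by rewrite ler_pdivlMr// mul1r.
  have v2 : v <= 2 by rewrite ler_pdivrMr// -exprS ltW.
  have hK : K^-1 <= h k s.
    rewrite hE invrK ler_pM ?expR_ge0 ?subr_ge0 ?(ltW e1)//.
      by rewrite ler_expR lerN2.
    by rewrite lerB// ler_expR lerN2.
  apply: (@le_trans _ _ ((2 ^+ k.+1) `^ theta)).
    by apply: ge0_ler_powR; rewrite ?nnegrE ?exprn_ge0 ?ltW.
  rewrite /ck mulrAC ler_peMl ?powR_ge0//.
  by rewrite mulrC -ler_pdivrMr// mul1r.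
have IH k : (\int[leb]_(s in D) (eta t s * h k s)%:E <= ((2 * l k) `^ delta)%:E)%E.
  have := @eta_integral_sum t (h k) (fun s => expR (- (s * (2 * l k / T)))) t0 (mh k)
    (@mexp _) (h0 k) (fun s _ => expR_ge0 _).
  rewrite [X in (_ = _ + X)%E]eta_laplace//; last by rewrite divr_gt0 ?mulr_gt0.
  have -> : (\int[leb]_(s in D) (eta t s * (h k s + expR (- (s * (2 * l k / T)))))%:E =
      \int[leb]_(s in D) (eta t s * expR (- (s * (l k / T))))%:E)%E.
    by apply: eq_integral => s _; rewrite /h subrK.
  rewrite eta_laplace ?divr_gt0// !laplace_exponent_scale ?mulr_gt0// => e.
  have -> : (\int[leb]_(s in D) (eta t s * h k s)%:E =
      (expR (- l k `^ delta))%:E - (expR (- (2 * l k) `^ delta))%:E)%E.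
    by rewrite e addeK.
  rewrite -EFinB lee_fin; set B := (2 * l k) `^ delta.
  have := expR_ge1Dx (- B); have : expR (- l k `^ delta) <= 1.
    by rewrite expR_le1 oppr_le0 powR_ge0.
  lra.
pose G s : \bar R := (T `^ theta * (eta t s * g0 s))%:E.
pose H k s : \bar R := ((T `^ theta * ck k) * (eta t s * h k s))%:E.
have Tth0 : 0 <= T `^ theta by exact: powR_ge0.
have Hk0 k s : D s -> (0 <= H k s)%E.
  move=> Ds; rewrite lee_fin; apply: mulr_ge0; first exact: mulr_ge0.
  by apply: mulr_ge0; [exact: eta_ge0|exact: h0].
have mg0 : measurable_fun D g0 by apply: measurable_funM.
have g0_ge0 s : 0 <= g0 s by rewrite mulr_ge0 ?expR_ge0.
have G0 s : D s -> (0 <= G s)%E.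
  by move=> Ds; rewrite lee_fin mulr_ge0// mulr_ge0 ?eta_ge0.
have mG : measurable_fun D G.
  apply/measurable_EFinP; apply: measurable_funM => //; exact: measurable_funM.
have mH k : measurable_fun D (H k).
  by apply/measurable_EFinP; apply: measurable_funM => //; apply: measurable_funM.
apply: (@le_trans _ _ (\int[leb]_(s in D) (G s + \sum_(k <oo) H k s))%E).
  apply: ge0_le_integral_nomeas => s Ds.
    by rewrite lee_fin mulr_ge0 ?powR_ge0// eta_ge0.
  have s0 := Dgt0 Ds.
  have w0 : (0 <= (T `^ theta * eta t s)%:E)%E by rewrite lee_fin mulr_ge0// eta_ge0.
  have -> : (eta t s * s `^ theta)%:E = ((T `^ theta * eta t s)%:E * ((s / T) `^ theta)%:E)%E.
    rewrite -EFinM; congr EFin; rewrite mulrAC -powRM ?divr_ge0 ?(ltW T0) ?(ltW s0)//.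
    by rewrite (mulrC T) divfK ?gt_eqF// mulrC.
  apply: le_trans (lee_wpmul2l w0 (PW s Ds)) _.
  rewrite ge0_muleDr; last 2 first.
  - by rewrite lee_fin mulr_ge0 ?expR_ge0.
  - by apply: nneseries_ge0 => k _ _; rewrite lee_fin mulr_ge0// h0.
  apply: leeD; first by rewrite -EFinM lee_fin mulrA.
  rewrite -nneseriesZl; last by move=> k _; rewrite lee_fin mulr_ge0// h0.
  apply: lee_nneseries => [k _ _|k _].
    by rewrite mule_ge0// lee_fin mulr_ge0// h0.
  by rewrite -EFinM lee_fin le_eqVlt; apply/orP; left; apply/eqP; ring.
rewrite ge0_integralD//; last 2 first.
- by move=> s Ds; apply: nneseries_ge0 => k _ _; exact: Hk0.
- by apply: ge0_emeasurable_sum => [k s Ds _|k _]; [exact: Hk0|exact: mH].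
rewrite integral_nneseries//.
rewrite mulrDl mul1r EFinD; apply: leeD.
  rewrite /G ge0_integralZl_real//; last 2 first.
  - exact: measurable_funM.
  - by move=> s Ds; rewrite mulr_ge0 ?eta_ge0.
  rewrite eta_integralZ ?expR_ge0//.
  rewrite eta_laplace ?divr_gt0// laplace_exponent_scale// powR1.
  by rewrite -!EFinM lee_fin -expRD subrr expR0 mulr1 TE.
apply: (@le_trans _ _ (\sum_(k <oo) (T `^ theta * c * q ^+ k)%:E)%E).
  apply: lee_nneseries => [k _ _|k _]; first by apply: integral_ge0 => s Ds; exact: Hk0.
  rewrite /H ge0_integralZl_real//; last 3 first.
  - by apply: measurable_funM; [exact: me|exact: mh].
  - by move=> s Ds; rewrite mulr_ge0 ?h0// eta_ge0.
  - by rewrite mulr_ge0.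
  apply: (@le_trans _ _ ((T `^ theta * ck k)%:E * ((2 * l k) `^ delta)%:E)%E).
    by apply: lee_wpmul2l => //; rewrite lee_fin mulr_ge0.
  rewrite -EFinM lee_fin le_eqVlt; apply/orP; left; apply/eqP.
  have pw (x : R) : (2 ^+ k) `^ x = (2 `^ x) ^+ k.
    by rewrite -powR_mulrn// -powR_mulrn ?powR_ge0// -!powRrM mulrC.
  have p0 : 0 < 2 ^+ k :> R by rewrite exprn_gt0.
  have -> : (2 * l k) `^ delta = 2 `^ delta * ((2 `^ delta) ^+ k)^-1.
    rewrite powRM// ?(ltW (l0 k))// /l -(powR_inv1 (ltW p0)) -powRrM mulN1r powRN.
    by rewrite pw.
  rewrite /ck exprS powRM// ?(ltW p0)// pw /c /q.
  rewrite powRB; last by rewrite pnatr_eq0 implybT.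
  rewrite expr_div_n; ring.
apply: le_trans (nneseries_geometric_le _ q01) _.
  by rewrite mulr_ge0// ltW.
by rewrite lee_fin TE le_eqVlt; apply/orP; left; apply/eqP; ring.
Qed.

End Subordinator.

(** * The heat flow *)

Section HeatFlow.
Context (R : realType) (d : measure_display) (X : borelMetricType R d).
Variable mu : {sigma_finite_measure set X -> \bar R}.
Variables (F : set (X -> R)) (E : (X -> R) -> (X -> R) -> R).
Variables (P : R -> (X -> R) -> X -> R) (p : R -> X -> X -> R) (dH dW kappa : R).
Hypotheses (supp : fully_supported mu) (A1 : proper_balls X).
Hypotheses (dH_gt0 : 0 < dH) (A2 : ahlfors_regular mu dH).
Hypothesis P_heat : heat_semigroup mu F E P.
Hypothesis HKc : continuous_heat_kernel mu P p.
Hypothesis dW_ge2 : 2 <= dW.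
Hypothesis HK : sub_gaussian_bounds mu dH dW p.
Hypotheses (kappa_gt0 : 0 < kappa) (kappa_lt : kappa < dW).
Hypothesis BE : weak_bakry_emery mu kappa dW p.

Let dW0 : 0 < dW. Proof. by rewrite (lt_le_trans _ dW_ge2). Qed.
Let dW1 : 0 < dW - 1. Proof. by have := dW_ge2; lra. Qed.

(** ** Pointwise bounds on the heat kernel *)

(** Times are written rho^dW from here on, so that rho is the spatial scale of the
heat kernel. *)
Lemma powR_scale (rho a : R) : 0 < rho -> (rho `^ dW) `^ (- (a / dW)) = rho `^ (- a).
Proof. by move=> r0; rewrite -powRrM mulrN mulrCA mulfV ?mulr1// gt_eqF. Qed.

Lemma heat_kernel_ge0 t x y : 0 < t -> 0 <= p t x y.
Proof.
move=> t0; have [c3 [c4 [c5 [c6 [c30 c40 c50 c60 H]]]]] := HK.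
have [cp _] := HKc t0.
rewrite -oppr_le0.
apply: (@ae_le_continuous _ _ X mu (fun z => - p t z.1 z.2) setT 0 supp _ openT _ (x, y) I).
  by move=> z; apply: cvgN; exact: cp.
apply: filterS (H t t0) => z /andP[h _] _.
rewrite oppr_le0; apply: le_trans h.
by rewrite !mulr_ge0 ?powR_ge0 ?expR_ge0// ltW.
Qed.

(** The almost everywhere lower bound is constant on the open set
d(x, y) < rho, up to a factor, and so extends to all its points by continuity. *)
Lemma heat_kernel_lower : exists2 c : R, 0 < c & forall rho x y, 0 < rho ->
  mdist x y < rho -> c * rho `^ (- dH) <= p (rho `^ dW) x y.
Proof.
have [c3 [c4 [c5 [c6 [c30 c40 c50 c60 H]]]]] := HK.
exists (c5 * expR (- c6)); first by rewrite mulr_gt0// expR_gt0.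
move=> rho x y r0 xy.
have t0 : 0 < rho `^ dW by rewrite powR_gt0.
have [cp _] := HKc t0.
rewrite -lerN2.
have oU : open [set z : X * X | mdist z.1 z.2 < rho].
  by have /continuousP/(_ _ (@open_lt R rho)) := @continuous_mdist _ _ X.
apply: (@ae_le_continuous _ _ X mu (fun z => - p (rho `^ dW) z.1 z.2) _ _ supp _ oU _ (x, y) xy).
  by move=> z; apply: cvgN; exact: cp.
apply: filterS (H _ t0) => z /andP[h _] /= zr.
rewrite lerN2; apply: le_trans h.
rewrite powR_scale// mulrAC ler_pM2l; last by rewrite mulr_gt0// powR_gt0.
rewrite ler_expR lerN2 -[leRHS]mulr1 ler_pM2l//.
rewrite powR_divl ?mdist_ge0// -powRrM.
have dg0 : 0 <= dW * (dW - 1)^-1 by rewrite mulr_ge0 ?invr_ge0 ?ltW.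
have e1 : 1 `^ (dW * (dW - 1)^-1) = 1 :> R by rewrite powR1.
rewrite -[leRHS]e1.
rewrite ge0_ler_powR// ?nnegrE ?divr_ge0 ?mdist_ge0 ?(ltW r0)//.
by rewrite ler_pdivrMr// mul1r ltW.
Qed.

(** On the open set where the distance exceeds d(x, y) / 2 the almost everywhere
upper bound is at most its value at distance d(x, y) / 2, and so holds at (x, y)
by continuity.  The stretched exponential has exponent dW / (dW - 1) >= 1,
hence decays faster than any power. *)
Lemma heat_kernel_upper b : exists2 C : R, 0 < C & forall rho x y, 0 < rho ->
  p (rho `^ dW) x y <= C * rho `^ (- dH) * decay b (mdist x y / rho).
Proof.
have [c3 [c4 [c5 [c6 [c30 c40 c50 c60 H]]]]] := HK.
have c42 : 0 < c4 / 2 by rewrite divr_gt0.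
have [C1 C10 HC1] := expRN_le_decay b c42.
exists (c3 * expR c4 * C1); first by rewrite !mulr_gt0// expR_gt0.
move=> rho x y r0.
have t0 : 0 < rho `^ dW by rewrite powR_gt0.
have [cp _] := HKc t0.
pose u := mdist x y / rho.
have u0 : 0 <= u by rewrite divr_ge0 ?mdist_ge0// ltW.
suff h : p (rho `^ dW) x y <=
    c3 * rho `^ (- dH) * (expR c4 * expR (- (c4 / 2 * u))).
  apply: le_trans h _; rewrite [leRHS](_ : _ = c3 * rho `^ (- dH) *
    (expR c4 * (C1 * decay b (mdist x y / rho)))); last by ring.
  rewrite ler_pM2l ?mulr_gt0 ?powR_gt0// ler_pM2l ?expR_gt0//.
  exact: HC1.
rewrite -expRD.
have [u2|u2] := ltP 2 u; last first.
  (* For d(x, y) <= 2 rho the exponential in the goal is at least 1, so the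
  maximum c3 t^(- dH / dW) of the upper bound suffices. *)
  apply: (@ae_le_continuous _ _ X mu (fun z => p (rho `^ dW) z.1 z.2) setT _ supp _ openT _ (x, y) I).
    exact: cp.
  apply: filterS (H _ t0) => z /andP[_ h] _.
  apply: le_trans h _.
  rewrite powR_scale// ler_pM2l ?mulr_gt0 ?powR_gt0//.
  rewrite ler_expR (@le_trans _ _ 0)//.
    by rewrite oppr_le0 mulr_ge0 ?powR_ge0 ?ltW.
  by nra.
have oU : open [set z : X * X | mdist x y / 2 < mdist z.1 z.2].
  by have /continuousP/(_ _ (@open_gt R (mdist x y / 2))) := @continuous_mdist _ _ X.
have ur : u * rho = mdist x y by rewrite /u divfK// gt_eqF.
have xy : mdist x y / 2 < mdist x y by rewrite -ur; nra.
apply: (@ae_le_continuous _ _ X mu (fun z => p (rho `^ dW) z.1 z.2) _ _ supp _ oU _ (x, y) xy).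
  exact: cp.
apply: filterS (H _ t0) => z /andP[_ h] /= zr.
apply: le_trans h _.
rewrite powR_scale// ler_pM2l ?mulr_gt0 ?powR_gt0//.
rewrite ler_expR powR_divl ?mdist_ge0// -powRrM.
set e := dW * _; set v := mdist z.1 z.2 / rho.
have e1 : 1 <= e by rewrite /e -[leLHS](mulfV (_ : dW - 1 != 0)) ?gt_eqF// ler_pM2r ?invr_gt0//; lra.
have v1 : u / 2 <= v by rewrite /u /v mulrAC ler_pM2r ?invr_gt0// ltW.
have vv : v <= v `^ e by apply: le1r_powR => //; lra.
have : c4 * (u / 2) <= c4 * v `^ e by rewrite ler_pM2l//; lra.
lra.
Qed.

Let p_ge0 := heat_kernel_ge0.

Lemma measurable_heat_kernel t : 0 < t ->
  measurable_fun setT (fun z : X * X => p t z.1 z.2).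
Proof. by move=> t0; apply: continuous_prod_measurable => //; have [] := HKc t0. Qed.

Lemma measurable_heat_kernelr t x : 0 < t -> measurable_fun setT (p t x).
Proof.
by move=> t0; have := measurableT_comp (measurable_heat_kernel t0) (pair1_measurable x).
Qed.

Lemma time_scale t : 0 < t -> exists2 rho : R, 0 < rho & rho `^ dW = t.
Proof.
move=> t0; exists (t `^ dW^-1); first by rewrite powR_gt0.
by rewrite -powRrM mulVf ?gt_eqF// powRr1// ltW.
Qed.

Lemma decay_mass : exists2 C : R, 0 < C & forall x rho, 0 < rho ->
  (\int[mu]_y (decay (dH + 1) (mdist x y / rho))%:E <= (C * rho `^ dH)%:E)%E.
Proof.
have [c1 [c2 [c10 c20 H]]] := A2.
exists (2 `^ (dH + 1) * c2) => [|x rho rho0]; first by rewrite mulr_gt0// powR_gt0.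
have := @integral_decay_le R _ X mu (cst 1) (mdist x) dH c2.
move=> /(_ _ _ (measurable_mdistl x) (ltW dH_gt0) (ltW c20) _ rho rho0).
under eq_integral do rewrite mul1r.
apply => //= r r0; under eq_integral do rewrite mul1r.
have /andP[_] := H x r (ltW r0); apply: le_trans.
rewrite -[ball x r]setIT -integral_indic//; last exact: measurable_metric_ball.
apply: ge0_le_integral_nomeas => y _; first by rewrite lee_fin.
rewrite lee_fin indicE ballEmdist; case: ltP => // yr.
by rewrite mem_set.
Qed.

(** Absorb the factor max(1, d / rho)^b into the tail of the heat kernel and
integrate the remaining decay of order dH + 1. *)
Lemma heat_kernel_moment b : 0 <= b -> exists2 C : R, 0 < C &
  forall rho x, 0 < rho ->
  (\int[mu]_y (p (rho `^ dW) x y * Num.max 1 (mdist x y / rho) `^ b)%:E <= C%:E)%E.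
Proof.
move=> b0; have [C1 C10 H1] := decay_mass.
have [C2 C20 H2] := heat_kernel_upper (dH + 1 + b).
exists (C2 * C1) => [|rho x rho0]; first by rewrite mulr_gt0.
have rd0 : 0 < rho `^ (- dH) by rewrite powR_gt0.
apply: (@le_trans _ _ (\int[mu]_y
    ((C2 * rho `^ (- dH)) * decay (dH + 1) (mdist x y / rho))%:E)%E).
  apply: ge0_le_integral_nomeas => y _.
    by rewrite lee_fin mulr_ge0 ?powR_ge0// p_ge0// powR_gt0.
  rewrite lee_fin; apply: le_trans (ler_wpM2r _ (H2 _ _ _ rho0)) _.
    exact: powR_ge0.
  have m0 : Num.max 1 (mdist x y / rho) != 0 by rewrite gt_eqF// lt_max ltr01.
  have e : decay b (mdist x y / rho) * Num.max 1 (mdist x y / rho) `^ b = 1.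
    by rewrite /decay -powRD ?m0 ?implybT// addNr powRr0.
  rewrite decayD; move: (decay b _) (Num.max _ _ `^ b) e => D N e.
  by rewrite -!mulrA e mulr1.
rewrite ge0_integralZl_real//; last 3 first.
- by apply: measurable_decay; exact: measurable_mdistl.
- by move=> y _; exact: decay_ge0.
- by rewrite mulr_ge0// ltW.
apply: le_trans (lee_pmul _ _ (lexx _) (H1 x _ rho0)) _.
- by rewrite lee_fin mulr_ge0// ltW.
- by apply: integral_ge0 => y _; rewrite lee_fin decay_ge0.
rewrite -EFinM lee_fin powRN le_eqVlt; apply/orP; left; apply/eqP; field.
by rewrite gt_eqF// powR_gt0.
Qed.

Lemma heat_kernel_mass_bound : exists2 C : R, 0 < C &
  forall t x, 0 < t -> (\int[mu]_y (p t x y)%:E <= C%:E)%E.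
Proof.
have [C C0 H] := heat_kernel_moment (lexx 0); exists C => // t x t0.
have [rho rho0 <-] := time_scale t0.
by have := H rho x rho0; under eq_integral do rewrite powRr0 mulr1.
Qed.

Lemma kernel_op_integrable t x (g : X -> R) K : 0 < t -> measurable_fun setT g ->
  (forall y, `|g y| <= K) ->
  mu.-integrable setT (EFin \o (fun y => p t x y * g y)).
Proof.
move=> t0 mg gK; have [C C0 H] := heat_kernel_mass_bound.
have K0 : 0 <= K by exact: le_trans (normr_ge0 _) (gK x).
apply: (@integrable_dominated _ _ _ _ _ _ (fun y => K * p t x y)) => //.
- by apply: measurable_funM => //; exact: measurable_heat_kernelr.
- by move=> y _; rewrite normrM mulrC (ger0_norm (p_ge0 _ _ t0)) ler_wpM2r// p_ge0.
rewrite ge0_integralZl_real//; last 2 first.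
- exact: measurable_heat_kernelr.
- by move=> y _; exact: p_ge0.
by rewrite lte_mul_pinfty// ?lee_fin// (le_lt_trans (H t x t0))// ltry.
Qed.

Lemma kernel_opE t x (g : X -> R) K : 0 < t -> measurable_fun setT g ->
  (forall y, `|g y| <= K) ->
  ((kernel_op mu (p t) g x)%:E = \int[mu]_y (p t x y * g y)%:E)%E.
Proof.
by move=> t0 mg gK; apply: EFin_Rintegral => //; exact: kernel_op_integrable gK.
Qed.

Lemma kernel_op_measurable t (g : X -> R) : 0 < t -> measurable_fun setT g ->
  (forall y, 0 <= g y) -> measurable_fun setT (kernel_op mu (p t) g).
Proof.
move=> t0 mg g0.
apply: (measurableT_comp (fine_measurable measurableT)).
apply: (measurable_fun_fubini_tonelli_F (fun z : X * X => (p t z.1 z.2 * g z.2)%:E)).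
  apply/measurable_EFinP; apply: measurable_funM; first exact: measurable_heat_kernel.
  exact: measurableT_comp mg measurable_snd.
by move=> z; rewrite lee_fin mulr_ge0// p_ge0.
Qed.

Lemma kernel_op_ge0 t (g : X -> R) x : 0 < t -> (forall y, 0 <= g y) ->
  0 <= kernel_op mu (p t) g x.
Proof. by move=> t0 g0; apply: Rintegral_ge0 => y _; rewrite mulr_ge0// p_ge0. Qed.

Lemma kernel_op_le t (f g : X -> R) x K : 0 < t ->
  measurable_fun setT f -> measurable_fun setT g ->
  (forall y, 0 <= f y <= g y) -> (forall y, g y <= K) ->
  kernel_op mu (p t) f x <= kernel_op mu (p t) g x.
Proof.
move=> t0 mf mg fg gK; rewrite -lee_fin (@kernel_opE _ _ _ K)//; last first.
  move=> y; have /andP[f0 fgy] := fg y; rewrite ger0_norm//.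
  exact: le_trans (gK y).
rewrite (@kernel_opE _ _ _ K)//; last first.
  move=> y; have /andP[f0 fgy] := fg y; rewrite ger0_norm//.
  exact: le_trans fgy.
apply: ge0_le_integral_nomeas => y _; have /andP[f0 fgy] := fg y.
  by rewrite lee_fin mulr_ge0// p_ge0.
by rewrite lee_fin ler_wpM2l// p_ge0.
Qed.

(** The semigroup law, transferred from classes of L^2 to the pointwise defined
kernel operators. *)
Lemma chapman_kolmogorov s t (f : X -> R) : 0 < s -> 0 < t -> f \in Lfun mu 2%:E ->
  (forall y, 0 <= f y) ->
  kernel_op mu (p (s + t)) f = kernel_op mu (p s) (kernel_op mu (p t) f) %[ae mu].
Proof.
move=> s0 t0 f2 f0.
have mf := Lfun_measurable f2.
have [_ /(_ _ f2) hst] := HKc (addr_gt0 s0 t0).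
have [_ /(_ _ f2) ht] := HKc t0.
have Pt2 := heat_L2 P_heat t0 f2.
have kt2 : kernel_op mu (p t) f \in Lfun mu 2%:E.
  exact: Lfun2_ae Pt2 (kernel_op_measurable t0 mf f0) ht.
have [_ /(_ _ kt2) hs] := HKc s0.
have := heat_semi P_heat s0 t0 f2; have := heat_ae P_heat s0 Pt2 kt2 ht.
move=> h3 h4; apply: ae_eq_trans (ae_eq_sym hst) _.
by apply: ae_eq_trans h4 _; exact: ae_eq_trans h3 hs.
Qed.

Definition heat_mass t : X -> R := kernel_op mu (p t) (cst 1).

Let norm1 : forall y : X, `|(cst 1 : X -> R) y| <= 1.
Proof. by move=> y; rewrite normr1. Qed.

Lemma heat_massE t x : 0 < t -> ((heat_mass t x)%:E = \int[mu]_y (p t x y)%:E)%E.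
Proof.
move=> t0; rewrite /heat_mass (@kernel_opE _ _ _ 1)//.
by under eq_integral do rewrite mulr1.
Qed.

Lemma heat_mass_upper : exists2 C : R, 0 < C & forall t x, 0 < t -> heat_mass t x <= C.
Proof.
have [C C0 H] := heat_kernel_mass_bound; exists C => // t x t0.
by rewrite -lee_fin heat_massE// H.
Qed.

Lemma heat_mass_lower : exists2 c : R, 0 < c & forall t x, 0 < t -> c <= heat_mass t x.
Proof.
have [c c0 H] := heat_kernel_lower.
have [c1 [c2 [c10 c20 H2]]] := A2.
exists (c * c1) => [|t x t0]; first by rewrite mulr_gt0.
rewrite -lee_fin heat_massE//; have [rho rho0 <-] := time_scale t0.
have r0 : 0 < rho `^ dH by rewrite powR_gt0.
have rN : rho `^ (- dH) = (rho `^ dH)^-1 by rewrite powRN.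
apply: (@le_trans _ _ (\int[mu]_y (c * rho `^ (- dH) * \1_(ball x rho) y)%:E)%E).
  rewrite ge0_integralZl_real//; last 2 first.
  - by apply: measurable_indic; exact: measurable_metric_ball.
  - by rewrite mulr_ge0 ?powR_ge0// ltW.
  rewrite integral_indic//; last exact: measurable_metric_ball.
  rewrite setIT.
  have /andP[h _] := H2 x rho (ltW rho0).
  apply: le_trans (lee_pmul _ _ (lexx _) h); last 2 first.
  - by rewrite lee_fin mulr_ge0 ?powR_ge0// ltW.
  - by rewrite lee_fin mulr_ge0 ?powR_ge0// ltW.
  rewrite -EFinM lee_fin rN le_eqVlt; apply/orP; left; apply/eqP; field.
  by rewrite gt_eqF.
apply: ge0_le_integral_nomeas => y _.
  by rewrite lee_fin !mulr_ge0 ?powR_ge0// ltW.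
rewrite lee_fin indicE; case: (boolP (y \in _)) => [|_].
  by rewrite inE ballEmdist /= mulr1 => yr; exact: H.
by rewrite mulr0 p_ge0// powR_gt0.
Qed.

Lemma heat_mass_measurable t : 0 < t -> measurable_fun setT (heat_mass t).
Proof. by move=> t0; apply: kernel_op_measurable. Qed.

(** ** Conservativeness *)

Lemma ball_measure_lty (x : X) (r : R) : (mu (ball x r) < +oo)%E.
Proof.
have [c1 [c2 [_ _ H]]] := A2.
apply: (@le_lt_trans _ _ (mu (ball x (Num.max 0 r)))).
  apply: le_measure; rewrite ?inE; try exact: measurable_metric_ball.
  by apply: le_ball; rewrite le_max lexx orbT.
have m0 : 0 <= Num.max 0 r by rewrite le_max lexx.
have /andP[_ h] := H x _ m0.
exact: le_lt_trans h (ltry _).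
Qed.

Section Exhaustion.

Let f x0 n : X -> R := \1_(ball x0 n%:R).
Let f_ge0 x0 n y : 0 <= f x0 n y. Proof. by rewrite /f indicE. Qed.
Let f_le1 x0 n y : `|f x0 n y| <= 1.
Proof. by rewrite ger0_norm// /f indicE lern1 leq_b1. Qed.
Let mf x0 n : measurable_fun setT (f x0 n).
Proof. by apply: measurable_indic; exact: measurable_metric_ball. Qed.

Lemma kernel_op_balls_cvg x0 t x : 0 < t ->
  (kernel_op mu (p t) (f x0 n) x)%:E @[n --> \oo] --> (heat_mass t x)%:E.
Proof.
move=> t0; rewrite (heat_massE _ t0).
have UB : \bigcup_n ball x0 n%:R = [set: X].
  apply/seteqP; split => // y _; exists (Num.truncn (mdist x0 y)).+1 => //.
  by rewrite ballEmdist /=; exact: truncnS_gt.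
rewrite (_ : (fun n => _) = (fun n => \int[mu]_(y in ball x0 n%:R) (p t x y)%:E)%E).
  rewrite -[X in (\int[mu]_(y in X) _)%E]UB.
  apply: ge0_nondecreasing_set_cvg_integral.
  - move=> m n mn; apply/subsetPset; apply: le_ball; by rewrite ler_nat.
  - by move=> n; exact: measurable_metric_ball.
  - move=> n; apply/measurable_EFinP; apply: measurable_funTS; exact: measurable_heat_kernelr.
  - by move=> n y _; rewrite lee_fin p_ge0.
apply/funext => n; rewrite (kernel_opE _ t0 (mf x0 n) (f_le1 x0 n)).
rewrite [RHS]integral_mkcond; apply: eq_integral => y _.
by rewrite /f indicE patchE; case: (y \in _); rewrite ?mulr1 ?mulr0.
Qed.

(** The constant 1 is not in L^2: apply the Chapman-Kolmogorov relation to the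
indicators of an exhausting sequence of balls and pass to the monotone limit. *)
Lemma heat_mass_semigroup s t : 0 < s -> 0 < t ->
  {ae mu, forall x, heat_mass (s + t) x = kernel_op mu (p s) (heat_mass t) x}.
Proof.
move=> s0 t0; have [[x0 _]|X0] := pselect ([set: X] !=set0); last first.
  by apply: aeW => x; exfalso; apply: X0; exists x.
have f2 n : f x0 n \in Lfun mu 2%:E.
  by apply: Lfun2_indic; [exact: measurable_metric_ball|exact: ball_measure_lty].
have ck n := chapman_kolmogorov s0 t0 (f2 n) (f_ge0 x0 n).
apply: filterS (ae_foralln ck) => x H.
have st0 : 0 < s + t by rewrite addr_gt0.
have cL := kernel_op_balls_cvg x0 (x := x) st0.
have [C C0 HC] := heat_mass_upper.
have m0 z : 0 <= heat_mass t z by apply: kernel_op_ge0 _ t0 _ => y.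
have mm : measurable_fun setT (heat_mass t).
  exact: heat_mass_measurable t0.
have k0 n z : 0 <= kernel_op mu (p t) (f x0 n) z.
  exact: kernel_op_ge0 _ t0 (f_ge0 x0 n).
have mk n : measurable_fun setT (kernel_op mu (p t) (f x0 n)).
  exact: kernel_op_measurable t0 (mf x0 n) (f_ge0 x0 n).
have kle m n z : (m <= n)%N ->
    kernel_op mu (p t) (f x0 m) z <= kernel_op mu (p t) (f x0 n) z.
  move=> mn; apply: (kernel_op_le (K := 1) _ t0 (mf x0 m) (mf x0 n)) => y.
    rewrite f_ge0 /f !indicE ler_nat; case: (boolP (y \in (ball x0 m%:R : set X))) => //.
    rewrite inE => ym; rewrite mem_set//; apply: le_ball ym; by rewrite ler_nat.
  by have := f_le1 x0 n y; rewrite ger0_norm.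
have kC n z : `|kernel_op mu (p t) (f x0 n) z| <= C.
  rewrite ger0_norm//; apply: le_trans (HC t z t0).
  apply: (kernel_op_le (K := 1) _ t0 (mf x0 n)) => // y.
  by rewrite f_ge0 /=; have := f_le1 x0 n y; rewrite ger0_norm.
have mC z : `|heat_mass t z| <= C by rewrite ger0_norm// HC.
pose g n z := (p s x z * kernel_op mu (p t) (f x0 n) z)%:E.
have cR : (kernel_op mu (p s) (kernel_op mu (p t) (f x0 n)) x)%:E @[n --> \oo] -->
    (kernel_op mu (p s) (heat_mass t) x)%:E.
  rewrite (kernel_opE _ s0 mm mC).
  rewrite (_ : (fun n => _) = (fun n => \int[mu]_z g n z)%E); last first.
    by apply/funext => n; rewrite (kernel_opE _ s0 (mk n) (kC n)).
  rewrite (_ : (\int[mu]_y _)%E = (\int[mu]_z (limn (g^~ z)))%E); last first.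
    apply: eq_integral => z _; apply/esym/cvg_lim => //.
    rewrite /g EFinM; under eq_fun do rewrite EFinM.
    by apply: cvgeZl => //; exact: kernel_op_balls_cvg.
  apply: cvg_monotone_convergence => //.
  - move=> n; apply/measurable_EFinP; apply: measurable_funM => //; exact: measurable_heat_kernelr.
  - by move=> n z _; rewrite lee_fin mulr_ge0// p_ge0.
  - by move=> z _ m n mn; rewrite lee_fin ler_wpM2l ?p_ge0// kle.
apply/EFin_inj; apply: (cvg_unique _ cL); last first.
  rewrite (_ : (fun n => _) = (fun n => (kernel_op mu (p s) (kernel_op mu (p t) (f x0 n)) x)%:E))//.
  by apply/funext => n; rewrite H.
exact: ereal_hausdorff.
Qed.

End Exhaustion.

Lemma heat_mass_hoelder : exists2 C : R, 0 < C & forall t x y, 0 < t ->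
  `|heat_mass t x - heat_mass t y| <= C * (mdist x y `^ kappa / t `^ (kappa / dW)).
Proof.
have [C C0 H] := BE; exists C => // t x y t0.
have c1 : forall y : X, `|cst 1 y : R| <= 1 by move=> z; rewrite normr1.
have [g1 g2] := Lfunoo_bounded mu (measurable_cst (1 : R)) ler01 c1.
apply: le_trans (H t _ x y t0 g1) _.
by rewrite -[leRHS]mulr1 ler_wpM2l// mulr_ge0 ?mulr_ge0 ?powR_ge0 ?invr_ge0 ?powR_ge0// ltW.
Qed.

(** Let u_t be the total mass of p_t.  By the weak Bakry-Emery estimate u_t becomes
locally constant as t grows, so u_(t+s) = P_s u_t differs from u_s u_t by a
quantity tending to 0.  As u_t stays between two positive constants, the
asymptotic ratio u_s along t = n s must be 1. *)
Lemma conservation s : 0 < s -> {ae mu, forall x, heat_mass s x = 1}.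
Proof.
move=> s0.
have t0 n : 0 < n.+1%:R * s by rewrite mulr_gt0.
apply: filterS (ae_foralln (fun n => heat_mass_semigroup s0 (t0 n))) => x H.
have [c c0 Hc] := heat_mass_lower.
have [C C0 HC] := heat_mass_upper.
have [K K0 HB] := heat_mass_hoelder.
have [M M0 HM] := heat_kernel_moment (ltW kappa_gt0).
have [rho rho0 srho] := time_scale s0.
pose v n := heat_mass (n.+1%:R * s) x.
have a0 : 0 < kappa / dW by rewrite divr_gt0.
pose L := K * rho `^ kappa * s `^ (- (kappa / dW)) * M.
pose e n := L * n.+1%:R `^ (- (kappa / dW)).
apply: (@asymptotic_ratio_eq1 R c C _ v e) => //.
- by move=> n; rewrite Hc ?HC.
- rewrite -[X in _ --> X](mulr0 L); by apply: cvgM; [exact: cvg_cst|exact: powR_natN_cvg0].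
move=> n; set t := n.+1%:R * s.
have tt : 0 < t by exact: t0.
have -> : v n.+1 = kernel_op mu (p s) (heat_mass t) x.
  by rewrite /v -H; congr heat_mass; rewrite /t -[n.+2%:R]natr1; ring.
have mm : measurable_fun setT (heat_mass t).
  exact: heat_mass_measurable tt.
have mC z : `|heat_mass t z| <= C.
  rewrite ger0_norm ?HC//.
  by apply: kernel_op_ge0 _ tt _ => y.
have mc : forall y : X, `|cst (v n) y : R| <= `|v n| by [].
have mcst : measurable_fun setT (cst (v n) : X -> R) by exact: measurable_cst.
have i1 := kernel_op_integrable x s0 mm mC.
have i2 := kernel_op_integrable x s0 mcst mc.
have c1 : forall y : X, `|cst 1 y : R| <= 1 by move=> z; rewrite normr1.
have i3 := kernel_op_integrable x s0 (measurable_cst (1 : R)) c1.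
have -> : heat_mass s x * v n = kernel_op mu (p s) (cst (v n)) x.
  rewrite /heat_mass /kernel_op mulrC -RintegralZl//.
  by apply: eq_Rintegral => y _; rewrite /= mulr1 mulrC.
rewrite /kernel_op -RintegralB//.
have i12 : mu.-integrable setT
    (EFin \o (fun y => p s x y * heat_mass t y - p s x y * cst (v n) y)).
  by apply: (@integrableB _ _ _ _ _ measurableT (EFin \o _) (EFin \o _) i1 i2).
apply: (le_trans (le_normr_Rintegral _ i12)) => //.
rewrite -lee_fin EFin_Rintegral//; last first.
  by have := integrable_abse i12.
pose G y := (K * rho `^ kappa * s `^ (- (kappa / dW)) * n.+1%:R `^ (- (kappa / dW))) *
    (p s x y * Num.max 1 (mdist x y / rho) `^ kappa).
apply: (@le_trans _ _ (\int[mu]_y (G y)%:E)%E).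
  apply: ge0_le_integral_nomeas => y _; first by rewrite lee_fin normr_ge0.
  rewrite lee_fin /G -mulrBr normrM (ger0_norm (p_ge0 _ _ s0)) mulrCA.
  rewrite ler_wpM2l ?p_ge0// distrC.
  apply: le_trans (HB _ _ _ tt) _.
  rewrite /t -powRN powRM ?ler0n ?(ltW s0)// [leRHS](_ : _ = K * ((rho `^ kappa *
     Num.max 1 (mdist x y / rho) `^ kappa) *
     (n.+1%:R `^ (- (kappa / dW)) * s `^ (- (kappa / dW))))); last first.
    move: (rho `^ kappa) (s `^ _) (n.+1%:R `^ _) (Num.max _ _ `^ kappa).
    by move=> A B D M'; ring.
  rewrite ler_wpM2l ?(ltW K0)// ler_wpM2r ?mulr_ge0 ?powR_ge0//.
  rewrite -powRM ?(ltW rho0)//; last by rewrite le_max ler01.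
  apply: ge0_ler_powR; rewrite ?nnegrE ?mdist_ge0 ?(ltW kappa_gt0)//.
    by rewrite mulr_ge0 ?(ltW rho0)// le_max ler01.
  by rewrite mulrC -ler_pdivrMr// le_max lexx orbT.
rewrite ge0_integralZl_real//; last 3 first.
- apply: measurable_funM; first exact: measurable_heat_kernelr.
  apply: (measurableT_comp (measurable_powR kappa)).
  apply: measurable_maxr => //; apply: measurable_funM => //.
  exact: measurable_mdistl.
- by move=> y _; rewrite mulr_ge0 ?powR_ge0// p_ge0.
- by rewrite !mulr_ge0 ?powR_ge0// ltW.
rewrite -srho; apply: le_trans (lee_pmul _ _ (lexx _) (HM rho x rho0)) _.
- by rewrite lee_fin !mulr_ge0 ?powR_ge0// ltW.
- apply: integral_ge0 => y _.
  by rewrite lee_fin mulr_ge0 ?powR_ge0// p_ge0// powR_gt0.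
by rewrite -EFinM lee_fin srho /e /L le_eqVlt; apply/orP; left; apply/eqP; ring.
Qed.

(** ** One step of the semigroup across the boundary of a set *)

Section KernelOpLinear.
Variables (t : R) (x : X).
Hypothesis t0 : 0 < t.
Local Notation k := (kernel_op mu (p t)).

Lemma kernel_opD (f g : X -> R) K L : measurable_fun setT f -> measurable_fun setT g ->
  (forall y, `|f y| <= K) -> (forall y, `|g y| <= L) ->
  k (fun y => f y + g y) x = k f x + k g x.
Proof.
move=> mf mg fK gL; rewrite /kernel_op -RintegralD//.
- by apply: eq_Rintegral => y _; rewrite mulrDr.
- exact: kernel_op_integrable fK.
- exact: kernel_op_integrable gL.
Qed.

Lemma kernel_opZ (c : R) (f : X -> R) K : measurable_fun setT f ->
  (forall y, `|f y| <= K) -> k (fun y => c * f y) x = c * k f x.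
Proof.
move=> mf fK; rewrite /kernel_op -RintegralZl//.
- by apply: eq_Rintegral => y _; rewrite mulrCA.
- exact: kernel_op_integrable fK.
Qed.

Lemma kernel_op_normr (f : X -> R) K : measurable_fun setT f ->
  (forall y, `|f y| <= K) -> (`|k f x|%:E <= \int[mu]_y (p t x y * `|f y|)%:E)%E.
Proof.
move=> mf fK; have i := kernel_op_integrable x t0 mf fK.
apply: le_trans (_ : (\int[mu]_y `|p t x y * f y|)%R%:E <= _)%E.
  by rewrite lee_fin; apply: le_normr_Rintegral.
rewrite EFin_Rintegral//; last by have := integrable_abse i.
rewrite le_eqVlt; apply/orP; left; apply/eqP; apply: eq_integral => y _.
by rewrite normrM ger0_norm ?p_ge0.
Qed.

End KernelOpLinear.

Lemma kernel_op_bounded t (g : X -> R) K : 0 < t -> measurable_fun setT g ->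
  (forall y, 0 <= g y <= K) ->
  exists2 L : R, 0 <= L & forall x, 0 <= kernel_op mu (p t) g x <= L.
Proof.
move=> t0 mg gK; have [C C0 HC] := heat_mass_upper.
have K0 (x : X) : 0 <= K by have /andP[h1 h2] := gK x; exact: le_trans h2.
exists (`|K| * C) => [|x]; first by rewrite mulr_ge0// ltW.
rewrite kernel_op_ge0//=; last by move=> y; have /andP[] := gK y.
have cK : forall y : X, `|cst 1 y : R| <= 1 by move=> y; rewrite normr1.
apply: (@le_trans _ _ (K * heat_mass t x)); last first.
  by rewrite ger0_norm ?(K0 x)// ler_wpM2l ?(K0 x)// HC.
rewrite -(kernel_opZ x t0 K (measurable_cst _) cK).
apply: (kernel_op_le (K := K) _ t0 mg) => [|y|y]; rewrite ?mulr1//.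
exact: measurable_funM.
Qed.

Section OneStep.
Variable A : set X.
Hypotheses (mA : measurable A) (Ay : (mu A < +oo)%E).
Local Notation e := (\1_A : X -> R).

Let e01 y : e y = 0 \/ e y = 1.
Proof. by rewrite indicE; case: (y \in A); [right|left]. Qed.
Let e_ge0 y : 0 <= e y. Proof. by case: (e01 y) => ->. Qed.
Let e_le1 y : e y <= 1. Proof. by case: (e01 y) => ->. Qed.
Let me : measurable_fun setT e. Proof. exact: measurable_indic. Qed.

Lemma finite_support_integrable (f : X -> R) K : measurable_fun setT f ->
  (forall x, `|f x| <= K * e x) -> mu.-integrable setT (EFin \o f).
Proof.
move=> mf fK.
apply: (@integrable_dominated _ _ _ _ _ _ (fun x => `|K| * e x)) => //.
  by move=> x _; apply: le_trans (fK x) _; rewrite ler_wpM2r// ler_norm.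
by rewrite ge0_integralZl_real// integral_indic// setIT lte_mul_pinfty// lee_fin.
Qed.

Lemma finite_support_Lfun2 (f : X -> R) K : measurable_fun setT f ->
  (forall x, `|f x| <= K * e x) -> f \in Lfun mu 2%:E.
Proof.
move=> mf fK; apply/Lfun2P; split => //.
apply: (@le_lt_trans _ _ (\int[mu]_x (K ^+ 2 * e x)%:E)%E).
  apply: ge0_le_integral_nomeas => x _; first by rewrite lee_fin sqr_ge0.
  rewrite lee_fin -(real_normK (num_real (f x))).
  have -> : K ^+ 2 * e x = (K * e x) ^+ 2.
    by rewrite exprMn; congr (_ * _); case: (e01 x) => ->; rewrite ?expr0n ?expr1n.
  by rewrite ler_pXn2r ?nnegrE// (le_trans _ (fK x)).
by rewrite ge0_integralZl_real ?sqr_ge0// integral_indic// setIT lte_mul_pinfty// lee_fin sqr_ge0.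
Qed.

(** Symmetry of the semigroup on L^2, transferred to the kernel operators. *)
Lemma kernel_op_symmetric t (f g : X -> R) : 0 < t ->
  f \in Lfun mu 2%:E -> g \in Lfun mu 2%:E ->
  (forall y, 0 <= f y) -> (forall y, 0 <= g y) ->
  L2dot mu (kernel_op mu (p t) f) g = L2dot mu f (kernel_op mu (p t) g).
Proof.
move=> t0 f2 g2 f0 g0.
have [_ H] := HKc t0.
have mf := Lfun_measurable f2; have mg := Lfun_measurable g2.
have mPf := Lfun_measurable (heat_L2 P_heat t0 f2).
have mPg := Lfun_measurable (heat_L2 P_heat t0 g2).
have mkf := kernel_op_measurable t0 mf f0.
have mkg := kernel_op_measurable t0 mg g0.
have := heat_sym P_heat t0 f2 g2.
rewrite /L2dot /Rintegral.
rewrite (@ae_eq_integral _ _ _ mu setT (fun x => (kernel_op mu (p t) f x * g x)%:E)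
  (fun x => (P t f x * g x)%:E))//; last 3 first.
- by apply/measurable_EFinP; apply: measurable_funM.
- by apply/measurable_EFinP; apply: measurable_funM.
- by apply: filterS (H _ f2) => x h _; rewrite h.
rewrite (@ae_eq_integral _ _ _ mu setT (fun x => (f x * kernel_op mu (p t) g x)%:E)
  (fun x => (f x * P t g x)%:E))//.
- by apply/measurable_EFinP; apply: measurable_funM.
- by apply/measurable_EFinP; apply: measurable_funM.
- by apply: filterS (H _ g2) => x h _; rewrite h.
Qed.

(** As the heat flow is conservative, h x - P_t h x is the integral of
p_t(x, y) (h x - h y).  Over x, y in A this integrates to
<P_t 1_A, 1_A h> - <1_A, P_t (1_A h)> = 0 by symmetry, so only the pairs with
x in A and y outside A contribute. *)
Lemma heat_step_across_boundary t (h : X -> R) K (G : X -> X -> R) : 0 < t ->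
  measurable_fun setT h -> (forall y, 0 <= h y <= K) ->
  (forall x y, A x -> ~ A y -> p t x y * `|h x - h y| <= G x y) ->
  ((\int[mu]_x (e x * h x) - \int[mu]_x (e x * kernel_op mu (p t) h x))%R%:E
    <= \int[mu]_x \int[mu]_y (e x * (1 - e y) * G x y)%:E)%E.
Proof.
move=> t0 mh hK HG.
pose k := kernel_op mu (p t).
have h0 y : 0 <= h y by have /andP[] := hK y.
have hle y : h y <= K by have /andP[] := hK y.
have hn y : `|h y| <= K by rewrite ger0_norm.
pose ec y : R := 1 - e y.
have ec0 y : 0 <= ec y by rewrite subr_ge0.
have ec1 y : ec y <= 1 by rewrite /ec gerBl.
have mec : measurable_fun setT ec by apply: measurable_funB.
pose eh y := e y * h y.
pose ch y := ec y * h y.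
have meh : measurable_fun setT eh by apply: measurable_funM.
have mch : measurable_fun setT ch by apply: measurable_funM.
have eh0 y : 0 <= eh y by rewrite mulr_ge0.
have ch0 y : 0 <= ch y by rewrite mulr_ge0.
have ehK y : eh y <= K by apply: le_trans (hle y); rewrite ler_piMl.
have chK y : ch y <= K by apply: le_trans (hle y); rewrite ler_piMl.
have en y : `|e y| <= 1 by rewrite ger0_norm.
have ecn y : `|ec y| <= 1 by rewrite ger0_norm.
have ehn y : `|eh y| <= K by rewrite ger0_norm.
have chn y : `|ch y| <= K by rewrite ger0_norm.
have bnd (g : X -> R) L : measurable_fun setT g -> (forall y, 0 <= g y) -> (forall y, g y <= L) ->
    [/\ measurable_fun setT (k g), (forall x, 0 <= k g x) &
        exists2 M : R, 0 <= M & forall x, k g x <= M].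
  move=> mg g0 gL; split; first exact: kernel_op_measurable.
  - by move=> x; exact: kernel_op_ge0.
  - have gb y : 0 <= g y <= L by rewrite g0 gL.
    have [M M0 HM] := kernel_op_bounded t0 mg gb.
    by exists M => // x; have /andP[] := HM x.
have [mke ke0 [Me Me0 keM]] := bnd _ _ me e_ge0 e_le1.
have [mkec kec0 [Mec Mec0 kecM]] := bnd _ _ mec ec0 ec1.
have [mkeh keh0 [Meh Meh0 kehM]] := bnd _ _ meh eh0 ehK.
have [mkch kch0 [Mch Mch0 kchM]] := bnd _ _ mch ch0 chK.
have [mkh kh0 [Mh Mh0 khM]] := bnd _ _ mh h0 hle.
(* On A, Q x is the integral of p_t(x, y) (h x - h y) over y outside A. *)
pose Q x := e x * (h x * k ec x - k ch x).
have mQ : measurable_fun setT Q.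
  by apply: measurable_funM => //; apply: measurable_funB => //; apply: measurable_funM.
have int (f : X -> R) L : measurable_fun setT f -> (forall x, 0 <= f x) ->
   (forall x, f x <= L) -> mu.-integrable setT (EFin \o (fun x => e x * f x)).
  move=> mf f0 fL; apply: (@finite_support_integrable _ L).
    exact: measurable_funM.
  by move=> x; rewrite ger0_norm ?mulr_ge0// mulrC ler_wpM2r.
have i1 := int _ _ mh h0 hle.
have i2 := int _ _ mkh kh0 khM.
have i3 : mu.-integrable setT (EFin \o (fun x => k e x * eh x)).
  rewrite (_ : (fun x => _) = (fun x => e x * (k e x * h x))); last first.
    by apply/funext => x; rewrite mulrCA.
  apply: (@int _ (Me * K)) => [|x|x]; first exact: measurable_funM.
    by rewrite mulr_ge0.
  by rewrite ler_pM.
have i4 := int _ _ mkeh keh0 kehM.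
have i5 : mu.-integrable setT (EFin \o Q).
  apply: (@finite_support_integrable _ (K * Mec + Mch)) => // x.
  rewrite normrM (ger0_norm (e_ge0 x)) mulrC ler_wpM2r//.
  apply: le_trans (ler_normB _ _) _; rewrite lerD//.
    by rewrite normrM !ger0_norm// ler_pM.
  by rewrite ger0_norm.
have -> : \int[mu]_x (e x * h x) - \int[mu]_x (e x * kernel_op mu (p t) h x) =
    \int[mu]_x Q x.
  have S : \int[mu]_x (k e x * eh x) = \int[mu]_x (e x * k eh x).
    apply: kernel_op_symmetric => //; first exact: Lfun2_indic.
    apply: (@finite_support_Lfun2 _ K) => // x.
    by rewrite ger0_norm// /eh mulrC ler_wpM2r.
  rewrite -RintegralB//.
  have -> : \int[mu]_x Q x =
      \int[mu]_x ((k e x * eh x - e x * k eh x) + Q x).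
    rewrite RintegralD//; last exact: (@integrableB _ _ _ _ _ measurableT (EFin \o _) (EFin \o _) i3 i4).
    by rewrite RintegralB// S subrr add0r.
  rewrite /Rintegral; congr fine; apply: ae_eq_integral => //.
  - apply/measurable_EFinP; apply: measurable_funB; apply: measurable_funM => //.
  - apply/measurable_EFinP; apply: measurable_funD => //.
    by apply: measurable_funB; apply: measurable_funM.
  apply: filterS (conservation t0) => x m1 _; congr EFin.
  have m1E : k e x + k ec x = 1.
    rewrite -m1 /heat_mass -(kernel_opD x t0 me mec en ecn).
    by congr kernel_op; apply/funext => y; rewrite addrC subrK.
  have khE : k h x = k eh x + k ch x.
    rewrite -(kernel_opD x t0 meh mch ehn chn).
    by congr kernel_op; apply/funext => y; rewrite -mulrDl addrC subrK mul1r.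
  rewrite -/k /Q /eh khE; have -> : k ec x = 1 - k e x by rewrite -m1E addrC addKr.
  ring.
apply: (@le_trans _ _ (\int[mu]_x `|Q x|%:E)%E).
  apply: le_trans (_ : `|\int[mu]_x Q x|%R%:E <= _)%E; first by rewrite lee_fin ler_norm.
  apply: le_trans (_ : (\int[mu]_x `|Q x|)%R%:E <= _)%E.
    by rewrite lee_fin; exact: le_normr_Rintegral.
  by rewrite EFin_Rintegral//; have := integrable_abse i5.
apply: ge0_le_integral_nomeas => x _; first by rewrite lee_fin.
have gx y : `|ec y * (h x - h y)| <= K + K.
  rewrite normrM -[leRHS]mul1r ler_pM//.
  by apply: le_trans (ler_normB _ _) _; rewrite lerD.
have mgx : measurable_fun setT (fun y => ec y * (h x - h y)).
  by apply: measurable_funM => //; apply: measurable_funB.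
have QE : h x * k ec x - k ch x = k (fun y => ec y * (h x - h y)) x.
  rewrite -(kernel_opZ x t0 (h x) mec ecn).
  rewrite -[X in _ - X]mul1r -mulNr -(kernel_opZ x t0 (- 1) mch chn).
  rewrite -(@kernel_opD _ _ t0 _ _ (K * 1) K).
  - by congr kernel_op; apply/funext => y; rewrite /ch; ring.
  - exact: measurable_funM.
  - exact: measurable_funM.
  - by move=> y; rewrite normrM ler_pM.
  - by move=> y; rewrite normrM normrN1 mul1r.
rewrite /Q QE normrM (ger0_norm (e_ge0 x)).
case: (e01 x) => ex; rewrite ex ?mul0r ?mul1r.
  by apply: integral_ge0 => y _; rewrite !mul0r.
apply: le_trans (kernel_op_normr x t0 mgx gx) _.
apply: ge0_le_integral_nomeas => y _; first by rewrite lee_fin mulr_ge0// p_ge0.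
rewrite lee_fin mul1r normrM (ger0_norm (ec0 y)) mulrCA -/(ec y).
case: (e01 y) => ey; last by rewrite /ec ey subrr !mul0r.
rewrite /ec ey subr0 !mul1r; apply: HG.
- by move: ex; rewrite indicE; case: (boolP (x \in A)) => [/[!inE]//|_ /eqP]; rewrite eq_sym oner_eq0.
- by move: ey; rewrite indicE; case: (boolP (y \in A)) => [_ /eqP|/negP]; rewrite ?oner_eq0 ?inE.
Qed.

End OneStep.

Section JumpTelescope.
Variable A : set X.
Hypotheses (mA : measurable A) (Ay : (mu A < +oo)%E).
Local Notation e := (\1_A : X -> R).

Let e01 y : e y = 0 \/ e y = 1.
Proof. by rewrite indicE; case: (y \in A); [right|left]. Qed.
Let e_ge0 y : 0 <= e y. Proof. by case: (e01 y) => ->. Qed.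
Let e_le1 y : e y <= 1. Proof. by case: (e01 y) => ->. Qed.
Let e_norm y : `|e y| <= 1. Proof. by rewrite ger0_norm. Qed.
Let ec_ge0 y : 0 <= 1 - e y. Proof. by rewrite subr_ge0. Qed.
Let me : measurable_fun setT e. Proof. exact: measurable_indic. Qed.

(** By conservativeness the mass that leaves A from x is 1 - P_t 1_A x. *)
Lemma jump_heat_kernel t : 0 < t ->
  (jump mu A (p t) = (\int[mu]_x (e x * e x) -
     \int[mu]_x (e x * kernel_op mu (p t) e x))%R%:E)%E.
Proof.
move=> t0.
have mk : measurable_fun setT (kernel_op mu (p t) e) by exact: kernel_op_measurable.
have e1 y : 0 <= e y <= 1 by rewrite e_ge0 e_le1.
have [M M0 HM] := kernel_op_bounded t0 me e1.
have i1 : mu.-integrable setT (EFin \o (fun x => e x * e x)).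
  apply: (finite_support_integrable mA Ay (K := 1)); first exact: measurable_funM.
  by move=> x; rewrite mul1r ger0_norm ?mulr_ge0// ler_piMl.
have i2 : mu.-integrable setT (EFin \o (fun x => e x * kernel_op mu (p t) e x)).
  apply: (finite_support_integrable mA Ay (K := M)); first exact: measurable_funM.
  move=> x; have /andP[h1 h2] := HM x.
  by rewrite ger0_norm ?mulr_ge0// mulrC ler_wpM2r.
rewrite (jump_iterated _ mA); last 2 first.
- exact: measurable_heat_kernel.
- by move=> x y; exact: p_ge0.
rewrite -RintegralB// EFin_Rintegral//; last first.
  exact: (@integrableB _ _ _ _ _ measurableT (EFin \o _) (EFin \o _) i1 i2).
have mec : measurable_fun setT (fun y => 1 - e y) by apply: measurable_funB.
have ecn y : `|1 - e y| <= 1 by rewrite ger0_norm// gerBl.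
have inner x : (\int[mu]_y (e x * (1 - e y) * p t x y)%:E =
    (e x * kernel_op mu (p t) (fun y => (1 - e y)%R) x)%:E)%E.
  rewrite EFinM (kernel_opE _ t0 mec ecn) -ge0_integralZl_real//.
  - by apply: eq_integral => y _; rewrite -mulrA (mulrC (p t x y)).
  - by apply: measurable_funM => //; exact: measurable_heat_kernelr.
  - by move=> y _; rewrite mulr_ge0// p_ge0.
transitivity (\int[mu]_x (e x * kernel_op mu (p t) (fun y => (1 - e y)%R) x)%:E)%E.
  by apply: eq_integral => x _; exact: inner.
apply: ae_eq_integral => //.
- apply/measurable_EFinP; apply: measurable_funM => //; exact: kernel_op_measurable.
- by apply/measurable_EFinP; apply: measurable_funB; apply: measurable_funM.
apply: filterS (conservation t0) => x m1 _; congr EFin.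
have : kernel_op mu (p t) e x + kernel_op mu (p t) (fun y => 1 - e y) x = 1.
  rewrite -[RHS]m1 /heat_mass.
  rewrite -(kernel_opD x t0 me mec e_norm ecn).
  by congr kernel_op; apply/funext => y; rewrite addrC subrK.
move=> /(canRL (addKr _)) ->.
by case: (e01 x) => ->; rewrite ?mul0r ?subrr// !mul1r addrC.
Qed.

(** Sum over j the estimate of one step of length tau, applied to 1_A for j = 0 and
to P_(j tau) 1_A for j > 0. *)
Lemma jump_telescope tau n (c : nat -> R) (D : X -> X -> R) : 0 < tau ->
  measurable_fun setT (fun z : X * X => D z.1 z.2) -> (forall x y, 0 <= D x y) ->
  (forall j, 0 <= c j) ->
  (forall x y, p tau x y <= c 0 * D x y) ->
  (forall j x y, p tau x y * `|kernel_op mu (p (j.+1%:R * tau)) e x -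
     kernel_op mu (p (j.+1%:R * tau)) e y| <= c j.+1 * D x y) ->
  (jump mu A (p (n.+1%:R * tau)) <= (\sum_(j < n.+1) c j)%:E * jump mu A D)%E.
Proof.
move=> tau0 mD D0 c0 H0 HS.
have tj j : 0 < j.+1%:R * tau by rewrite mulr_gt0.
pose h j : X -> R := if j is j'.+1 then kernel_op mu (p (j'.+1%:R * tau)) e else e.
pose I j := \int[mu]_x (e x * h j x).
have mh j : measurable_fun setT (h j).
  by case: j => [|j] //=; exact: kernel_op_measurable.
have hb j : exists K : R, forall y, 0 <= h j y <= K.
  case: j => [|j]; first by exists 1 => y; rewrite /= e_ge0 e_le1.
  have e1 y : 0 <= e y <= 1 by rewrite e_ge0 e_le1.
  by have [M _ HM] := kernel_op_bounded (tj j) me e1; exists M.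
have next j : \int[mu]_x (e x * kernel_op mu (p tau) (h j) x) = I j.+1.
  rewrite /I; case: j => [|j]; first by rewrite /= mul1r.
  rewrite /Rintegral; congr fine; apply: ae_eq_integral => //.
  - apply/measurable_EFinP; apply: measurable_funM => //.
    apply: kernel_op_measurable => // y; by have [K HK'] := hb j.+1; have /andP[] := HK' y.
  - by apply/measurable_EFinP; apply: measurable_funM.
  have e2 : e \in Lfun mu 2%:E by exact: Lfun2_indic.
  have := chapman_kolmogorov tau0 (tj j) e2 e_ge0.
  apply: filterS => x hx _; congr EFin; congr (_ * _).
  rewrite /= -hx//; congr kernel_op; congr p.
  by rewrite -[j.+2%:R]natr1; ring.
have step j : ((I j - I j.+1)%:E <= (c j)%:E * jump mu A D)%E.
  have [K hK] := hb j.
  rewrite -next.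
  rewrite -(jumpZ _ mA)// (jump_iterated _ mA); last 2 first.
  - by apply: measurable_funM.
  - by move=> x y; rewrite mulr_ge0.
  apply: (heat_step_across_boundary mA Ay tau0 (mh j) hK) => x y Ax nAy.
  case: j hK => [|j] _ /=; last exact: HS.
  rewrite !indicE mem_set// memNset// subr0 normr1 mulr1.
  exact: H0.
have -> : jump mu A (p (n.+1%:R * tau)) = (I 0%N - I n.+1)%:E by rewrite jump_heat_kernel.
have jD0 : (0 <= jump mu A D)%E by exact: jump_ge0.
elim: n.+1 => [|m IH].
  by rewrite subrr big_ord0 mul0e.
rewrite big_ord_recr/= [in leRHS]EFinD ge0_muleDl ?lee_fin ?sumr_ge0//.
have -> : I 0%N - I m.+1 = (I 0%N - I m) + (I m - I m.+1) by ring.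
by rewrite EFinD; apply: leeD.
Qed.

End JumpTelescope.

(** With tau = rho^dW, the weak Bakry-Emery estimate provides the coefficients
rho^-dH j^(-kappa / dW) in the telescoped sum, hence a factor
N^(1 - kappa / dW) for N steps; the factor d^kappa that comes with it is absorbed
by the tail of p_tau.  On d(x, y) < r the left-hand side is controlled by
p_(N tau), which is at least of order (N tau)^(-dH / dW) there. *)
Lemma jump_near_diag_le_decay b : exists2 C : R, 0 < C & forall rho n r (A : set X),
  0 < rho -> 0 < r -> r `^ dW <= n.+1%:R * rho `^ dW ->
  measurable A -> (mu A < +oo)%E ->
  (jump mu A (fun x y => (mdist x y < r)%R%:R) <=
   (C * n.+1%:R `^ ((dW - kappa + dH) / dW))%:E *
     jump mu A (fun x y => decay b (mdist x y / rho)))%E.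
Proof.
have [c c0 Hc] := heat_kernel_lower.
have [C1 C10 HC1] := heat_kernel_upper b.
have [C2 C20 HC2] := heat_kernel_upper (b + kappa).
have [K K0 HK'] := BE.
pose s := kappa / dW.
have s0 : 0 < s by rewrite divr_gt0.
have s1 : s < 1 by rewrite /s ltr_pdivrMr// mul1r.
have s1' : 0 < 1 - s by rewrite subr_gt0.
pose M := C1 + C2 * K * (1 - s)^-1.
have M0 : 0 < M by rewrite addr_gt0// !mulr_gt0// invr_gt0.
exists (M / c) => [|rho n r A rho0 r0 rn mA Ay]; first by rewrite divr_gt0.
have tau0 : 0 < rho `^ dW by rewrite powR_gt0.
pose D (x y : X) := decay b (mdist x y / rho) : R.
have D0 x y : 0 <= D x y by exact: decay_ge0.
have mD : measurable_fun setT (fun z : X * X => D z.1 z.2).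
  by apply: measurable_decay; exact: measurable_mdist.
pose q := rho `^ (- dH).
have q0 : 0 < q by rewrite powR_gt0.
pose cc j : R := if j is j'.+1 then C2 * K * q * j'.+1%:R `^ (- s) else C1 * q.
have cc0 j : 0 <= cc j.
  by case: j => [|j] /=; rewrite !mulr_ge0 ?powR_ge0// ltW.
have e1 (y : X) : `|\1_A y : R| <= 1 by rewrite indicE normr_nat lern1 leq_b1.
have [goo gle] := Lfunoo_bounded mu (measurable_indic mA) ler01 e1.
have T := @jump_telescope A mA Ay (rho `^ dW) n cc D tau0 mD D0 cc0.
have {}T : (jump mu A (p (n.+1%:R * rho `^ dW)) <= (\sum_(j < n.+1) cc j)%:E * jump mu A D)%E.
  apply: T => [x y|j x y]; first by rewrite /= HC1.
  have tj : 0 < j.+1%:R * rho `^ dW by rewrite mulr_gt0.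
  have hB : `|kernel_op mu (p (j.+1%:R * rho `^ dW)) \1_A x -
      kernel_op mu (p (j.+1%:R * rho `^ dW)) \1_A y| <=
      K * (Num.max 1 (mdist x y / rho) `^ kappa * j.+1%:R `^ (- s)).
    apply: le_trans (HK' _ _ x y tj goo) _.
    apply: (@le_trans _ _ (K * (mdist x y `^ kappa / (j.+1%:R * rho `^ dW) `^ s))).
      by rewrite -[leRHS]mulr1 ler_wpM2l// mulr_ge0 ?mulr_ge0 ?powR_ge0 ?invr_ge0 ?powR_ge0// ltW.
    rewrite ler_wpM2l ?(ltW K0)// powRM ?ler0n ?powR_ge0//.
    have -> : (rho `^ dW) `^ s = rho `^ kappa.
      by rewrite -powRrM /s mulrC divfK// gt_eqF.
    rewrite invfM mulrCA -powRN mulrC ler_wpM2r ?powR_ge0//.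
    rewrite powR_divl ?mdist_ge0//.
    apply: ge0_ler_powR; rewrite ?nnegrE ?(ltW kappa_gt0)// ?divr_ge0 ?mdist_ge0 ?(ltW rho0)//.
      by rewrite le_max ler01.
    by rewrite le_max lexx orbT.
  apply: le_trans (ler_pM _ _ (HC2 _ x y rho0) hB) _; rewrite ?p_ge0//.
  rewrite decayD /=; set u := mdist x y / rho.
  have m0 : Num.max 1 u != 0 by rewrite gt_eqF// lt_max ltr01.
  have e : decay kappa u * Num.max 1 u `^ kappa = 1.
    by rewrite /decay -powRD ?m0 ?implybT// addNr powRr0.
  rewrite /D -/u /q; move: (decay kappa u) (Num.max 1 u `^ kappa) e => a1 a2 e.
  rewrite [leLHS](_ : _ = C2 * K * rho `^ (- dH) * j.+1%:R `^ (- s) * decay b u * (a1 * a2)).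
    by rewrite e mulr1.
  by move: (rho `^ _) (j.+1%:R `^ _) => *; ring.
have Ssum : \sum_(j < n.+1) cc j <= q * (M * n.+1%:R `^ (1 - s)).
  rewrite big_ord_recl /=.
  have -> : \sum_(i < n) cc (bump 0 i) = C2 * K * q * \sum_(1 <= j < n.+1) j%:R `^ (- s).
    by rewrite big_add1 big_mkord mulr_sumr.
  have S1 : \sum_(1 <= j < n.+1) (j%:R : R) `^ (- s) <= (1 - s)^-1 * n.+1%:R `^ (1 - s).
    apply: le_trans (sum_powRN_le n s0 s1) _.
    rewrite ler_wpM2l ?invr_ge0 ?(ltW s1')//.
    by apply: ge0_ler_powR; rewrite ?nnegrE ?ler_nat// ltW.
  have S2 : 1 <= n.+1%:R `^ (1 - s) :> R.
    rewrite -[leLHS](powRr0 n.+1%:R); apply: ler_powR; last exact: ltW.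
    by rewrite ler1n.
  have k0 : 0 <= C2 * K * q by rewrite !mulr_ge0 ?powR_ge0// ltW.
  apply: (@le_trans _ _ (C1 * q * n.+1%:R `^ (1 - s) +
     C2 * K * q * ((1 - s)^-1 * n.+1%:R `^ (1 - s)))).
    apply: lerD; last exact: ler_wpM2l.
    by rewrite ler_peMr// mulr_ge0 ?powR_ge0// ltW.
  by rewrite /M; move: (n.+1%:R `^ _) (1 - s)^-1 => *; lra.
pose rho' := n.+1%:R `^ dW^-1 * rho.
have n0 : 0 < n.+1%:R `^ dW^-1 :> R by rewrite powR_gt0.
have rho'0 : 0 < rho' by rewrite mulr_gt0.
have rho'E : rho' `^ dW = n.+1%:R * rho `^ dW.
  rewrite /rho' powRM ?(ltW n0) ?(ltW rho0)// -powRrM mulVf ?gt_eqF// powRr1//.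
have rr' : r <= rho'.
  rewrite leNgt; apply/negP => h.
  have := @gt0_ltr_powR R dW dW0 rho' r; rewrite !nnegrE (ltW r0) (ltW rho'0) rho'E.
  by move=> /(_ isT isT h); rewrite ltNge rn.
pose i (x y : X) : R := (mdist x y < r)%R%:R.
have mi : measurable_fun setT (fun z : X * X => i z.1 z.2).
  by apply: measurable_lt_natr; exact: measurable_mdist.
have i0 x y : 0 <= i x y by [].
have q'0 : 0 < rho' `^ (- dH) by rewrite powR_gt0.
have L : ((c * rho' `^ (- dH))%:E * jump mu A i <= jump mu A (p (n.+1%:R * rho `^ dW)))%E.
  rewrite -(jumpZ _ mA)//; last by rewrite mulr_ge0// ltW.
  apply: jump_le => x y; first by rewrite !mulr_ge0// ltW.
  rewrite /i -rho'E; case: ltP => [xy|_]; last by rewrite mulr0 p_ge0// powR_gt0.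
  by rewrite mulr1 Hc//; exact: lt_le_trans rr'.
have jD0 : (0 <= jump mu A D)%E by exact: jump_ge0.
have {T} := le_trans L (le_trans T (lee_wpmul2r jD0 _)).
move=> /(_ (q * (M * n.+1%:R `^ (1 - s)))%:E); rewrite lee_fin => /(_ Ssum) T.
have cq0 : 0 < c * rho' `^ (- dH) by rewrite mulr_gt0.
rewrite -/i -/D.
have -> : (M / c * n.+1%:R `^ ((dW - kappa + dH) / dW))%:E =
    ((c * rho' `^ (- dH))^-1%:E * (q * (M * n.+1%:R `^ (1 - s)))%:E)%E.
  rewrite -EFinM; congr EFin.
  have -> : rho' `^ (- dH) = (n.+1%:R `^ (dH / dW))^-1 * q.
    rewrite /rho' powRM ?(ltW n0) ?(ltW rho0)// -powRrM.
    by rewrite -powRN mulrN (mulrC dW^-1).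
  have -> : (dW - kappa + dH) / dW = 1 - s + dH / dW.
    by rewrite /s; field; rewrite gt_eqF.
  rewrite powRD; last by apply/implyP => _; rewrite pnatr_eq0.
  have : 0 < n.+1%:R `^ (dH / dW) :> R by rewrite powR_gt0.
  move: (n.+1%:R `^ (dH / dW)) (n.+1%:R `^ (1 - s)) => u v u0.
  by field; rewrite !gt_eqF.
by rewrite -muleA lee_pdivlMl.
Qed.

(** ** Weak monotonicity of the Korevaar-Schoen energies *)

Section WeakMonotonicity.

Let a := dW - kappa + dH.
Let a_gt0 : 0 < a. Proof. by rewrite addr_gt0// subr_gt0. Qed.

(** Take rho = r' / Lam and about (r / rho)^dW steps of length rho^dW.  A decay of
order a + 2 in d / rho is at most near_diag r' plus Lam^-1 times a decay of
order a + 1, and the latter is integrated with the bound M over all scales. *)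
Lemma osc_comparison_of_scales : exists2 C : R, 0 < C & forall f M Lam r r',
  f \in Lfun mu 1 -> 0 <= M ->
  (forall s, 0 < s -> (osc mu f (near_diag s) <= (M * s `^ a)%:E)%E) ->
  1 <= Lam -> 0 < r' -> r' <= r ->
  (osc mu f (near_diag r) <= (C * r `^ a)%:E *
     (((Lam / r') `^ a)%:E * osc mu f (near_diag r') + (Lam^-1 * M)%:E))%E.
Proof.
have [C0 C00 HC] := jump_near_diag_le_decay (a + 1 + 1).
pose T : R := 2 `^ (a / dW) * 2 `^ (a + 1).
have t1 : 0 < 2 `^ (a / dW) :> R by rewrite powR_gt0.
have t2 : 1 <= 2 `^ (a + 1) :> R.
  rewrite -[leLHS](powRr0 2); apply: ler_powR; first by rewrite ler1n.
  by rewrite addr_ge0// ltW.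
have T0 : 0 < T by rewrite mulr_gt0// (lt_le_trans ltr01).
exists (C0 * T) => [|f M Lam r r' f1 M0 HM Lam1 r'0 r'r]; first by rewrite mulr_gt0.
have mf := Lfun_measurable f1.
have r0 : 0 < r by exact: lt_le_trans r'r.
have Lam0 : 0 < Lam by exact: lt_le_trans Lam1.
pose rho := r' / Lam.
have rho0 : 0 < rho by rewrite divr_gt0.
have rhor : rho <= r by rewrite (le_trans _ r'r)// ler_pdivrMr// ler_peMr// ltW.
pose q := r `^ dW / rho `^ dW.
have rW0 : 0 < rho `^ dW by rewrite powR_gt0.
have q1 : 1 <= q.
  rewrite ler_pdivlMr// mul1r; apply: ge0_ler_powR; rewrite ?nnegrE//.
  - exact: ltW.
  - exact: ltW.
  - exact: ltW.
(* n + 1 steps of length rho^dW reach time r^dW, and n + 1 <= 2 q as q >= 1. *)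
pose n := Num.truncn q.
have /andP[nq qn] : n%:R <= q < n.+1%:R by apply: truncn_itv; rewrite (le_trans _ q1).
have rn : r `^ dW <= n.+1%:R * rho `^ dW.
  by rewrite -ler_pdivrMr//; exact: ltW.
have n2 : n.+1%:R <= 2 * q.
  by rewrite -natr1; lra.
have nE : n.+1%:R `^ (a / dW) <= 2 `^ (a / dW) * (r / rho) `^ a.
  have -> : (r / rho) `^ a = q `^ (a / dW).
    rewrite /q powR_divl ?(ltW r0)// -powRrM; congr (_ `^ _).
    by rewrite mulrCA mulfV ?mulr1// gt_eqF.
  rewrite -powRM ?(le_trans _ q1)//.
  apply: ge0_ler_powR; rewrite ?nnegrE//.
  - by rewrite divr_ge0// ltW.
  - by rewrite mulr_ge0// (le_trans _ q1).
pose D (x y : X) := decay (a + 1 + 1) (mdist x y / rho).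
pose D1 (x y : X) := decay (a + 1) (mdist x y / rho).
have mdec b : measurable_fun setT (fun z : X * X => decay b (mdist z.1 z.2 / rho)).
  by apply: measurable_decay; exact: measurable_mdist.
have N0 : 0 <= C0 * n.+1%:R `^ (a / dW) by rewrite mulr_ge0 ?powR_ge0// ltW.
have S1 : (osc mu f (near_diag r) <= (C0 * n.+1%:R `^ (a / dW))%:E * osc mu f D)%E.
  apply: osc_le_of_jumps => //.
  - exact: measurable_near_diag.
  - exact: mdec.
  - by move=> x y; exact: decay_ge0.
  - by move=> x y; exact: near_diagC.
  - by move=> x y; rewrite /D metric_sym.
  - by move=> A mA Ay; exact: (HC _ _ _ _ rho0 r0 rn mA Ay).
have S2 : (osc mu f D <= osc mu f (near_diag r') + (Lam^-1)%:E * osc mu f D1)%E.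
  rewrite -oscZ//; last 3 first.
  - exact: mdec.
  - by move=> x y; exact: decay_ge0.
  - by rewrite invr_ge0 ltW.
  rewrite -oscD//; last 3 first.
  - exact: measurable_near_diag.
  - by apply: measurable_funM => //; exact: mdec.
  - by move=> x y; rewrite mulr_ge0 ?decay_ge0// invr_ge0 ltW.
  apply: osc_le => x y; first exact: decay_ge0.
  rewrite /near_diag; case: ltP => xy.
    apply: (@le_trans _ _ 1); last first.
      by rewrite lerDl mulr_ge0 ?decay_ge0// invr_ge0 ltW.
    apply: decay_le1; apply: addr_ge0 => //; apply: addr_ge0 => //; exact: ltW.
  rewrite add0r /D decayD mulrC ler_wpM2r ?decay_ge0//.
  have uL : Lam <= mdist x y / rho.
    by rewrite ler_pdivlMr// /rho mulrC divfK// gt_eqF.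
  have u1 : 1 <= mdist x y / rho by exact: le_trans uL.
  rewrite /decay (max_idPr u1) powR_inv1; last exact: le_trans u1.
  by rewrite lef_pV2 ?posrE// (lt_le_trans _ u1).
have S3 : (osc mu f D1 <= (2 `^ (a + 1) * M * rho `^ a)%:E)%E.
  have md : measurable_fun setT (fun z : X * X => mdist z.1 z.2) by exact: measurable_mdist.
  have mg : measurable_fun setT (fun z : X * X => `|f z.1 - f z.2|).
    apply: measurableT_comp => //; apply: measurable_funB.
      exact: measurableT_comp mf measurable_fst.
    exact: measurableT_comp mf measurable_snd.
  by apply: (integral_decay_le mg _ md (ltW a_gt0) M0 _ rho0) => [z|s s0] //; exact: HM.
have o0 s : (0 <= osc mu f (near_diag s))%E by exact: osc_ge0.
apply: (le_trans S1).
apply: (@le_trans _ _ ((C0 * n.+1%:R `^ (a / dW))%:E *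
    (osc mu f (near_diag r') + (Lam^-1 * (2 `^ (a + 1) * M * rho `^ a))%:E))%E).
  apply: lee_wpmul2l; first by rewrite lee_fin.
  apply: (le_trans S2); apply: leeD => //.
  by rewrite [leRHS]EFinM lee_wpmul2l// lee_fin invr_ge0 ltW.
have K0 : 0 <= Lam^-1 * (2 `^ (a + 1) * M * rho `^ a).
  by rewrite mulr_ge0 ?invr_ge0 ?(ltW Lam0)// !mulr_ge0 ?powR_ge0.
apply: (@le_trans _ _ ((C0 * (2 `^ (a / dW) * (r / rho) `^ a))%:E *
    (osc mu f (near_diag r') + (Lam^-1 * (2 `^ (a + 1) * M * rho `^ a))%:E))%E).
  apply: lee_wpmul2r; first by rewrite adde_ge0// lee_fin.
  by rewrite lee_fin ler_wpM2l// ltW.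
have LE : (Lam / r') `^ a = (rho `^ a)^-1.
  have -> : Lam / r' = rho^-1 by rewrite /rho invf_div.
  by rewrite -(powR_inv1 (ltW rho0)) -powRrM mulN1r powRN.
have ra0 : 0 < rho `^ a by rewrite powR_gt0.
have rrE : (r / rho) `^ a = r `^ a / rho `^ a by rewrite powR_divl// ltW.
rewrite rrE LE.
have -> : (C0 * (2 `^ (a / dW) * (r `^ a / rho `^ a)))%:E =
    ((C0 * 2 `^ (a / dW) * r `^ a)%:E * (rho `^ a)^-1%:E)%E.
  by rewrite -EFinM; congr EFin; ring.
rewrite -muleA ge0_muleDr ?lee_fin//.
have -> : ((rho `^ a)^-1%:E * (Lam^-1 * (2 `^ (a + 1) * M * rho `^ a))%:E)%E =
    (2 `^ (a + 1) * (Lam^-1 * M))%:E.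
  by rewrite -EFinM; congr EFin; field; rewrite !gt_eqF.
have -> : (C0 * T * r `^ a)%:E = ((C0 * 2 `^ (a / dW) * r `^ a)%:E * (2 `^ (a + 1))%:E)%E.
  by rewrite -EFinM; congr EFin; rewrite /T; ring.
rewrite -[leRHS]muleA; apply: lee_wpmul2l.
  by rewrite lee_fin !mulr_ge0 ?powR_ge0// ltW.
have LM0 : 0 <= Lam^-1 * M by rewrite mulr_ge0// invr_ge0 ltW.
have oo : (0 <= (rho `^ a)^-1%:E * osc mu f (near_diag r'))%E.
  by rewrite mule_ge0// lee_fin invr_ge0 ltW.
rewrite [leRHS]ge0_muleDr ?lee_fin//; apply: leeD; last by rewrite EFinM.
by rewrite -[leLHS]mul1e lee_wpmul2r// lee_fin.
Qed.

(** The finite constant M only serves to make the best constant N finite; taking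
Lam = max(1, 2 C) turns the comparison of scales into N <= C Lam^a V + N / 2. *)
Lemma weak_monotonicity : exists2 C : R, 0 < C & forall f M V,
  f \in Lfun mu 1 ->
  (forall s, 0 < s -> (osc mu f (near_diag s) <= (M * s `^ a)%:E)%E) -> 0 <= V ->
  (forall e : R, 0 < e -> exists r', [/\ 0 < r', r' < e &
     (osc mu f (near_diag r') <= (V * r' `^ a)%:E)%E]) ->
  forall r, 0 < r -> (osc mu f (near_diag r) <= (C * V * r `^ a)%:E)%E.
Proof.
have [C C0 HC] := osc_comparison_of_scales.
pose Lam := Num.max 1 (2 * C).
have Lam1 : 1 <= Lam by rewrite le_max lexx.
have Lam0 : 0 < Lam by exact: lt_le_trans Lam1.
exists (2 * C * Lam `^ a) => [|f M V f1 HM V0 HV]; first by rewrite !mulr_gt0// powR_gt0.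
have sa s : 0 < s -> 0 < s `^ a :> R by move=> s0; rewrite powR_gt0.
have M0 : 0 <= M.
  have := HM 1 ltr01; rewrite powR1 mulr1 -lee_fin; apply: le_trans.
  exact: osc_ge0.
have o_fin s : 0 < s -> osc mu f (near_diag s) \is a fin_num.
  move=> s0; rewrite ge0_fin_numE ?osc_ge0//.
  by apply: (le_lt_trans (HM s s0)); rewrite ltry.
pose k s := fine (osc mu f (near_diag s)) / s `^ a.
have kE s : 0 < s -> osc mu f (near_diag s) = (k s * s `^ a)%:E.
  by move=> s0; rewrite /k divfK ?fineK ?o_fin// gt_eqF// sa.
pose S := [set x | exists2 s, 0 < s & x = k s].
have S_le K : (forall s, 0 < s -> (osc mu f (near_diag s) <= (K * s `^ a)%:E)%E) <->
    ubound S K.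
  split=> [h x [s s0 ->]|h s s0].
    by have := h s s0; rewrite kE// lee_fin ler_pM2r// sa.
  rewrite kE// lee_fin ler_pM2r ?sa//; apply: h; by exists s.
have hS : has_sup S.
  by split; [exists (k 1), 1|exists M; apply/S_le].
pose N := sup S.
have HN s : 0 < s -> (osc mu f (near_diag s) <= (N * s `^ a)%:E)%E.
  by move=> s0; apply: (S_le N).2 => //; exact: sup_upper_bound.
have N0 : 0 <= N.
  have := HN 1 ltr01; rewrite powR1 mulr1 -lee_fin; apply: le_trans.
  exact: osc_ge0.
have step s : 0 < s -> (osc mu f (near_diag s) <= ((C * (Lam `^ a * V) + N / 2) * s `^ a)%:E)%E.
  move=> s0; have [r' [r'0 r's Hr']] := HV s s0.
  apply: le_trans (HC f N Lam s r' f1 N0 HN Lam1 r'0 (ltW r's)) _.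
  have r'a := sa _ r'0.
  have P0 : 0 <= (Lam / r') `^ a by exact: powR_ge0.
  apply: (@le_trans _ _ ((C * s `^ a)%:E * (((Lam / r') `^ a)%:E * (V * r' `^ a)%:E + (Lam^-1 * N)%:E))%E).
    apply: lee_wpmul2l; first by rewrite lee_fin mulr_ge0// ltW ?sa.
    by apply: leeD => //; apply: lee_wpmul2l.
  rewrite -EFinM lee_fin.
  have -> : (Lam / r') `^ a = Lam `^ a / r' `^ a by rewrite powR_divl// ltW.
  have -> : Lam `^ a / r' `^ a * (V * r' `^ a) = Lam `^ a * V.
    by field; rewrite gt_eqF.
  have CL : C * Lam^-1 <= 2^-1.
    by rewrite ler_pdivrMr// -ler_pdivrMl ?invr_gt0// invrK le_max lexx orbT.
  have CN : C * (Lam^-1 * N) <= N / 2 by rewrite mulrA mulrC ler_wpM2l.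
  rewrite mulrAC ler_wpM2r ?(ltW (sa _ _))// mulrDr; lra.
have : N <= C * (Lam `^ a * V) + N / 2.
  by apply: ge_sup; [have [] := hS|apply/S_le].
move=> hN r r0; apply: (le_trans (HN r r0)); rewrite lee_fin ler_wpM2r ?(ltW (sa _ r0))//.
rewrite -!mulrA; lra.
Qed.

(** Arbitrarily near r = 0 there are scales at which the energy is below
Var f + eps; weak monotonicity applies to them, and eps tends to 0. *)
Lemma BV_osc_le_Var : exists2 C : R, 0 < C & forall f, BV mu dW kappa f ->
  exists v : R, [/\ 0 <= v, Var mu dW kappa f = v%:E &
    forall r, 0 < r -> (osc mu f (near_diag r) <= (C * v * r `^ a)%:E)%E].
Proof.
have [C C0 HC] := weak_monotonicity.
have [c1 [c2 [c10 c20 H]]] := KS_energy_osc A1 A2.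
exists (C * c2) => [|f bvf]; first by rewrite mulr_gt0.
have f1 : f \in Lfun mu 1 by case: bvf.
have mf := Lfun_measurable f1.
have lam : 0 <= dW - kappa <= dW - kappa by rewrite lexx andbT subr_ge0 ltW.
have [M M0 HM] := KS_osc_bound A1 A2 bvf lam.
have Var0 : (0 <= Var mu dW kappa f)%E.
  apply: limf_einf_ge0 => r; apply: integral_ge0 => x _; apply: integral_ge0 => y _.
  by rewrite lee_fin divr_ge0 ?mulr_ge0 ?powR_ge0// fine_ge0.
have Vary : (Var mu dW kappa f < +oo)%E.
  apply: le_lt_trans (limf_einf_le_bound (B := (M / c1)%:E) _) _; last exact: ltry.
  move=> r r0; have /andP[_ h] := H (dW - kappa) f r mf r0; apply: (le_trans h).
  have cr : 0 < c1 * r `^ (dW - kappa + dH) by rewrite mulr_gt0// powR_gt0.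
  rewrite lee_pdivrMl//; apply: (le_trans (HM r r0)).
  by rewrite -EFinM lee_fin le_eqVlt; apply/orP; left; apply/eqP; field; rewrite gt_eqF.
have vE : (fine (Var mu dW kappa f))%:E = Var mu dW kappa f.
  by rewrite fineK// ge0_fin_numE.
exists (fine (Var mu dW kappa f)); split; rewrite ?fine_ge0//.
set v := fine _ => r r0.
have v0 : 0 <= v by rewrite fine_ge0.
have ra0 : 0 < r `^ a by rewrite powR_gt0.
apply/lee_addgt0Pr => e e0.
pose eps := e / (C * c2 * r `^ a).
have eps0 : 0 < eps by rewrite divr_gt0// !mulr_gt0.
have small : (Var mu dW kappa f < (v + eps)%:E)%E by rewrite -vE lte_fin ltrDl.
apply: (@le_trans _ _ (C * (c2 * (v + eps)) * r `^ a)%:E); last first.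
  rewrite -EFinD lee_fin /eps le_eqVlt; apply/orP; left; apply/eqP; field.
  by rewrite !gt_eqF.
apply: (HC f M) => //; first by rewrite mulr_ge0 ?addr_ge0// ltW.
move=> e' e'0; have [r' [r'0 r'e' h]] := limf_einf_lt_near small e'0.
exists r'; split => //.
have /andP[h1 _] := H (dW - kappa) f r' mf r'0.
have cr : 0 < c2 * r' `^ (dW - kappa + dH) by rewrite mulr_gt0// powR_gt0.
have := le_trans h1 (ltW h); rewrite lee_pdivrMl//.
by rewrite -EFinM [c2 * r' `^ _ * _]mulrAC.
Qed.

End WeakMonotonicity.

(** ** Besov seminorms of the subordinated semigroup *)

Section Besov.
Variables (delta : R) (eta : R -> R -> R).
Hypothesis delta_gt0 : 0 < delta.
Hypothesis eta_density : subordinator_density delta eta.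

Let eta_ge0 := eta_ge0 eta_density.

Local Notation D := (`]0%R, +oo[%classic : set R).
Local Notation leb := (@lebesgue_measure R).

Let Dgt0 s : D s -> 0 < s. Proof. by rewrite /= in_itv /= andbT. Qed.

Lemma subordinated_kernel_ge0 t x y : 0 < t ->
  (0 <= subordinated_kernel eta p t x y)%E.
Proof.
move=> t0; apply: integral_ge0 => s Ds; have s0 := Dgt0 Ds.
by rewrite lee_fin mulr_ge0 ?eta_ge0 ?heat_kernel_ge0.
Qed.

(** The times s between a t^(1/delta) = r^dW and 4 t^(1/delta) carry a fixed
proportion of the mass of eta t, and p_s is at least of order r^-dH on
d(x, y) < r for all of them. *)
Lemma subordinated_kernel_lower : exists A c : R, [/\ 0 < A, 0 < c &
  forall r (x y : X), 0 < r ->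
  ((c * r `^ (- dH) * near_diag r x y)%:E <=
     subordinated_kernel eta p ((A * r `^ dW) `^ delta) x y)%E].
Proof.
have [a [c [a0 a4 c0 Hm]]] := eta_mass delta_gt0 eta_density.
have [c1 c10 Hp] := heat_kernel_lower.
pose b := (4 / a) `^ (- (dH / dW)).
have b0 : 0 < b by rewrite powR_gt0// divr_gt0.
exists a^-1, (c1 * b * c); split; rewrite ?invr_gt0 ?mulr_gt0// => r x y r0.
pose t := (a^-1 * r `^ dW) `^ delta.
have rW : 0 < r `^ dW by rewrite powR_gt0.
have t0 : 0 < t by rewrite powR_gt0// mulr_gt0// invr_gt0.
have TE : t `^ delta^-1 = a^-1 * r `^ dW.
  rewrite /t -powRrM mulfV ?gt_eqF// powRr1//.
  by rewrite mulr_ge0 ?powR_ge0// invr_ge0 ltW.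
rewrite -/t /near_diag; case: ltP => xy; last first.
  by rewrite mulr0 subordinated_kernel_ge0.
rewrite mulr1.
have rd0 : 0 < r `^ (- dH) by rewrite powR_gt0.
pose I s : R := (a * t `^ delta^-1 <= s <= 4 * t `^ delta^-1)%R%:R.
apply: (@le_trans _ _ (\int[leb]_(s in D) ((c1 * b * r `^ (- dH)) * (eta t s * I s))%:E)%E).
  rewrite ge0_integralZl_real//; last 3 first.
  - apply: measurable_funM; first exact: eta_measurable eta_density _ t0.
    apply: measurable_funTS; apply: measurable_natr; apply: measurable_and.
      exact: measurable_fun_ler.
    exact: measurable_fun_ler.
  - by move=> s Ds; rewrite mulr_ge0 ?eta_ge0.
  - by rewrite !mulr_ge0// ltW.
  have k0 : (0 <= (c1 * b * r `^ (- dH))%:E)%E by rewrite lee_fin !mulr_ge0// ltW.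
  apply: le_trans (lee_wpmul2l k0 (Hm t t0)).
  by rewrite -EFinM lee_fin le_eqVlt; apply/orP; left; apply/eqP; ring.
apply: ge0_le_integral_nomeas => s Ds; have s0 := Dgt0 Ds.
  rewrite lee_fin; apply: mulr_ge0; last by rewrite mulr_ge0 ?eta_ge0.
  by rewrite !mulr_ge0// ltW.
rewrite lee_fin mulrCA ler_wpM2l ?eta_ge0//.
rewrite /I; case: (boolP (_ && _)) => [|_]; last by rewrite mulr0 heat_kernel_ge0.
rewrite mulr1 TE mulVKf ?gt_eqF// => /andP[s1 s2].
have [rho rho0 rhoE] := time_scale s0.
have rr : r <= rho.
  rewrite leNgt; apply/negP => h.
  have := @gt0_ltr_powR R dW dW0 rho r; rewrite !nnegrE (ltW r0) (ltW rho0) rhoE.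
  by move=> /(_ isT isT h); rewrite ltNge s1.
rewrite -rhoE; apply: le_trans (Hp _ _ _ rho0 (lt_le_trans xy rr)).
rewrite -mulrA ler_wpM2l ?(ltW c10)//.
rewrite -(powR_scale dH r0) -(powR_scale dH rho0) rhoE /b.
have a4' : 0 < 4 / a by rewrite divr_gt0.
have aW : 0 < 4 / a * r `^ dW by rewrite mulr_gt0.
rewrite -powRM ?(ltW rW) ?(ltW a4')//.
rewrite !powRN lef_pV2 ?posrE ?powR_gt0//.
apply: ge0_ler_powR; rewrite ?nnegrE ?(ltW s0) ?(ltW aW)//.
  by rewrite divr_ge0// ltW.
by rewrite -mulrA.
Qed.

(** Test the supremum that defines the seminorm at the time t = (A r^dW)^delta. *)
Lemma besov_lower alpha : exists2 C : R, 0 < C & forall (f : X -> R) r,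
  measurable_fun setT f -> 0 < r ->
  (osc mu f (near_diag r) <=
    (C * r `^ (dW * delta * alpha + dH))%:E * besov_seminorm mu eta p 1 alpha f)%E.
Proof.
have [A [c [A0 c0 H]]] := subordinated_kernel_lower.
exists (A `^ (delta * alpha) / c) => [|f r mf r0]; first by rewrite divr_gt0// powR_gt0.
have rW : 0 < r `^ dW by rewrite powR_gt0.
have rd0 : 0 < r `^ (- dH) by rewrite powR_gt0.
pose t := (A * r `^ dW) `^ delta.
have t0 : 0 < t by rewrite powR_gt0// mulr_gt0.
pose I := (\int[mu]_y \int[mu]_x
  ((`|f x - f y| `^ 1)%:E * subordinated_kernel eta p t x y))%E.
have I0 : (0 <= I)%E.
  apply: integral_ge0 => y _; apply: integral_ge0 => x _.
  by rewrite mule_ge0 ?subordinated_kernel_ge0.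
have cI : ((c * r `^ (- dH))%:E * osc mu f (near_diag r) <= I)%E.
  have c'0 : 0 <= c * r `^ (- dH) by rewrite mulr_ge0// ltW.
  rewrite -oscZ//; last exact: measurable_near_diag.
  rewrite /osc (@fubini_tonelli2 _ _ _ _ _ mu mu)//; last 2 first.
  - apply/measurable_EFinP.
    apply: (measurable_osc (w := fun x y => c * r `^ (- dH) * near_diag r x y)) => //.
    by apply: measurable_funM => //; exact: measurable_near_diag.
  - by move=> z; rewrite lee_fin !mulr_ge0// ltW.
  apply: ge0_le_integral_nomeas => y _.
    by apply: integral_ge0 => x _; rewrite lee_fin mulr_ge0// mulr_ge0.
  apply: ge0_le_integral_nomeas => x _.
    by rewrite lee_fin mulr_ge0// mulr_ge0.
  by rewrite powRr1//= EFinM lee_wpmul2l// H.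
have IS : ((t `^ (- alpha))%:E * I <= besov_seminorm mu eta p 1 alpha f)%E.
  apply: ereal_sup_ubound; exists t => //.
  by rewrite invr1 poweRe1.
have ta0 : 0 < t `^ (- alpha) by rewrite powR_gt0.
have : ((t `^ (- alpha) * (c * r `^ (- dH)))%:E * osc mu f (near_diag r) <=
    besov_seminorm mu eta p 1 alpha f)%E.
  apply: le_trans IS; rewrite EFinM -muleA; apply: lee_wpmul2l => //.
  by rewrite lee_fin ltW.
have -> : t `^ (- alpha) * (c * r `^ (- dH)) =
    (A `^ (delta * alpha) / c * r `^ (dW * delta * alpha + dH))^-1.
  rewrite -(mulrA dW delta) powRN /t -powRrM powRM ?(ltW A0) ?(ltW rW)// -powRrM mulrA powRN.
  rewrite powRD; last by apply/implyP => _; rewrite gt_eqF.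
  have : 0 < A `^ (delta * alpha) by rewrite powR_gt0.
  have : 0 < r `^ (dW * (delta * alpha)) by rewrite powR_gt0.
  have : 0 < r `^ dH by rewrite powR_gt0.
  move: (A `^ _) (r `^ dH) (r `^ (_ * _)) => u v w v0 w0 u0.
  by field; rewrite !gt_eqF.
by rewrite lee_pdivrMl// mulr_gt0 ?powR_gt0// divr_gt0// powR_gt0.
Qed.

(** Bound p_s by a power decay at scale s^(1/dW), exchange the integrals over s and
(x, y), apply the dyadic estimate for each s, and use the moment of order
lambda / dW of eta t. *)
Lemma besov_upper lambda : 0 < lambda -> lambda < delta * dW ->
  exists2 C : R, 0 < C & forall (f : X -> R) M, measurable_fun setT f -> 0 <= M ->
  (forall r, 0 < r -> (osc mu f (near_diag r) <= (M * r `^ (lambda + dH))%:E)%E) ->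
  (besov_seminorm mu eta p 1 (lambda / (delta * dW)) f <= (C * M)%:E)%E.
Proof.
move=> lam0 lamd; pose a := lambda + dH.
have a0 : 0 < a by rewrite addr_gt0.
pose th := lambda / dW.
have th0 : 0 < th by rewrite divr_gt0.
have thd : th < delta by rewrite ltr_pdivrMr.
have [K K0 HK'] := heat_kernel_upper (a + 1).
have [L L0 HL] := eta_moment delta_gt0 eta_density th0 thd.
exists (K * 2 `^ (a + 1) * L) => [|f M mf M0 HM]; first by rewrite !mulr_gt0// powR_gt0.
apply: ge_ereal_sup => _ [t /= t0 <-].
have me := eta_measurable eta_density t0.
pose h s : R := (0 < s)%R%:R * (eta t s * s `^ (- (dH / dW))).
pose w s (x y : X) : R := decay (a + 1) (mdist x y / (s `^ dW^-1)).
pose G (zs : (X * X) * R) : \bar R :=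
  (h zs.2 * (`|f zs.1.1 - f zs.1.2| * w zs.2 zs.1.1 zs.1.2))%:E.
have h0 s : 0 <= h s.
  rewrite /h; case: ltP => s0; last by rewrite mul0r.
  by rewrite mul1r mulr_ge0 ?powR_ge0// eta_ge0//= in_itv /= s0.
have w0 s x y : 0 <= w s x y by exact: decay_ge0.
have G0 zs : (0 <= G zs)%E by rewrite lee_fin mulr_ge0// mulr_ge0.
have mh : measurable_fun setT h.
  rewrite (_ : h = (fun s => eta t s * s `^ (- (dH / dW))) \_ D).
    apply/(measurable_restrictT _ _).1 => //.
    apply: measurable_funM => //; apply: measurable_funTS; exact: measurable_powR.
  apply/funext => s; rewrite patchE /h.
  case: ifPn => [|]; first by rewrite inE => /Dgt0 ->; rewrite mul1r.
  rewrite notin_setE /= in_itv /= andbT => /negP/negbTE ->.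
  by rewrite mul0r.
have m1 : measurable_fun setT (fun zs : (X * X) * R => zs.1) by exact: measurable_fst.
have m2 : measurable_fun setT (fun zs : (X * X) * R => zs.2) by exact: measurable_snd.
have mdf : measurable_fun setT (fun z : X * X => `|f z.1 - f z.2|).
  apply: measurableT_comp => //; apply: measurable_funB.
    exact: measurableT_comp mf measurable_fst.
  exact: measurableT_comp mf measurable_snd.
have mG : measurable_fun setT G.
  apply/measurable_EFinP; apply: measurable_funM; first exact: measurableT_comp mh m2.
  apply: measurable_funM; first exact: measurableT_comp mdf m1.
  rewrite (_ : (fun zs => _) = (fun zs : (X * X) * R =>
      Num.max 1 (mdist zs.1.1 zs.1.2 * zs.2 `^ (- dW^-1)) `^ (- (a + 1)))); last first.
    by apply/funext => zs; rewrite /w /decay (powRN zs.2).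
  apply: (measurableT_comp (measurable_powR _)); apply: measurable_maxr => //.
  apply: measurable_funM.
    exact: measurableT_comp (@measurable_mdist _ _ _ A1) m1.
  exact: measurableT_comp (measurable_powR _) m2.
pose J := (\int[square_measure mu]_z \int[leb]_s G (z, s))%E.
have U : (\int[mu]_y \int[mu]_x
    ((`|f x - f y| `^ 1)%:E * subordinated_kernel eta p t x y) <= K%:E * J)%E.
  have mJ : measurable_fun setT (fun z => \int[leb]_s G (z, s))%E.
    have := @measurable_fun_fubini_tonelli_F _ _ _ _ _ lebesgue_measure G mG G0.
    exact.
  have J0 z : (0 <= \int[leb]_s G (z, s))%E by apply: integral_ge0 => s _; exact: G0.
  rewrite /J -(ge0_integralZl _ measurableT mJ)// ?lee_fin ?(ltW K0)//.
  rewrite [leRHS](@fubini_tonelli2 _ _ _ _ _ mu mu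
     (fun z => K%:E * \int[leb]_s G (z, s))%E); last 2 first.
  - by apply: measurable_funeM.
  - by move=> z; rewrite mule_ge0// lee_fin ltW.
  apply: ge0_le_integral_nomeas => y _.
    by apply: integral_ge0 => x _; rewrite mule_ge0 ?subordinated_kernel_ge0.
  apply: ge0_le_integral_nomeas => x _.
    by rewrite mule_ge0 ?subordinated_kernel_ge0.
  have mGz : measurable_fun setT (fun s => G ((x, y), s)).
    exact: measurableT_comp mG (pair1_measurable (x, y)).
  rewrite powRr1// -(ge0_integralZl leb measurableT mGz)// ?lee_fin ?(ltW K0)//.
  pose g s : R := eta t s * (K * s `^ (- (dH / dW)) * w s x y).
  have mw : measurable_fun setT (fun s => w s x y).
    rewrite (_ : (fun s => _) = (fun s => Num.max 1 (mdist x y * s `^ (- dW^-1)) `^ (- (a + 1)))).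
      apply: (measurableT_comp (measurable_powR _)); apply: measurable_maxr => //.
      by apply: measurable_funM => //; exact: measurable_powR.
    by apply/funext => s; rewrite /w /decay (powRN s).
  have mg : measurable_fun D g.
    apply: measurable_funM => //; apply: measurable_funTS; apply: measurable_funM => //.
    by apply: measurable_funM => //; exact: measurable_powR.
  have g0 s : D s -> 0 <= g s.
    by move=> Ds; rewrite mulr_ge0 ?eta_ge0// !mulr_ge0 ?powR_ge0// ltW.
  apply: (@le_trans _ _ (`|f x - f y|%:E * \int[leb]_(s in D) (g s)%:E)%E).
    apply: lee_wpmul2l; first by rewrite lee_fin.
    apply: ge0_le_integral_nomeas => s Ds; have s0 := Dgt0 Ds.
      by rewrite lee_fin mulr_ge0 ?eta_ge0 ?heat_kernel_ge0.
    rewrite lee_fin /g ler_wpM2l ?eta_ge0//.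
    have [rho rho0 rhoE] := time_scale s0.
    have -> : w s x y = decay (a + 1) (mdist x y / rho).
      by rewrite /w -rhoE -powRrM mulfV ?gt_eqF// powRr1// ltW.
    by rewrite -rhoE powR_scale//; exact: HK'.
  rewrite -ge0_integralZl_real// integral_mkcond.
  apply: ge0_le_integral_nomeas => s _.
    by apply: erestrict_ge0 => s' Ds'; rewrite lee_fin mulr_ge0// g0.
  rewrite patchE; case: ifPn => [|_]; last by rewrite mule_ge0// lee_fin ltW.
  rewrite inE => /Dgt0 s0; rewrite /G /h s0 -EFinM lee_fin /g /=.
  by rewrite le_eqVlt; apply/orP; left; apply/eqP; ring.
have JB : (J <= (2 `^ (a + 1) * M * (L * t `^ (th / delta)))%:E)%E.
  have BM0 : 0 <= 2 `^ (a + 1) * M by rewrite mulr_ge0 ?powR_ge0.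
  have jl := lee_wpmul2l (_ : (0 <= (2 `^ (a + 1) * M)%:E)%E) (HL t t0).
  rewrite EFinM; apply: le_trans (jl _); last by rewrite lee_fin.
  rewrite -ge0_integralZl_real//; last 2 first.
  - by apply: measurable_funM => //; apply: measurable_funTS; exact: measurable_powR.
  - by move=> s Ds; rewrite mulr_ge0 ?powR_ge0 ?eta_ge0.
  rewrite /J (@fubini_tonelli _ _ _ _ _ (square_measure mu) leb G)//.
  rewrite [leRHS]integral_mkcond; apply: ge0_le_integral_nomeas => s _.
    by apply: integral_ge0 => z _; exact: G0.
  have mws : measurable_fun setT (fun z : X * X => w s z.1 z.2).
    by apply: measurable_decay; exact: measurable_mdist.
  have -> : (\int[square_measure mu]_z G (z, s) = (h s)%:E * osc mu f (w s))%E.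
    rewrite /osc -ge0_integralZl_real//.
      exact: measurable_osc.
    by move=> z _; rewrite mulr_ge0.
  rewrite patchE; case: ifPn => [|]; last first.
    rewrite notin_setE /= in_itv /= andbT => /negP/negbTE s0.
    by rewrite /h s0 mul0r mul0e.
  rewrite inE => /[dup] Ds /Dgt0 s0.
  have [rho rho0 rhoE] := time_scale s0.
  have wE : w s = (fun x y => decay (a + 1) (mdist x y / rho)).
    apply/funext => x; apply/funext => y.
    by rewrite /w -rhoE -powRrM mulfV ?gt_eqF// powRr1// ltW.
  have oB : (osc mu f (w s) <= (2 `^ (a + 1) * M * rho `^ a)%:E)%E.
    rewrite wE.
    by apply: (integral_decay_le mdf _ (@measurable_mdist _ _ _ A1) (ltW a0) M0 _ rho0) => [z|r r0] //; exact: HM.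
  have hs0 : (0 <= (h s)%:E)%E by rewrite lee_fin.
  apply: le_trans (lee_wpmul2l hs0 oB) _.
  rewrite -EFinM lee_fin /h s0 mul1r.
  have -> : s `^ th = s `^ (- (dH / dW)) * rho `^ a.
    rewrite -rhoE powR_scale// -powRrM -powRD; last by apply/implyP => _; rewrite gt_eqF.
    congr (_ `^ _); rewrite /th /a; field.
    by rewrite gt_eqF.
  by rewrite le_eqVlt; apply/orP; left; apply/eqP; ring.
have thE : lambda / (delta * dW) = th / delta.
  by rewrite /th; field; rewrite !gt_eqF.
have I0 : (0 <= \int[mu]_y \int[mu]_x
    ((`|f x - f y| `^ 1)%:E * subordinated_kernel eta p t x y))%E.
  apply: integral_ge0 => y _; apply: integral_ge0 => x _.
  by rewrite mule_ge0 ?subordinated_kernel_ge0.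
rewrite invr1 poweRe1// thE.
have ta0 : 0 < t `^ (th / delta) by rewrite powR_gt0.
have tN0 : (0 <= (t `^ (- (th / delta)))%:E)%E by rewrite lee_fin powR_ge0.
apply: le_trans (lee_wpmul2l tN0 U) _.
have KE0 : (0 <= K%:E)%E by rewrite lee_fin ltW.
apply: le_trans (lee_wpmul2l tN0 (lee_wpmul2l KE0 JB)) _.
rewrite -!EFinM lee_fin powRN le_eqVlt; apply/orP; left; apply/eqP; field.
by rewrite gt_eqF.
Qed.

End Besov.

End HeatFlow.

(** * Identification of the critical Besov class *)

Unset Implicit Arguments.

Theorem theorem4p4 (R : realType) (d : measure_display)
  (X : borelMetricType R d) (mu : {sigma_finite_measure set X -> \bar R})
  (F : set (X -> R)) (E : (X -> R) -> (X -> R) -> R)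
  (P : R -> (X -> R) -> X -> R) (p : R -> X -> X -> R)
  (dH dW kappa delta : R) (eta : R -> R -> R)
  (X_loc_compact : locally_compact [set: X])
  (mu_radon : radon mu) (mu_supp : fully_supported mu)
  (E_dirichlet : dirichlet_form mu F E)
  (P_heat : heat_semigroup mu F E P)
  (A1 : proper_balls X)
  (dH_gt0 : 0 < dH) (A2 : ahlfors_regular mu dH)
  (A3_regular : regular_form mu F E) (A3_local : strongly_local mu F E)
  (HK_kernel : continuous_heat_kernel mu P p)
  (dW_ge2 : 2 <= dW) (HK : sub_gaussian_bounds mu dH dW p)
  (kappa_gt0 : 0 < kappa) (kappa_lt : kappa < dW)
  (kappa_def : KS_critical mu = (dW - kappa)%:E)
  (BE : weak_bakry_emery mu kappa dW p)
  (delta_gt0 : 0 < delta) (delta_lt1 : delta < 1)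
  (eta_density : subordinator_density delta eta)
  (alpha_lt1 : (besov_critical mu eta p < 1)%E) :
  besov mu eta p 1 (fine (besov_critical mu eta p)) = BV mu dW kappa /\
  exists c C : R, [/\ 0 < c, 0 < C &
    forall f, BV mu dW kappa f ->
      (c%:E * Var mu dW kappa f
         <= besov_seminorm mu eta p 1 (delta^-1 * (1 - kappa / dW))%R f
         <= C%:E * Var mu dW kappa f)%E].
Proof.
have dW0 : 0 < dW by rewrite (lt_le_trans _ dW_ge2).
pose lam := dW - kappa.
have lam0 : 0 < lam by rewrite subr_gt0.
pose al := delta^-1 * (1 - kappa / dW).
have alE : al = lam / (delta * dW) by rewrite /al /lam; field; rewrite !gt_eqF.
have ddW : 0 < delta * dW by rewrite mulr_gt0.
have al0 : 0 < al by rewrite alE divr_gt0.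
have [cK cK0 HK2] := KS_of_osc_bound A1 A2.
have low alpha := besov_lower mu_supp A1 dH_gt0 HK_kernel dW_ge2 HK delta_gt0 eta_density alpha.
have up l := @besov_upper _ _ _ _ _ _ _ _ mu_supp A1 dH_gt0 HK_kernel dW_ge2 HK _ _ delta_gt0 eta_density l.
(* The condition alpha < 1 makes the moment of the stable law that bounds the
seminorm finite. *)
have KS_besov l alpha f : KS mu l 1 f -> 0 < alpha -> alpha < 1 ->
    alpha * (delta * dW) <= l -> besov mu eta p 1 alpha f.
  move=> fKS alpha0 alpha1 al_l; have f1 : f \in Lfun mu 1 by case: fKS.
  have l0 : 0 < alpha * (delta * dW) by rewrite mulr_gt0.
  have lb : 0 <= alpha * (delta * dW) <= l by rewrite (ltW l0).
  have [M M0 HM] := KS_osc_bound A1 A2 fKS lb.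
  have l1 : alpha * (delta * dW) < delta * dW by rewrite gtr_pMl.
  have [C C0 HC] := up _ l0 l1.
  split => //; have := HC f M (Lfun_measurable f1) M0 HM.
  rewrite mulfK ?gt_eqF// => h; apply: (le_lt_trans h); exact: ltry.
have besov_KS alpha f : besov mu eta p 1 alpha f -> KS mu (dW * delta * alpha) 1 f.
  move=> [f1 fB]; split => //.
  have [C C0 HC] := low alpha.
  have mf := Lfun_measurable f1.
  apply: (le_lt_trans (limf_esup_le_bound (B := (C / cK)%:E * besov_seminorm mu eta p 1 alpha f)%E _)).
    by apply: HK2 => // r r0; exact: HC.
  by apply: lte_mul_pinfty => //; rewrite lee_fin divr_ge0// ltW.
have crit_ge alpha : 0 < alpha -> alpha < 1 -> alpha < al ->
    (alpha%:E <= besov_critical mu eta p)%E.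
  move=> alpha0 alpha1 alphal.
  have : ((alpha * (delta * dW))%:E < KS_critical mu)%E.
    by rewrite kappa_def lte_fin -ltr_pdivlMr// -alE.
  move=> /ereal_sup_gt[_ [l [l0 [f fKS fn]] <-]]; rewrite lte_fin => al_l.
  apply: ereal_sup_ubound; exists alpha => //; split => //.
  exists f => //; exact: KS_besov fKS alpha0 alpha1 (ltW al_l).
(* Otherwise crit_ge would apply to every alpha < 1 and the critical exponent
would be at least 1. *)
have al1 : al < 1.
  rewrite ltNge; apply/negP => al_ge1.
  have : (1 <= besov_critical mu eta p)%E.
    apply/lee_subgt0Pr => e e0.
    have [e1|e1] := ltP e 1; last first.
      apply: (@le_trans _ _ (2^-1)%:E); last by apply: crit_ge; lra.
      by rewrite -EFinB lee_fin; lra.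
    by rewrite -EFinB; apply: crit_ge; lra.
  by rewrite leNgt alpha_lt1.
have critE : besov_critical mu eta p = al%:E.
  apply/eqP; rewrite eq_le; apply/andP; split.
    apply: ge_ereal_sup => _ [alpha [alpha0 [f fB fn]] <-].
    rewrite lee_fin alE ler_pdivlMr// -lee_fin -[leRHS]kappa_def.
    apply: ereal_sup_ubound; exists (dW * delta * alpha).
      split; first by rewrite !mulr_gt0.
      by exists f => //; exact: besov_KS.
    by rewrite mulrC (mulrC delta).
  apply/lee_subgt0Pr => e e0; rewrite -EFinB.
  have [ea|ea] := ltP e al; first by apply: crit_ge; lra.
  apply: (@le_trans _ _ (al / 2)%:E); last by apply: crit_ge; lra.
  by rewrite lee_fin; lra.
have lamE : dW * delta * al = lam by rewrite alE; field; rewrite !gt_eqF.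
have lamE' : al * (delta * dW) = lam by rewrite -lamE; ring.
rewrite critE /=; split.
  apply/seteqP; split => f.
    by move=> /besov_KS; rewrite lamE.
  by move=> fBV; apply: (KS_besov lam) => //; rewrite lamE'.
have [C C0 HC] := low al.
have [C1 C10 HC1] := BV_osc_le_Var mu_supp A1 dH_gt0 A2 P_heat HK_kernel dW_ge2 HK kappa_gt0 kappa_lt BE.
have lam1 : lam < delta * dW by rewrite -lamE' gtr_pMl.
have [C2 C20 HC2] := up _ lam0 lam1.
have CcK0 : 0 < C / cK by rewrite divr_gt0.
exists (C / cK)^-1, (C2 * C1); split => [||f fBV].
- by rewrite invr_gt0.
- exact: mulr_gt0.
have f1 : f \in Lfun mu 1 by case: fBV.
have mf := Lfun_measurable f1.
have [v [v0 vE Hv]] := HC1 f fBV.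
apply/andP; split.
  rewrite lee_pdivrMl ?divr_gt0//.
  apply: limf_einf_le_bound => r r0.
  by apply: HK2 => // s s0; rewrite -/lam -lamE; exact: HC.
rewrite vE -EFinM -mulrA -/al alE; apply: HC2 => //.
by rewrite mulr_ge0// ltW.
Qed.
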